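(* Let $K$ be a positive definite kernel on the Euclidean unit ball $\mathbb B^m\subset\mathbb C^m$ with $K(w,w)>0$ for all $w\in\mathbb B^m$, and assume that the adjoint $\boldsymbol M^*=(M_1^*,\ldots,M_m^* )$ of the tuple $\boldsymbol M$ of multiplications by the coordinate functions on the reproducing kernel Hilbert space $\mathcal H_K$ belongs to $B_1(\mathbb B^m)$. Then the function $$\Big(\frac{\partial^2}{\partial w_i\,\partial\bar w_j}\log\big((1-\langle w,w\rangle)K(w,w)\big)\Big)_{i,j=1}^m,\quad w\in\mathbb B^m,$$ is a positive definite function on $\mathbb B^m$, or equivalently $$\mathsf K_{\boldsymbol M^*}(w)\preceq\mathsf K_{\boldsymbol R_m^*}(w),\quad w\in\mathbb B^m,$$ if and only if the multiplication tuple $\boldsymbol M$ is an infinitely divisible row contraction.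
   Context: Positive definite kernel: a function $L:U\times U\to M_n(\mathbb C)$ ($n\ge1$, $U\subseteq\mathbb C^m$ open), holomorphic in the first variable and anti-holomorphic in the second, is a positive definite kernel on $U$ if $\sum_{p,q}\langle L(u_p,u_q)\xi_q,\xi_p\rangle_{\mathbb C^n}\ge0$ for all finite choices $u_1,\ldots,u_l\in U$, $\xi_1,\ldots,\xi_l\in\mathbb C^n$ (scalar kernels: $n=1$). Positive definite function: a real analytic ($M_n(\mathbb C)$-valued) function $G$ on a connected open set $U$ is a positive definite function on $U$ if its polarization $\widetilde G$ (the unique function on $U\times U$, holomorphic in the first variable, anti-holomorphic in the second, with $\widetilde G(w,w)=G(w)$) is defined on $U\times U$ and is a positive definite kernel on $U$. $G_1\preceq G_2$ means that $G_2-G_1$ is a positive definite function on $U$. Infinite divisibility: for $L$ holomorphic in the first and anti-holomorphic in the second variable on $U\times U$ and positive on the diagonal, $L^t$ ($t>0$) is the polarization of $w\mapsto L(w,w)^t$; $L$ is infinitely divisible if for every $t>0$, $L^t$ is (defined on $U\times U$ and) a positive definite kernel on $U$. $\boldsymbol M$ on $\mathcal H_K$ is an infinitely divisible row contraction if $(1-\langle z,w\rangle)K(z,w)$ is infinitely divisible on $\mathbb B^m$. $B_1(D)$ for a bounded domain $D\subset\mathbb C^m$: the commuting tuples $\boldsymbol T=(T_1,\ldots,T_m)$ of bounded operators on a separable complex Hilbert space $\mathcal H$ such that for all $w\in D$ the operator $D_{\boldsymbol T-w}:x\mapsto((T_1-w_1)x,\ldots,(T_m-w_m)x)$ has closed range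 and one-dimensional kernel, and the span of $\{\ker D_{\boldsymbol T-w}:w\in D\}$ is dense in $\mathcal H$. Curvatures: $\mathsf K_{\boldsymbol M^*}(w)=\big(-\frac{\partial^2}{\partial w_i\partial\bar w_j}\log K(w,w)\big)_{i,j=1}^m$. $\boldsymbol R_m^*$ is the adjoint of the coordinate multiplication tuple on the Drury-Arveson space $H^2_m$, with reproducing kernel $\frac{1}{1-\langle z,w\rangle}$, so $\mathsf K_{\boldsymbol R_m^*}(w)=\big(-\frac{\partial^2}{\partial w_i\partial\bar w_j}\log\frac1{1-\langle w,w\rangle}\big)_{i,j=1}^m$. *)

(* Defs.v *)
From HB Require Import structures.
From mathcomp Require Import all_boot all_order all_algebra.
From mathcomp Require Import all_classical all_reals all_analysis.
From mathcomp Require Import complex.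

Set Implicit Arguments.
Unset Strict Implicit.
Unset Printing Implicit Defensive.

Import Order.TTheory GRing.Theory Num.Theory Num.Def.
Import numFieldNormedType.Exports.

Local Open Scope classical_set_scope.
Local Open Scope complex_scope.
Local Open Scope ring_scope.

(* As numFieldNormedType does for abstract number fields. *)
HB.instance Definition _ (R : rcfType) := PseudoPointedMetric.copy R[i] R[i]^o.
HB.instance Definition _ (R : rcfType) := GRing.ComAlgebra.copy R[i] R[i]^o.
HB.instance Definition _ (R : rcfType) := Vector.copy R[i] R[i]^o.
HB.instance Definition _ (R : rcfType) := NormedModule.copy R[i] R[i]^o.

(* C^m is 'rV[R[i]]_m, for R a realType.  An inequality in R[i] also asserts
   that the difference of its two sides is real. *)

Definition vdot (R : realType) (n : nat) (x y : 'rV[R[i]]_n) : R[i] :=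
  \sum_(k < n) x 0 k * conjC (y 0 k).

Definition unit_ball (R : realType) (m : nat) : set 'rV[R[i]]_m :=
  [set z | vdot z z < 1].

Section Kernels.
Context {R : realType} {m : nat}.
Implicit Types U : set 'rV[R[i]]_m.

(* Complex (Frechet) differentiability, R[i] being the base field. *)
Definition holomorphic_on (n : nat) U (f : 'rV[R[i]]_m -> 'M[R[i]]_n) : Prop :=
  forall z, U z -> differentiable f z.

(* Anti-holomorphy of a function is holomorphy of its entrywise conjugate. *)
Definition sesquiholomorphic (n : nat) U
    (L : 'rV[R[i]]_m -> 'rV[R[i]]_m -> 'M[R[i]]_n) : Prop :=
  (forall w, U w -> holomorphic_on U (fun z => L z w)) /\
  (forall z, U z -> holomorphic_on U (fun w => map_mx conjC (L z w))).

Definition pos_def_kernel (n : nat) U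
    (L : 'rV[R[i]]_m -> 'rV[R[i]]_m -> 'M[R[i]]_n) : Prop :=
  sesquiholomorphic U L /\
  forall (l : nat) (u : 'I_l -> 'rV[R[i]]_m) (xi : 'I_l -> 'cV[R[i]]_n),
    (forall p, U (u p)) ->
    0 <= \sum_(p < l) \sum_(q < l)
           vdot (L (u p) (u q) *m xi q)^T (xi p)^T.

Definition polarization (n : nat) U (G : 'rV[R[i]]_m -> 'M[R[i]]_n)
    (Gt : 'rV[R[i]]_m -> 'rV[R[i]]_m -> 'M[R[i]]_n) : Prop :=
  sesquiholomorphic U Gt /\ forall w, U w -> Gt w w = G w.

(* To be used with U open and connected: the polarization is then unique, and
   its existence on U x U forces G to be real analytic on U. *)
Definition pos_def_function (n : nat) U (G : 'rV[R[i]]_m -> 'M[R[i]]_n) : Prop :=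
  exists2 Gt, polarization U G Gt & pos_def_kernel U Gt.

Definition pd_le (n : nat) U (G1 G2 : 'rV[R[i]]_m -> 'M[R[i]]_n) : Prop :=
  pos_def_function U (fun w => G2 w - G1 w).

Definition scalar_fun (g : 'rV[R[i]]_m -> R[i]) : 'rV[R[i]]_m -> 'M[R[i]]_1 :=
  fun w => (g w)%:M.

Definition scalar_kernel (L : 'rV[R[i]]_m -> 'rV[R[i]]_m -> R[i]) :
    'rV[R[i]]_m -> 'rV[R[i]]_m -> 'M[R[i]]_1 :=
  fun z w => (L z w)%:M.

Definition infinitely_divisible U
    (L : 'rV[R[i]]_m -> 'rV[R[i]]_m -> R[i]) : Prop :=
  [/\ sesquiholomorphic U (scalar_kernel L),
      forall w, U w -> 0 < L w w &
      forall t : R, 0 < t ->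
        pos_def_function U
          (scalar_fun (fun w => (complex.Re (L w w) `^ t)%:C))].

(* The condition on the multiplication tuple on the reproducing kernel Hilbert
   space of K. *)
Definition inf_div_row_contraction
    (K : 'rV[R[i]]_m -> 'rV[R[i]]_m -> R[i]) : Prop :=
  infinitely_divisible (@unit_ball R m) (fun z w => (1 - vdot z w) * K z w).

(* Derivative at w along the real line spanned by v. *)
Definition real_dir_deriv (v : 'rV[R[i]]_m) (f : 'rV[R[i]]_m -> R[i])
    (w : 'rV[R[i]]_m) : R[i] :=
  derive1 (fun t : R => complex.Re (f (w + t%:C *: v))) 0
  +i* derive1 (fun t : R => complex.Im (f (w + t%:C *: v))) 0.

(* Wirtinger derivatives: d/dw_i = (d/dx_i - i d/dy_i) / 2 and
   d/d(conj w_i) = (d/dx_i + i d/dy_i) / 2, where w_i = x_i + i y_i. *)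
Definition d_dw (i : 'I_m) (f : 'rV[R[i]]_m -> R[i]) (w : 'rV[R[i]]_m) : R[i] :=
  (real_dir_deriv (delta_mx 0 i) f w
   - 'i%C * real_dir_deriv ('i%C *: delta_mx 0 i) f w) / 2.

Definition d_dwbar (i : 'I_m) (f : 'rV[R[i]]_m -> R[i]) (w : 'rV[R[i]]_m) : R[i] :=
  (real_dir_deriv (delta_mx 0 i) f w
   + 'i%C * real_dir_deriv ('i%C *: delta_mx 0 i) f w) / 2.

Definition log_diag (L : 'rV[R[i]]_m -> 'rV[R[i]]_m -> R[i])
    (w : 'rV[R[i]]_m) : R[i] :=
  (ln (complex.Re (L w w)))%:C.

Definition ddbar_log (L : 'rV[R[i]]_m -> 'rV[R[i]]_m -> R[i])
    (w : 'rV[R[i]]_m) : 'M[R[i]]_m :=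
  \matrix_(i, j) d_dw i (d_dwbar j (log_diag L)) w.

Definition curvature (L : 'rV[R[i]]_m -> 'rV[R[i]]_m -> R[i])
    (w : 'rV[R[i]]_m) : 'M[R[i]]_m :=
  \matrix_(i, j) - d_dw i (d_dwbar j (log_diag L)) w.

Definition drury_arveson (z w : 'rV[R[i]]_m) : R[i] := (1 - vdot z w)^-1.

End Kernels.

(* {dot _ for conjC} is linear in its first argument. *)
Record hilbert (R : realType) := Hilbert {
  hilbert_space :> completeNormedModType R[i];
  inner : {dot hilbert_space for @conjC R[i]};
  innerE : forall x : hilbert_space, `|x| ^+ 2 = inner x x
}.

Section Operators.
Context {R : realType} {m : nat}.

(* H, with ev f z the value of f at z, is a Hilbert space of functions on U
   whose reproducing kernel is K; by Moore-Aronszajn it is unique up to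
   isomorphism. *)
Definition is_rkhs (U : set 'rV[R[i]]_m)
    (K : 'rV[R[i]]_m -> 'rV[R[i]]_m -> R[i])
    (H : hilbert R) (ev : H -> 'rV[R[i]]_m -> R[i]) : Prop :=
  [/\ forall (a : R[i]) (f g : H) z, U z ->
        ev (a *: f + g) z = a * ev f z + ev g z,
      forall f g : H, (forall z, U z -> ev f z = ev g z) -> f = g &
      forall w, U w -> exists2 k : H,
        forall z, U z -> ev k z = K z w &
        forall f : H, ev f w = inner H f k].

Definition coordinate_multiplication (U : set 'rV[R[i]]_m)
    (H : hilbert R) (ev : H -> 'rV[R[i]]_m -> R[i])
    (M : 'I_m -> {linear H -> H}) : Prop :=
  forall i, continuous (M i) /\
    forall (f : H) z, U z -> ev (M i f) z = z 0 i * ev f z.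

Definition adjoint_tuple (H : hilbert R) (M Mstar : 'I_m -> {linear H -> H}) :
    Prop :=
  forall i (x y : H), inner H (M i x) y = inner H x (Mstar i y).

(* The operator D_{T - w}, with values in the m-fold direct sum of H. *)
Definition D_op (H : hilbert R) (T : 'I_m -> {linear H -> H})
    (w : 'rV[R[i]]_m) (x : H) : 'rV[H]_m :=
  \row_i (T i x - w 0 i *: x).

Definition ker_D (H : hilbert R) (T : 'I_m -> {linear H -> H})
    (w : 'rV[R[i]]_m) : set H :=
  [set x | forall i, T i x = w 0 i *: x].

Definition lin_span (H : hilbert R) (A : set H) : set H :=
  [set y | exists (n : nat) (c : 'I_n -> R[i]) (x : 'I_n -> H),
     (forall i, A (x i)) /\ y = \sum_(i < n) c i *: x i].

Definition in_B1 (D : set 'rV[R[i]]_m) (H : hilbert R)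
    (T : 'I_m -> {linear H -> H}) : Prop :=
  [/\ exists2 S : set H, countable S & dense S,
      forall i, continuous (T i),
      forall i j (x : H), T i (T j x) = T j (T i x),
      forall w, D w ->
        closed (range (D_op T w)) /\
        exists2 e : H, e != 0 & ker_D T w = range (fun c : R[i] => c *: e) &
      dense (lin_span (\bigcup_(w in D) ker_D T w))].

End Operators.

(* Main.v *)
Require Import Defs.
From HB Require Import structures.
From mathcomp Require Import all_boot all_order all_algebra.
From mathcomp Require Import all_classical all_reals all_analysis.
From mathcomp Require Import complex.
From mathcomp Require Import ring lra.
Set Implicit Arguments.
Unset Strict Implicit.
Unset Printing Implicit Defensive.
Import Order.TTheory GRing.Theory Num.Theory Num.Def.
Import numFieldNormedType.Exports.
Local Open Scope classical_set_scope.
Local Open Scope complex_scope.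
Local Open Scope ring_scope.

(** Write L(z, w) = (1 - <z, w>) K(z, w) and let F(z, w) = L(z, conj w) be the
    corresponding holomorphic function on B x B; for the ball B, conjugation of the
    second argument exchanges kernels and holomorphic functions, and a function on
    the diagonal has at most one polarization (polarization_unique).

    The two conditions on curvatures agree because the mixed derivatives of log are
    additive on products: those of log L are those of log K minus those of the
    logarithm of the Drury-Arveson kernel (ddbar_row_kernel).

    Suppose that L is infinitely divisible.  The polarized root p_n of order n + 1
    is a positive definite kernel, hence bounded by its diagonal values, uniformly
    in n.  A zero of F would be a zero of all p_n, so F = p_n ^ (n + 1) would be
    arbitrarily small near it and F would vanish (divisible_neq0).  Then p_n tends
    to 1, and (n + 1) times the matrix of mixed derivatives of p_n, a positive
    definite kernel as a limit of second differences (pdk_derivative), tends to the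
    matrix of mixed derivatives of log F (divisible_ddbar).

    Conversely, let G be the positive definite polarization of the matrix of mixed
    derivatives of log L.  Its double integral N over the squares spanned by z and w
    is a scalar positive definite kernel, being a limit of Riemann sums
    (potential_pdk).  Near the origin, where log F is defined, the integral
    telescopes, and the identity theorem gives
        F(z, w) F(0, 0) = F(z, 0) F(0, w) e^N(z, w)
    on the whole of B x B (potential_exp).  In particular F(z, 0) does not vanish
    and has a logarithm h on B (log_branch).  So L^t is the product of e^(tN), which
    is positive definite by Schur's product theorem (pdk_cexp), and of a kernel of
    rank one (divisible_of_mixed).

    All this needs F to be jointly holomorphic.  By Osgood's lemma it is enough that
    K is locally bounded, and a positive definite kernel is so as soon as it is
    locally bounded on the diagonal.  This is what membership in B_1 gives: by the
    open mapping theorem, kernel functions at nearby points are nearly proportional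
    (kernel_diag_bounded).

    Holomorphy is treated by elementary means: Goursat's argument and Cauchy's
    formula for sums over the vertices of polygons (goursat, cauchy_formula) give
    the Cauchy estimates (cauchy_taylor), from which follow limits, derivatives,
    the identity theorem and Osgood's lemma in several variables. *)

(** * Complex modulus and complex differentiability *)

Section ComplexBasics.
Context {R : realType}.
Notation C := R[i].
Notation cRe := (@complex.Re R).
Notation cIm := (@complex.Im R).

(** The real-valued modulus: estimates are carried out in the ordered field of
    real numbers rather than in the partially ordered field of complex ones. *)
Definition cmod (z : C) : R := cRe `|z|.

Lemma cmodE z : `|z| = (cmod z)%:C.
Proof. by rewrite /cmod normc_def. Qed.

Lemma cmod_sqrt z : cmod z = Num.sqrt (cRe z ^+ 2 + cIm z ^+ 2).
Proof. by rewrite /cmod normc_def. Qed.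

Lemma cmod_ge0 z : 0 <= cmod z.
Proof. by rewrite cmod_sqrt sqrtr_ge0. Qed.

Lemma cmod0 : cmod 0 = 0.
Proof. by rewrite /cmod normr0. Qed.

Lemma cmod1 : cmod 1 = 1.
Proof. by rewrite /cmod normr1. Qed.

Lemma cmodN z : cmod (- z) = cmod z.
Proof. by rewrite /cmod normrN. Qed.

Lemma cmodBC x y : cmod (x - y) = cmod (y - x).
Proof. by rewrite -cmodN opprB. Qed.

Lemma cmodM x y : cmod (x * y) = cmod x * cmod y.
Proof. by apply: complexI; rewrite rmorphM /= -!cmodE normrM. Qed.

Lemma cmodV x : cmod x^-1 = (cmod x)^-1.
Proof.
by apply: complexI; rewrite -cmodE normfV cmodE -fmorphV.
Qed.

Lemma cmodX x n : cmod (x ^+ n) = cmod x ^+ n.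
Proof. by elim: n => [|n IH]; rewrite ?expr0 ?cmod1 // !exprS cmodM IH. Qed.

Lemma cmodD x y : cmod (x + y) <= cmod x + cmod y.
Proof. by rewrite -lecR rmorphD /= -!cmodE ler_normD. Qed.

Lemma cmodB x y : cmod (x - y) <= cmod x + cmod y.
Proof. by rewrite -[cmod y]cmodN cmodD. Qed.

Lemma cmod_tri z x y : cmod (x - y) <= cmod (x - z) + cmod (z - y).
Proof. by apply: le_trans (cmodD _ _); rewrite addrA subrK. Qed.

Lemma cmod_dist x y : cmod x - cmod y <= cmod (x - y).
Proof. by rewrite lerBlDr; apply: le_trans (cmodD _ _); rewrite subrK. Qed.

Lemma cmodJ z : cmod (z^*)%C = cmod z.
Proof. by rewrite !cmod_sqrt; case: z => a b /=; rewrite sqrrN. Qed.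

Lemma cmod_real (x : R) : cmod x%:C = `|x|.
Proof. by rewrite cmod_sqrt /= expr0n /= addr0 sqrtr_sqr. Qed.

Lemma cmod_nat n : cmod n%:R = n%:R.
Proof. by rewrite -(rmorph_nat (real_complex R)) cmod_real normr_nat. Qed.

Lemma cmodi : cmod 'i%C = 1.
Proof. by rewrite cmod_sqrt /= expr0n /= add0r expr1n sqrtr1. Qed.

Lemma cmod_eq0 z : (cmod z == 0) = (z == 0).
Proof. by rewrite -[z == 0]normr_eq0 cmodE -(inj_eq (@complexI R)). Qed.

Lemma cmod_gt0 z : (0 < cmod z) = (z != 0).
Proof. by rewrite lt_def cmod_ge0 andbT cmod_eq0. Qed.

Lemma cmod_Re z : `|cRe z| <= cmod z.
Proof. by rewrite cmod_sqrt -sqrtr_sqr ler_wsqrtr // lerDl sqr_ge0. Qed.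

Lemma cmod_Im z : `|cIm z| <= cmod z.
Proof. by rewrite cmod_sqrt -sqrtr_sqr ler_wsqrtr // lerDr sqr_ge0. Qed.

Lemma cmod_le_ReIm z : cmod z <= `|cRe z| + `|cIm z|.
Proof.
rewrite {1}[z]complexE; apply: (le_trans (cmodD _ _)).
by rewrite cmodM !cmod_real cmodi mul1r.
Qed.

Lemma cmod_sum (I : Type) (r : seq I) (P : pred I) (F : I -> C) :
  cmod (\sum_(i <- r | P i) F i) <= \sum_(i <- r | P i) cmod (F i).
Proof.
elim/big_rec2: _ => [|i y1 y2 _ IH]; first by rewrite cmod0.
by apply: le_trans (cmodD _ _) _; rewrite lerD2l.
Qed.

Lemma eq_leW (x y : R) : x = y -> x <= y.
Proof. by move=> ->. Qed.

Lemma cmod_small z : (forall e : R, 0 < e -> cmod z <= e) -> z = 0.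
Proof.
move=> h; apply/eqP; rewrite -cmod_eq0 eq_le cmod_ge0 andbT.
by apply/ler_addgt0Pl => e e0; rewrite addr0 h.
Qed.

Definition climit (u : nat -> C) (l : C) : Prop :=
  forall e : R, 0 < e -> exists N, forall n, (N <= n)%N -> cmod (u n - l) <= e.

Lemma climit_unique u l l' : climit u l -> climit u l' -> l = l'.
Proof.
move=> h h'; apply/eqP; rewrite -subr_eq0; apply/eqP/cmod_small => e e0.
have e2 : 0 < e / 2 by lra.
have [N hN] := h _ e2; have [N' hN'] := h' _ e2.
have := hN _ (leq_maxl N N'); have := hN' _ (leq_maxr N N').
have := cmod_tri (u (maxn N N')) l l'; rewrite [cmod (l - u _)]cmodBC; lra.
Qed.

Lemma climitD u v a b : climit u a -> climit v b ->
  climit (fun n => u n + v n) (a + b).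
Proof.
move=> hu hv e e0; have e2 : 0 < e / 2 by lra.
have [N hN] := hu _ e2; have [N' hN'] := hv _ e2.
exists (maxn N N') => n; rewrite geq_max => /andP[/hN h1 /hN' h2].
have := cmodD (u n - a) (v n - b).
have -> : u n - a + (v n - b) = u n + v n - (a + b) by ring.
lra.
Qed.

Lemma climitN u a : climit u a -> climit (fun n => - u n) (- a).
Proof. by move=> h e /h[N hN]; exists N => n /hN; rewrite -opprD cmodN. Qed.

Lemma climitMl c u a : climit u a -> climit (fun n => c * u n) (c * a).
Proof.
move=> hu e e0; have c0 : 0 < 1 + cmod c by have := cmod_ge0 c; lra.
have [N hN] := hu (e / (1 + cmod c)) (divr_gt0 e0 c0).
exists N => n /hN; rewrite -mulrBr cmodM ler_pdivlMr // => h.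
have := cmod_ge0 (u n - a); nra.
Qed.

Lemma climit_sum (I : Type) (r : seq I) (P : pred I) (u : I -> nat -> C) a :
  (forall i, climit (u i) (a i)) ->
  climit (fun n => \sum_(i <- r | P i) u i n) (\sum_(i <- r | P i) a i).
Proof.
move=> h; elim: r => [|i r IH].
  by rewrite big_nil => e e0; exists 0%N => n _; rewrite big_nil subrr cmod0 ltW.
move=> e e0; rewrite big_cons; case: ifP => Pi; last first.
  by have [N hN] := IH _ e0; exists N => n Nn; rewrite big_cons Pi hN.
have [N hN] := climitD (h i) IH e0; exists N => n Nn.
by rewrite big_cons Pi hN.
Qed.

Lemma climit_le u l (b : R) :
  climit u l -> (forall n, cmod (u n) <= b) -> cmod l <= b.
Proof.
move=> h hb; apply/ler_addgt0Pr => e e0; have [N /(_ N (leqnn _)) hN] := h _ e0.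
by have := hb N; have := cmod_dist l (u N); rewrite cmodBC; lra.
Qed.

Lemma climit_ge0 u l : climit u l -> (forall n, 0 <= u n) -> 0 <= l.
Proof.
move=> h u0; have hI n : cIm (u n) = 0 by rewrite ger0_Im.
have hR n : 0 <= cRe (u n) by have := u0 n; rewrite lecE => /andP[].
rewrite lecE /=; apply/andP; split.
  rewrite -normr_eq0 eq_le normr_ge0 andbT.
  apply/ler_addgt0Pr => e /h[N /(_ N (leqnn _))]; rewrite add0r.
  apply: le_trans; apply: le_trans (cmod_Im _).
  by rewrite raddfB /= hI sub0r normrN.
apply/ler_addgt0Pr => e /h[N /(_ N (leqnn _))] he.
have := le_trans (cmod_Re _) he; rewrite raddfB /= ler_distlC => /andP[].
by have := hR N; lra.
Qed.

Lemma pos_below (r r' : R) : 0 < r -> 0 < r' -> exists2 t, 0 < t & t < r /\ t < r'.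
Proof.
move=> r0 r'0; exists (Num.min r r' / 2); first by rewrite divr_gt0 // lt_min r0.
have : Num.min r r' <= r by rewrite ge_min lexx.
have : Num.min r r' <= r' by rewrite ge_min lexx orbT.
have : 0 < Num.min r r' by rewrite lt_min r0.
lra.
Qed.

(** Completeness of the complex plane without sequences: P e c reads as c being an
    approximation of quality e, as produced below by existence proofs. *)
Lemma cauchy_choice (P : R -> C -> Prop) (k : R) :
  (forall e : R, 0 < e -> exists c, P e c) ->
  (forall (e e' : R) c c', 0 < e -> 0 < e' -> P e c -> P e' c' ->
     cmod (c - c') <= k * (e + e')) ->
  exists l, forall (e : R) c, 0 < e -> P e c -> cmod (c - l) <= k * e.
Proof.
move=> exP cP.
have p0 n : 0 < n.+1%:R^-1 :> R by rewrite invr_gt0 ltr0n.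
have /choice[u hu] : forall n, exists c, P n.+1%:R^-1 c by move=> n; apply: exP.
have k0 : 0 <= k.
  have := cP _ _ _ _ (p0 0%N) (p0 0%N) (hu 0%N) (hu 0%N).
  by rewrite subrr cmod0 invr1; lra.
have small (e : R) : 0 < e -> \forall n \near \oo, k * n.+1%:R^-1 <= e.
  move=> e0; near=> n; rewrite ler_pdivrMr ?ltr0n //.
  rewrite -ler_pdivrMl //.
  near: n; exists (truncn (e^-1 * k)).+1 => // n /= hn.
  apply/ltW/(lt_le_trans (truncnS_gt _)).
  by rewrite ler_nat (leq_trans hn).
have cv (f : C -> R) : (forall x y, `|f x - f y| <= cmod (x - y)) ->
    cvg (f \o u @ \oo).
  move=> hf; apply/cauchy_cvgP/cauchy_exP => e e0.
  have e4 : 0 < e / 4 by lra.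
  have [N _ hN] := small _ e4; exists (f (u N)); exists N => // n /= hn.
  rewrite -ball_normE /=; apply: le_lt_trans (hf _ _) _.
  apply: le_lt_trans (cP _ _ _ _ (p0 N) (p0 n) (hu N) (hu n)) _.
  by rewrite mulrDr; apply: le_lt_trans (lerD (hN _ (leqnn N)) (hN _ hn)) _; lra.
have /cvg_ex[a ha] : cvg (cRe \o u @ \oo).
  by apply: cv => x y; rewrite -raddfB cmod_Re.
have /cvg_ex[b hb] : cvg (cIm \o u @ \oo).
  by apply: cv => x y; rewrite -raddfB cmod_Im.
exists (a +i* b) => e c e0 hc; apply/ler_addgt0Pr => d d0.
have d3 : 0 < d / 4 by lra.
suff: \forall n \near \oo, cmod (c - (a +i* b)) <= k * e + d.
  by case=> N _ /(_ N (leqnn _)).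
have := small _ d3; have /cvgrPdist_le/(_ _ d3) := ha.
have /cvgrPdist_le/(_ _ d3) := hb.
apply: filterS3 => n /= hbn han hn.
have := cP _ _ _ _ e0 (p0 n) hc (hu n); rewrite mulrDr.
have := cmod_tri (u n) c (a +i* b).
have := cmod_le_ReIm (u n - (a +i* b)); rewrite !raddfB /=.
rewrite distrC in hbn; rewrite distrC in han.
by move: hn; move: (k / _) => x; lra.
Unshelve. all: by end_near.
Qed.

(** Differentiability by inequalities, for a complex function of one complex
    variable; the derivative is an argument, so that no choice is involved. *)
Definition cdiff (f : C -> C) (p d : C) : Prop :=
  forall e : R, 0 < e -> exists2 r : R, 0 < r &
    forall h, cmod h < r -> cmod (f (p + h) - f p - d * h) <= e * cmod h.

Definition cdifferentiable (f : C -> C) (p : C) : Prop := exists d, cdiff f p d.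

Definition cderiv (f : C -> C) (p : C) : C := xget 0 [set d | cdiff f p d].

Lemma cdiff_unique f p d d' : cdiff f p d -> cdiff f p d' -> d = d'.
Proof.
move=> h h'; apply/eqP; rewrite -subr_eq0; apply/eqP/cmod_small => e e0.
have e2 : 0 < e / 2 by lra.
have [r r0 hr] := h _ e2; have [r' r'0 hr'] := h' _ e2.
have [t t0 [tr tr']] := pos_below r0 r'0.
have tm : cmod t%:C = t by rewrite cmod_real gtr0_norm.
have := hr t%:C; have := hr' t%:C; rewrite tm => /(_ tr') h1 /(_ tr) h2.
have : cmod (d - d') * t <= e * t.
  rewrite -{1}tm -cmodM.
  have -> : (d - d') * t%:C = (f (p + t%:C) - f p - d' * t%:C) -
     (f (p + t%:C) - f p - d * t%:C) by ring.
  by apply: le_trans (cmodB _ _) _; lra.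
by rewrite ler_pM2r.
Qed.

Lemma cderivE f p d : cdiff f p d -> cderiv f p = d.
Proof.
move=> h; rewrite /cderiv; case: xgetP => [x _ hx|/(_ d)//].
exact: cdiff_unique hx h.
Qed.

Lemma cderivP f p : cdifferentiable f p -> cdiff f p (cderiv f p).
Proof. by case=> d h; rewrite (cderivE h). Qed.

End ComplexBasics.
(** * Nested squares and calculus of complex derivatives *)

Section Calculus.
Context {R : realType}.
Notation C := R[i].

Lemma half_pow_small (e : R) : 0 < e -> exists n, 2 ^- n < e.
Proof.
move=> e0; have [N _ /(_ N (leqnn _))] := near_infty_natSinv_expn_lt (PosNum e0).
by rewrite /= div1r; exists N.
Qed.

Lemma harmonic_small (c e : R) : 0 < e -> exists N, forall n, (N <= n)%N ->
  c * n.+1%:R^-1 <= e.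
Proof.
move=> e0; exists (truncn (c / e)) => n hn; rewrite ler_pdivrMr ?ltr0n //.
rewrite -ler_pdivrMl // mulrC; apply: ltW; apply: lt_le_trans (truncnS_gt _) _.
by rewrite ler_nat.
Qed.

(** Compactness of the unit square as a bisection principle: following the quarter
    that inherits P, the squares shrink to a point (x, y). *)
Lemma nested_squares (P : R -> R -> R -> Prop) :
  P 0 0 1 ->
  (forall a c h, 0 < h -> P a c h -> exists b b' : bool,
     P (a + b%:R * (h / 2)) (c + b'%:R * (h / 2)) (h / 2)) ->
  exists x y, forall d : R, 0 < d -> exists a c h,
    [/\ 0 < h < d, 0 <= a <= x /\ x <= a + h <= 1,
        0 <= c <= y /\ y <= c + h <= 1 & P a c h].
Proof.
move=> P0 step.
have /choice[F hF] : forall s : R * R * R, exists b : bool * bool,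
    0 < s.2 -> P s.1.1 s.1.2 s.2 ->
    P (s.1.1 + b.1%:R * (s.2 / 2)) (s.1.2 + b.2%:R * (s.2 / 2)) (s.2 / 2).
  move=> [[a c] h] /=; have [[h0 hP]|nh] := pselect (0 < h /\ P a c h).
    by have [b [b' hb]] := step _ _ _ h0 hP; exists (b, b').
  by exists (true, true) => h0 hP; case: nh.
pose G (s : R * R * R) := (s.1.1 + (F s).1%:R * (s.2 / 2),
  s.1.2 + (F s).2%:R * (s.2 / 2), s.2 / 2).
pose u n := iter n G (0, 0, 1 : R).
have uS n : u n.+1 = G (u n) by [].
have hh n : (u n).2 = 2 ^- n.
  elim: n => [|n IH]; first by rewrite /= expr0 invr1.
  by rewrite uS /= IH exprS invfM mulrC.
have h0 n : 0 < (u n).2 by rewrite hh invr_gt0 exprn_gt0.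
have hP n : P (u n).1.1 (u n).1.2 (u n).2.
  by elim: n => [|n IH]; [exact: P0|rewrite uS; apply: hF].
have b01 (b : bool) : b%:R = 0 :> R \/ b%:R = 1 :> R by case: b; [right|left].
have stepx n : (u n).1.1 <= (u n.+1).1.1 /\
    (u n.+1).1.1 + (u n.+1).2 <= (u n).1.1 + (u n).2.
  by rewrite uS /=; have := h0 n; case: (b01 (F (u n)).1) => ->; lra.
have stepy n : (u n).1.2 <= (u n.+1).1.2 /\
    (u n.+1).1.2 + (u n.+1).2 <= (u n).1.2 + (u n).2.
  by rewrite uS /=; have := h0 n; case: (b01 (F (u n)).2) => ->; lra.
have lim (a : nat -> R) : a 0%N = 0 ->
    (forall n, a n <= a n.+1 /\ a n.+1 + (u n.+1).2 <= a n + (u n).2) ->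
    exists x, forall n, 0 <= a n <= x /\ x <= a n + (u n).2 <= 1.
  move=> a0 ha.
  have mon n k : a n <= a (k + n)%N /\ a (k + n)%N + (u (k + n)%N).2 <= a n + (u n).2.
    elim: k => [|k [IH1 IH2]]; first by rewrite add0n.
    by rewrite addSn; have [] := ha (k + n)%N; lra.
  have cross n k : a n <= a k + (u k).2.
    case/orP: (leq_total n k) => /subnK e.
      by have [] := mon n (k - n)%N; rewrite e; have := h0 k; lra.
    by have [] := mon k (n - k)%N; rewrite e; have := h0 n; lra.
  exists (sup (range a)) => n.
  have le0 : 0 <= a n by have [] := mon 0%N n; rewrite addn0 a0.
  have le1 : a n + (u n).2 <= 1.
    by have [] := mon 0%N n; rewrite addn0 a0 /=; lra.
  rewrite le0 le1 andbT; split; rewrite /=.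
    apply: ub_le_sup; last by exists n.
    by exists (a 0%N + (u 0%N).2) => _ [k _ <-]; apply: cross.
  by apply: ge_sup; [exists (a n); exists n|move=> _ [k _ <-]; apply: cross].
have [x hx] := lim (fun n => (u n).1.1) erefl stepx.
have [y hy] := lim (fun n => (u n).1.2) erefl stepy.
exists x, y => d /half_pow_small[n hn].
by exists (u n).1.1, (u n).1.2, (u n).2; split=> //; rewrite h0 hh.
Qed.

Lemma nested_intervals (P : R -> R -> Prop) :
  P 0 1 ->
  (forall a h, 0 < h -> P a h -> exists b : bool, P (a + b%:R * (h / 2)) (h / 2)) ->
  exists x, forall d : R, 0 < d -> exists a h,
    [/\ 0 < h < d, 0 <= a <= x, x <= a + h <= 1 & P a h].
Proof.
move=> P0 step.
have [|x [y h]] := @nested_squares (fun a _ h => P a h) P0.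
  by move=> a _ h h0 /(step _ _ h0)[b hb]; exists b, b.
by exists x => d /h[a [c [k [? [? ?] _ ?]]]]; exists a, k.
Qed.

Implicit Types (f g : C -> C) (p d : C).

Lemma cdiff_cst c p : cdiff (fun=> c) p 0.
Proof.
move=> e e0; exists 1 => // h _; rewrite subrr mul0r subrr cmod0.
by rewrite mulr_ge0 ?cmod_ge0 ?ltW.
Qed.

Lemma cdiff_id p : cdiff id p 1.
Proof.
move=> e e0; exists 1 => // h _; have -> : p + h - p - 1 * h = 0 by ring.
rewrite cmod0.
by rewrite mulr_ge0 ?cmod_ge0 ?ltW.
Qed.

Lemma cdiff_near f g p d (r : R) : 0 < r ->
  (forall h, cmod h < r -> f (p + h) = g (p + h)) -> cdiff g p d -> cdiff f p d.
Proof.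
move=> r0 fg hg e /hg[r' r'0 h']; have [t t0 [tr tr']] := pos_below r0 r'0.
exists t => // h ht; rewrite fg ?(lt_trans ht) //.
have := fg 0; rewrite addr0 cmod0 => ->//.
by apply: h'; apply: lt_trans tr'.
Qed.

Lemma cdiff_ext f g p d : f =1 g -> cdiff g p d -> cdiff f p d.
Proof. by move=> fg; apply: cdiff_near ltr01 _ => h _; apply: fg. Qed.

Lemma cdiff_lip f p d : cdiff f p d -> exists2 r : R, 0 < r &
  forall h, cmod h < r -> cmod (f (p + h) - f p) <= (1 + cmod d) * cmod h.
Proof.
move=> /(_ 1 ltr01)[r r0 hr]; exists r => // h /hr; rewrite mul1r => hh.
have := cmodD (f (p + h) - f p - d * h) (d * h); rewrite subrK cmodM.
lra.
Qed.

Lemma cdiff_cont f p d (e : R) : cdiff f p d -> 0 < e -> exists2 r : R, 0 < r &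
  forall h, cmod h < r -> cmod (f (p + h) - f p) <= e.
Proof.
move=> /cdiff_lip[r r0 hr] e0.
have d0 : 0 < 1 + cmod d by have := cmod_ge0 d; lra.
have [t t0 [tr te]] := pos_below r0 (divr_gt0 e0 d0).
exists t => // h ht; apply: le_trans (hr _ (lt_trans ht tr)) _.
by rewrite -ler_pdivlMl // mulrC ltW // (lt_trans ht).
Qed.

Lemma cdiffD f g p d d' :
  cdiff f p d -> cdiff g p d' -> cdiff (fun z => f z + g z) p (d + d').
Proof.
move=> hf hg e e0; have e2 : 0 < e / 2 by lra.
have [r r0 hr] := hf _ e2; have [r' r'0 hr'] := hg _ e2.
have [t t0 [tr tr']] := pos_below r0 r'0.
exists t => // h ht.
have := hr h (lt_trans ht tr); have := hr' h (lt_trans ht tr').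
have -> : f (p + h) + g (p + h) - (f p + g p) - (d + d') * h =
  (f (p + h) - f p - d * h) + (g (p + h) - g p - d' * h) by ring.
by move=> h1 h2; apply: le_trans (cmodD _ _) _; lra.
Qed.

Lemma cdiffM f g p d d' : cdiff f p d -> cdiff g p d' ->
  cdiff (fun z => f z * g z) p (d * g p + f p * d').
Proof.
move=> hf hg e e0; have [rl rl0 hl] := cdiff_lip hf.
have [rl' rl'0 hl'] := cdiff_lip hg.
pose k := 3 * (1 + cmod (f p) + cmod (g p)).
have k0 : 0 < k by rewrite /k; have := cmod_ge0 (f p); have := cmod_ge0 (g p); lra.
have ek : 0 < e / k by rewrite divr_gt0.
have [r r0 hr] := hf _ ek; have [r' r'0 hr'] := hg _ ek.
pose l := (1 + cmod d) * (1 + cmod d').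
have l0 : 0 < l.
  by rewrite mulr_gt0 //; [have := cmod_ge0 d|have := cmod_ge0 d']; lra.
have [t t0 [tr tr']] := pos_below r0 r'0.
have [s s0 [sr sr']] := pos_below rl0 rl'0.
have [q q0 [qt qs]] := pos_below t0 s0.
have el : 0 < e / (3 * l) by rewrite divr_gt0 // mulr_gt0.
have [w w0 [wq wl]] := pos_below q0 el.
exists w => // h hw.
have ht := lt_trans hw (lt_trans wq qt); have hs := lt_trans hw (lt_trans wq qs).
have := hr h (lt_trans ht tr); have := hr' h (lt_trans ht tr').
have := hl h (lt_trans hs sr); have := hl' h (lt_trans hs sr').
set A := f (p + h) - f p; set B := g (p + h) - g p => hB hA h2 h1.
have -> : f (p + h) * g (p + h) - f p * g p - (d * g p + f p * d') * h =
  (A - d * h) * g p + f p * (B - d' * h) + A * B by rewrite /A /B; ring.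
apply: le_trans (cmodD _ _) _.
have b3 : cmod (A * B) <= e / 3 * cmod h.
  rewrite cmodM; apply: (@le_trans _ _ (l * cmod h * cmod h)).
    apply: le_trans (ler_pM (cmod_ge0 _) (cmod_ge0 _) hA hB) _.
    by rewrite /l mulrACA mulrA.
  apply: ler_wpM2r; first exact: cmod_ge0.
  rewrite mulrC -ler_pdivlMr //; apply: ltW; apply: lt_le_trans (lt_trans hw wl) _.
  by rewrite invfM mulrA.
have b12 : cmod ((A - d * h) * g p + f p * (B - d' * h)) <= e * (2 / 3) * cmod h.
  apply: le_trans (cmodD _ _) _; rewrite !cmodM.
  have ekk : e / k * (1 + cmod (f p) + cmod (g p)) = e / 3.
    by rewrite /k; field; rewrite lt0r_neq0 // -(@pmulr_rgt0 _ 3).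
  have hh := cmod_ge0 h.
  have i1 : cmod (A - d * h) * cmod (g p) <= e / 3 * cmod h.
    apply: le_trans (ler_wpM2r (cmod_ge0 _) h1) _.
    rewrite mulrAC; apply: ler_wpM2r => //; rewrite -ekk.
    by rewrite ler_pM2l //; have := cmod_ge0 (f p); lra.
  have i2 : cmod (f p) * cmod (B - d' * h) <= e / 3 * cmod h.
    apply: le_trans (ler_wpM2l (cmod_ge0 _) h2) _.
    rewrite mulrA [cmod (f p) * _]mulrC; apply: ler_wpM2r => //; rewrite -ekk.
    by rewrite ler_pM2l //; have := cmod_ge0 (g p); lra.
  lra.
lra.
Qed.

Lemma cdiff_comp f g p d d' : cdiff f p d -> cdiff g (f p) d' ->
  cdiff (fun z => g (f z)) p (d' * d).
Proof.
move=> hf hg e e0; have [rl rl0 hl] := cdiff_lip hf.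
have d1 : 0 < 1 + cmod d by have := cmod_ge0 d; lra.
have d1' : 0 < 1 + cmod d' by have := cmod_ge0 d'; lra.
have e1 : 0 < e / 2 / (1 + cmod d) by rewrite !divr_gt0.
have e2 : 0 < e / 2 / (1 + cmod d') by rewrite !divr_gt0.
have [r r0 hr] := hf _ e2; have [r' r'0 hr'] := hg _ e1.
have [t t0 [tr tr']] := pos_below r0 rl0.
have [s s0 [st sr]] := pos_below t0 (divr_gt0 r'0 d1).
exists s => // h hs; have ht := lt_trans hs st.
have := hr h (lt_trans ht tr); have := hl h (lt_trans ht tr').
set A := f (p + h) - f p => hA hd.
have Ar : cmod A < r'.
  apply: le_lt_trans hA _; rewrite mulrC -ltr_pdivlMr //.
  exact: lt_trans hs sr.
have := hr' A Ar; have -> : f p + A = f (p + h) by rewrite /A; ring.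
move=> hB.
have -> : g (f (p + h)) - g (f p) - d' * d * h =
  (g (f (p + h)) - g (f p) - d' * A) + d' * (A - d * h) by ring.
apply: le_trans (cmodD _ _) _; rewrite cmodM.
have i1 : cmod (g (f (p + h)) - g (f p) - d' * A) <= e / 2 * cmod h.
  apply: le_trans hB _; rewrite -mulrA; apply: ler_wpM2l; first by lra.
  by rewrite ler_pdivrMl.
have i2 : cmod d' * cmod (A - d * h) <= e / 2 * cmod h.
  apply: le_trans (ler_wpM2l (cmod_ge0 _) hd) _.
  rewrite mulrA; apply: ler_wpM2r; first exact: cmod_ge0.
  rewrite mulrC mulrAC ler_pdivrMr // ler_pM2l; lra.
lra.
Qed.

Lemma cdiff_inv p : p != 0 -> cdiff (fun z => z^-1) p (- (p ^- 2)).
Proof.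
move=> p0 e e0; have F0 : 0 < cmod p by rewrite cmod_gt0.
have F2 : 0 < cmod p / 2 by lra.
have F3 : 0 < e * cmod p ^+ 3 / 2 by rewrite divr_gt0 // mulr_gt0 // exprn_gt0.
have [t t0 [tr tr']] := pos_below F2 F3; exists t => // h ht.
have hp : cmod p / 2 <= cmod (p + h).
  have := cmod_dist p (- h); rewrite cmodN opprK; lra.
have ph0 : p + h != 0 by rewrite -cmod_gt0 (lt_le_trans F2).
have -> : (p + h)^-1 - p^-1 - - p ^- 2 * h = h * (h / (p ^+ 2 * (p + h))).
  by field; rewrite p0 ph0.
rewrite cmodM [leRHS]mulrC; apply: ler_wpM2l; first exact: cmod_ge0.
rewrite cmodM cmodV ler_pdivrMr ?cmod_gt0 ?mulf_neq0 ?expf_neq0 //.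
rewrite cmodM cmodX; apply: le_trans (ltW (lt_trans ht tr')) _.
rewrite exprSr -!mulrA; apply: ler_wpM2l; first exact: ltW.
by rewrite !ler_pM2l.
Qed.

Lemma cdiffV f p d : f p != 0 -> cdiff f p d ->
  cdiff (fun z => (f z)^-1) p (- (f p ^- 2) * d).
Proof. by move=> fp hf; apply: cdiff_comp hf (cdiff_inv fp). Qed.

Lemma cdiffZ c f p d : cdiff f p d -> cdiff (fun z => c * f z) p (c * d).
Proof.
by move=> h; have := cdiffM (cdiff_cst c p) h; rewrite mul0r add0r.
Qed.

Lemma cdiffN f p d : cdiff f p d -> cdiff (fun z => - f z) p (- d).
Proof.
move=> /(cdiffZ (-1)); rewrite mulN1r.
by apply: cdiff_ext => z; rewrite mulN1r.
Qed.

Lemma cdiffB f g p d d' :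
  cdiff f p d -> cdiff g p d' -> cdiff (fun z => f z - g z) p (d - d').
Proof. by move=> hf /cdiffN; apply: cdiffD. Qed.

Lemma cdiff_affine a b p : cdiff (fun z => a + z * b) p b.
Proof.
have := cdiffD (cdiff_cst a p) (cdiffM (cdiff_id p) (cdiff_cst b p)).
by rewrite add0r mul1r mulr0 addr0.
Qed.

Lemma cdiff_shift f p a d : cdiff (fun z => f (a + z)) p d <-> cdiff f (a + p) d.
Proof. by split=> h e /h[r r0 hr]; exists r => // k /hr; rewrite addrA. Qed.

End Calculus.
Section Cdifferentiable.
Context {R : realType}.
Notation C := R[i].
Implicit Types (f g : C -> C) (p d : C).

Lemma cdf_cst c p : cdifferentiable (fun=> c) p.
Proof. by exists 0; apply: cdiff_cst. Qed.

Lemma cdf_id p : cdifferentiable id p.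
Proof. by exists 1; apply: cdiff_id. Qed.

Lemma cdfD f g p : cdifferentiable f p -> cdifferentiable g p ->
  cdifferentiable (fun z => f z + g z) p.
Proof. by move=> [d hd] [d' hd']; exists (d + d'); apply: cdiffD. Qed.

Lemma cdfB f g p : cdifferentiable f p -> cdifferentiable g p ->
  cdifferentiable (fun z => f z - g z) p.
Proof. by move=> [d hd] [d' hd']; exists (d - d'); apply: cdiffB. Qed.

Lemma cdfM f g p : cdifferentiable f p -> cdifferentiable g p ->
  cdifferentiable (fun z => f z * g z) p.
Proof. by move=> [d hd] [d' hd']; eexists; apply: cdiffM hd hd'. Qed.

Lemma cdfV f p : f p != 0 -> cdifferentiable f p ->
  cdifferentiable (fun z => (f z)^-1) p.
Proof. by move=> fp [d hd]; eexists; apply: cdiffV fp hd. Qed.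

Lemma cdfX f p n : cdifferentiable f p -> cdifferentiable (fun z => f z ^+ n) p.
Proof.
move=> hf; elim: n => [|n IH].
  by have [d hd] := cdf_cst 1 p; exists d; apply: cdiff_ext hd => z; rewrite expr0.
by have [d hd] := cdfM hf IH; exists d; apply: cdiff_ext hd => z; rewrite exprS.
Qed.

Lemma cdf_comp f g p : cdifferentiable f p -> cdifferentiable g (f p) ->
  cdifferentiable (fun z => g (f z)) p.
Proof. by move=> [d hd] [d' hd']; eexists; apply: cdiff_comp hd hd'. Qed.

Lemma cdf_near f g p (r : R) : 0 < r ->
  (forall h, cmod h < r -> f (p + h) = g (p + h)) ->
  cdifferentiable g p -> cdifferentiable f p.
Proof. by move=> r0 fg [d hd]; exists d; apply: cdiff_near fg hd. Qed.

End Cdifferentiable.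
(** * Cauchy's theorem through dyadic trapezoid sums *)

Section Goursat.
Context {R : realType}.
Notation C := R[i].

(** Contour integrals are replaced throughout by finite trapezoid sums, which are
    defined for all functions and can be compared with each other exactly. *)
Definition trapezoid (g : C -> C) (x y : C) : C := (g x + g y) / 2 * (y - x).

Fixpoint tsum n (F : R -> C) (g : C -> C) (a b : R) : C :=
  if n is n'.+1 then tsum n' F g a ((a + b) / 2) + tsum n' F g ((a + b) / 2) b
  else trapezoid g (F a) (F b).

(** The trapezoid sum along the image of the boundary of [a, b] x [c, d]. *)
Definition cell_sum n (Phi : R -> R -> C) (g : C -> C) (a b c d : R) : C :=
  tsum n (Phi^~ c) g a b + tsum n (Phi b) g c d
  - tsum n (Phi^~ d) g a b - tsum n (Phi a) g c d.

Lemma cell_sum_split n Phi g a b c d :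
  cell_sum n.+1 Phi g a b c d =
    cell_sum n Phi g a ((a + b) / 2) c ((c + d) / 2)
    + cell_sum n Phi g ((a + b) / 2) b c ((c + d) / 2)
    + cell_sum n Phi g a ((a + b) / 2) ((c + d) / 2) d
    + cell_sum n Phi g ((a + b) / 2) b ((c + d) / 2) d.
Proof. by rewrite /cell_sum /=; ring. Qed.

Lemma tsum_bound n F g (a b M K : R) : a <= b -> 0 <= M ->
  (forall x, a <= x <= b -> cmod (g (F x)) <= M) ->
  (forall x y, a <= x <= b -> a <= y <= b -> cmod (F x - F y) <= K * `|x - y|) ->
  cmod (tsum n F g a b) <= M * K * (b - a).
Proof.
move=> + M0; elim: n a b => [|n IH] a b ab gM lip /=.
  have := gM a; have := gM b; rewrite !lexx ab => /(_ isT) h1 /(_ isT) h2.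
  have := lip b a; rewrite !lexx ab => /(_ isT isT).
  rewrite ger0_norm ?subr_ge0 // => h3.
  rewrite /trapezoid cmodM -mulrA; apply: ler_pM; rewrite ?cmod_ge0 //.
  rewrite cmodM cmodV cmod_nat ler_pdivrMr // mulr_natr mulr2n.
  by apply: le_trans (cmodD _ _) _; apply: lerD.
have am : a <= (a + b) / 2 <= b by lra.
have /andP[am1 am2] := am.
apply: le_trans (cmodD _ _) _.
have h1 : cmod (tsum n F g a ((a + b) / 2)) <= M * K * ((a + b) / 2 - a).
  apply: IH => // [x hx|x y hx hy]; [apply: gM|apply: lip]; lra.
have h2 : cmod (tsum n F g ((a + b) / 2) b) <= M * K * (b - (a + b) / 2).
  apply: IH => // [x hx|x y hx hy]; [apply: gM|apply: lip]; lra.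
lra.
Qed.

(** The trapezoid rule is exact on affine functions, for which it telescopes. *)
Lemma tsum_affine n F (u v : C) (a b : R) :
  tsum n F (fun z => u + v * z) a b =
  u * (F b - F a) + v * (F b ^+ 2 - F a ^+ 2) / 2.
Proof.
elim: n a b => [|n IH] a b /=; first by rewrite /trapezoid; field.
by rewrite !IH; field.
Qed.

Lemma tsumB n F g g' (a b : R) :
  tsum n F (fun z => g z - g' z) a b = tsum n F g a b - tsum n F g' a b.
Proof.
elim: n a b => [|n IH] a b /=; first by rewrite /trapezoid; field.
by rewrite !IH; ring.
Qed.

(** Goursat's argument, for the image of a square under a Lipschitz map: if the
    boundary sums did not tend to 0, repeated quartering would produce
    arbitrarily small squares with boundary sums of the order of their area,
    around a point where the function is affine up to a smaller error. *)
Lemma goursat (Phi : R -> R -> C) (g : C -> C) (K : R) : 0 < K ->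
  (forall s t s' t', 0 <= s <= 1 -> 0 <= t <= 1 -> 0 <= s' <= 1 -> 0 <= t' <= 1 ->
     cmod (Phi s t - Phi s' t') <= K * (`|s - s'| + `|t - t'|)) ->
  (forall s t, 0 <= s <= 1 -> 0 <= t <= 1 -> cdifferentiable g (Phi s t)) ->
  forall e : R, 0 < e -> exists N, forall n, (N <= n)%N ->
    cmod (cell_sum n Phi g 0 1 0 1) <= e.
Proof.
move=> K0 lip dg e e0.
pose good a c h := exists N, forall n, (N <= n)%N ->
  cmod (cell_sum n Phi g a (a + h) c (c + h)) <= e * h ^+ 2.
suff : good 0 0 1 by rewrite /good !add0r expr1n mulr1.
apply: contrapT => bad0.
have [||x [y hxy]] := @nested_squares R (fun a c h => ~ good a c h).
- exact: bad0.
- move=> a c h h0; apply: contra_notP => /forallNP nb.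
  have {}nb (b b' : bool) : good (a + b%:R * (h / 2)) (c + b'%:R * (h / 2)) (h / 2).
    by apply: contrapT => bad; apply: (nb b); exists b'.
  have [N1 h1] := nb false false; have [N2 h2] := nb true false.
  have [N3 h3] := nb false true; have [N4 h4] := nb true true.
  exists (maxn (maxn N1 N2) (maxn N3 N4)).+1 => -[//|n]; rewrite ltnS !geq_max.
  move=> /andP[/andP[n1 n2] /andP[n3 n4]].
  move: (h1 n n1) (h2 n n2) (h3 n n3) (h4 n n4).
  have eh (z : R) : (z + (z + h)) / 2 = z + h / 2 by field.
  have eh' (z : R) : z + h / 2 + h / 2 = z + h by field.
  rewrite cell_sum_split !eh !mul1r !mul0r !addr0 !eh' => i1 i2 i3 i4.
  apply: le_trans (cmodD _ _) _; apply: le_trans (lerD (cmodD _ _) (lexx _)) _.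
  apply: le_trans (lerD (lerD (cmodD _ _) (lexx _)) (lexx _)) _.
  have -> : e * h ^+ 2 = e * (h / 2) ^+ 2 + e * (h / 2) ^+ 2 + e * (h / 2) ^+ 2
    + e * (h / 2) ^+ 2 by field.
  by rewrite !lerD.
have [x1 y1] : 0 <= x <= 1 /\ 0 <= y <= 1.
  have [a [c [h [/andP[h0 _] [? ?] [? ?] _]]]] := hxy 1 ltr01; lra.
(* with this accuracy each side of the final square contributes e / 4 * h ^+ 2 *)
have [d hd] := dg x y x1 y1.
have e1 : 0 < e / (8 * K ^+ 2) by rewrite divr_gt0 // mulr_gt0 // exprn_gt0.
have [r r0 hr] := hd _ e1.
have rK : 0 < r / (2 * K) by rewrite divr_gt0 // mulr_gt0.
have [a [c [h [/andP[h0 hrK] [/andP[a0 ax] /andP[xa ah]] [/andP[c0 cy] /andP[yc ch]]]]]] := hxy _ rK.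
apply; exists 0%N => n _.
set p := Phi x y in hd hr.
have inA s : a <= s <= a + h -> 0 <= s <= 1.
  by move=> /andP[/(le_trans a0) -> /le_trans ->].
have inC t : c <= t <= c + h -> 0 <= t <= 1.
  by move=> /andP[/(le_trans c0) -> /le_trans ->].
(* the affine approximation of g at p, whose boundary sums vanish *)
pose q z := g p - d * p + d * z.
have dist s t : a <= s <= a + h -> c <= t <= c + h ->
    cmod (Phi s t - p) <= 2 * K * h.
  move=> hs ht; apply: le_trans (lip s t x y (inA s hs) (inC t ht) x1 y1) _.
  have : `|s - x| <= h by rewrite ler_norml; lra.
  have : `|t - y| <= h by rewrite ler_norml; lra.
  nra.
have near s t : a <= s <= a + h -> c <= t <= c + h ->
    cmod (g (Phi s t) - q (Phi s t)) <= e / (4 * K) * h.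
  move=> hs ht; have hp := dist s t hs ht.
  have -> : g (Phi s t) - q (Phi s t) =
      g (p + (Phi s t - p)) - g p - d * (Phi s t - p).
    by rewrite /q [p + _]addrC subrK; ring.
  apply: le_trans (hr _ _) _.
    by apply: le_lt_trans hp _; rewrite mulrC -ltr_pdivlMr // mulr_gt0.
  apply: le_trans (ler_wpM2l (ltW e1) hp) _.
  by have -> : e / (4 * K) * h = e / (8 * K ^+ 2) * (2 * K * h) by field; lra.
have q0 : cell_sum n Phi q a (a + h) c (c + h) = 0.
  by rewrite /cell_sum !tsum_affine; field.
have -> : cell_sum n Phi g a (a + h) c (c + h) =
    cell_sum n Phi (fun z => g z - q z) a (a + h) c (c + h).
  have -> : cell_sum n Phi (fun z => g z - q z) a (a + h) c (c + h) =
    cell_sum n Phi g a (a + h) c (c + h) - cell_sum n Phi q a (a + h) c (c + h).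
    by rewrite /cell_sum !tsumB; ring.
  by rewrite q0 subr0.
have M0 : 0 <= e / (4 * K) * h by rewrite mulr_ge0 ?divr_ge0 ?mulr_ge0 ?ltW.
have edge1 t : c <= t <= c + h ->
    cmod (tsum n (Phi^~ t) (fun z => g z - q z) a (a + h)) <= e / 4 * h ^+ 2.
  move=> ht; have -> : e / 4 * h ^+ 2 = e / (4 * K) * h * K * (a + h - a).
    by field; lra.
  apply: tsum_bound => // [|s hs|s s' hs hs']; [lra|exact: near|].
  have := lip s t s' t; rewrite subrr normr0 addr0; apply; by [apply: inA|apply: inC].
have edge2 s : a <= s <= a + h ->
    cmod (tsum n (Phi s) (fun z => g z - q z) c (c + h)) <= e / 4 * h ^+ 2.
  move=> hs; have -> : e / 4 * h ^+ 2 = e / (4 * K) * h * K * (c + h - c).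
    by field; lra.
  apply: tsum_bound => // [|t ht|t t' ht ht']; [lra|exact: near|].
  have := lip s t s t'; rewrite subrr normr0 add0r; apply; by [apply: inA|apply: inC].
have i1 : cmod (tsum n (Phi^~ c) (fun z => g z - q z) a (a + h)) <= e / 4 * h ^+ 2.
  by apply: edge1; lra.
have i2 : cmod (tsum n (Phi (a + h)) (fun z => g z - q z) c (c + h)) <= e / 4 * h ^+ 2.
  by apply: edge2; lra.
have i3 : cmod (tsum n (Phi^~ (c + h)) (fun z => g z - q z) a (a + h)) <= e / 4 * h ^+ 2.
  by apply: edge1; lra.
have i4 : cmod (tsum n (Phi a) (fun z => g z - q z) c (c + h)) <= e / 4 * h ^+ 2.
  by apply: edge2; lra.
rewrite /cell_sum; apply: le_trans (cmodB _ _) _.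
apply: le_trans (lerD (cmodB _ _) (lexx _)) _.
apply: le_trans (lerD (lerD (cmodD _ _) (lexx _)) (lexx _)) _.
lra.
Qed.

(** The recursive form is suited to bisection, this one to points equally spaced on
    a circle. *)
Lemma tsum_uniform n F g (a b : R) : tsum n F g a b =
  \sum_(k < 2 ^ n) trapezoid g (F (a + k%:R * ((b - a) / 2 ^+ n)))
                               (F (a + k.+1%:R * ((b - a) / 2 ^+ n))).
Proof.
elim: n a b => [|n IH] a b /=.
  by rewrite big_ord_recl big_ord0 addr0 mul0r addr0 mul1r expr0 divr1 addrC subrK.
have e1 : ((a + b) / 2 - a) / 2 ^+ n = (b - a) / 2 ^+ n.+1.
  by rewrite exprS; field; rewrite expf_neq0.
have e2 : (b - (a + b) / 2) / 2 ^+ n = (b - a) / 2 ^+ n.+1.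
  by rewrite exprS; field; rewrite expf_neq0.
have e3 k : (a + b) / 2 + k%:R * ((b - a) / 2 ^+ n.+1) =
    a + (2 ^ n + k)%:R * ((b - a) / 2 ^+ n.+1).
  by rewrite natrD natrX exprS; field; rewrite expf_neq0.
rewrite !IH e1 e2 expnS mul2n -addnn big_split_ord /=; congr (_ + _).
by apply: eq_bigr => k _; rewrite !e3 addnS.
Qed.

Definition circ (t : R) : C := cos (2 * pi * t) +i* sin (2 * pi * t).

Lemma circD s t : circ (s + t) = circ s * circ t.
Proof.
rewrite /circ mulrDr cosD sinD; apply/eqP; rewrite eq_complex /= eqxx /=.
by apply/eqP; ring.
Qed.

Lemma circ0 : circ 0 = 1.
Proof. by rewrite /circ mulr0 cos0 sin0. Qed.

Lemma circ1 : circ 1 = 1.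
Proof. by rewrite /circ mulr1 mulr_natl cos2pi sin2pi. Qed.

Lemma cmod_circ t : cmod (circ t) = 1.
Proof. by rewrite cmod_sqrt /= cos2Dsin2 sqrtr1. Qed.

Lemma circ_neq0 t : circ t != 0.
Proof. by rewrite -cmod_gt0 cmod_circ ltr01. Qed.

Lemma circN t : circ (- t) = (circ t)^-1.
Proof.
by apply: (mulfI (circ_neq0 t)); rewrite -circD subrr circ0 mulfV ?circ_neq0.
Qed.

Lemma circ_nat k t : circ (k%:R * t) = circ t ^+ k.
Proof.
elim: k => [|k IH]; first by rewrite mul0r circ0.
by rewrite -natr1 mulrDl mul1r circD IH exprSr.
Qed.

Lemma circ_lip s t : cmod (circ s - circ t) <= 4 * pi * `|s - t|.
Proof.
have lip (f f' : R -> R) : (forall x : R, is_derive x (1 : R) f (f' x)) ->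
    (forall x, `|f' x| <= 1) -> forall x y, `|f x - f y| <= `|x - y|.
  move=> df f1; have main x y : x < y -> `|f x - f y| <= `|x - y|.
    move=> xy; have [|c _] := MVT xy (fun z _ => df z).
      by apply: derivable_within_continuous => z _; case: (df z).
    rewrite distrC [`|x - y|]distrC => ->; rewrite normrM.
    by rewrite ler_piMl.
  move=> x y; have [xy|xy|->] := ltgtP x y; [exact: main| |by rewrite !subrr].
  by rewrite distrC [`|x - y|]distrC; exact: main.
have e : `|2 * pi * s - 2 * pi * t| = 2 * pi * `|s - t|.
  by rewrite -mulrBr normrM ger0_norm // mulr_ge0 // pi_ge0.
apply: le_trans (cmod_le_ReIm _) _; rewrite !raddfB /=.
have h1 := lip cos (fun x => - sin x) (fun x => is_derive_cos x) _
  (2 * pi * s) (2 * pi * t).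
have h2 := lip sin cos (fun x => is_derive_sin x) _ (2 * pi * s) (2 * pi * t).
have {}h1 := h1 (fun x => _); have {}h2 := h2 (fun x => _).
have c1 x : `|cos x : R| <= 1 by rewrite ler_norml cos_geN1 cos_le1.
have s1 x : `|- sin x : R| <= 1 by rewrite normrN ler_norml sin_geN1 sin_le1.
have := h1 s1; have := h2 c1; rewrite e; lra.
Qed.

Definition cmean n (c : C) (r : R) (f : C -> C) : C :=
  2 ^- n * \sum_(k < 2 ^ n) f (c + r%:C * circ (2 ^- n) ^+ k).

Lemma circ_root n : circ (2 ^- n) ^+ (2 ^ n) = 1.
Proof.
by rewrite -circ_nat natrX mulfV ?circ1 // expf_neq0.
Qed.

(** The constant that replaces 2 i pi when integrals over a circle become sums over
    the vertices of a regular polygon; Cauchy's formula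
    needs a lower bound for its modulus, and not its limit. *)
Definition circ_weight n : C := 2 ^+ n * (circ (2 ^- n) - (circ (2 ^- n))^-1) / 2.

Lemma circ_weight_ge n : (1 < n)%N -> 4 <= cmod (circ_weight n).
Proof.
have E k : cmod (circ_weight k) = 2 ^+ k * `|sin (2 * pi * 2 ^- k)|.
  have -> : circ_weight k = 'i%C * (2 ^+ k * sin (2 * pi * 2 ^- k))%:C.
    rewrite /circ_weight -circN /circ mulrN cosN sinN.
    rewrite rmorphM rmorphXn rmorph_nat.
    set s := sin _; set t := cos _.
    have -> : t +i* s - (t +i* - s) = 2 * ('i%C * s%:C) :> C.
      apply/eqP; rewrite eq_complex /=; apply/andP; split; apply/eqP; ring.
    by field.
  by rewrite cmodM cmodi mul1r cmod_real normrM ger0_norm // exprn_ge0.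
case: n => [//|[//|n _]]; elim: n => [|n IH].
  rewrite E; have -> : 2 * pi * 2 ^- 2 = pi / 2 :> R by field.
  by rewrite sin_pihalf normr1 mulr1; lra.
apply: le_trans IH _; rewrite !E.
have -> : 2 * pi * 2 ^- n.+2 = 2 * pi * 2 ^- n.+3 + 2 * pi * 2 ^- n.+3 :> R.
  by rewrite [in RHS]exprS; field; rewrite expf_neq0.
move: (2 * pi * 2 ^- n.+3) => x.
have -> : sin (x + x) = 2 * (sin x * cos x) by rewrite sinD; ring.
have -> : 2 ^+ n.+3 * `|sin x| = 2 ^+ n.+2 * (2 * `|sin x|) by rewrite exprSr mulrA.
rewrite ler_pM2l ?exprn_gt0 // !normrM [`|2|]ger0_norm // ler_pM2l //.
by rewrite ler_piMr // ler_norml cos_geN1 cos_le1.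
Qed.

(** On a circle the trapezoid sum is an exact multiple of the mean of
    (z - c) g(z): summation by parts over the vertices of a regular polygon. *)
Lemma tsum_circle n (c : C) (r : R) (g : C -> C) :
  tsum n (fun t => c + r%:C * circ t) g 0 1 =
  circ_weight n * cmean n c r (fun z => (z - c) * g z).
Proof.
rewrite tsum_uniform subr0 mul1r.
under eq_bigr => k _ do rewrite !add0r !circ_nat.
set w := circ (2 ^- n); set G := fun k => g (c + r%:C * w ^+ k).
have w0 : w != 0 by apply: circ_neq0.
(* the two halves of the trapezoids at a vertex are joined by shifting one of them *)
pose u k := G k * r%:C * (w ^+ k - w ^+ k / w) / 2.
have G_per : u (2 ^ n)%N = u 0%N by rewrite /u /G circ_root.
have shift : \sum_(k < 2 ^ n) u k.+1 = \sum_(k < 2 ^ n) u k.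
  have : \sum_(k < (2 ^ n).+1) u k = \sum_(k < 2 ^ n) u k + u (2 ^ n)%N.
    by rewrite big_ord_recr.
  rewrite big_ord_recl /= G_per addrC => /addIr <-.
  by apply: eq_bigr.
have -> : \sum_(k < 2 ^ n) trapezoid g (c + r%:C * w ^+ k) (c + r%:C * w ^+ k.+1) =
    \sum_(k < 2 ^ n) (u k.+1 + (G k * r%:C * (w ^+ k.+1 - w ^+ k) / 2)).
  apply: eq_bigr => k _; rewrite /u /trapezoid -!/(G _) exprSr mulfK //.
  by rewrite -/(G k) -exprSr -/(G k.+1); field.
rewrite big_split /= shift -big_split /= /cmean /circ_weight -/w !mulrA.
rewrite [in RHS]mulr_sumr; apply: eq_bigr => k _.
rewrite /u -/(G k) [c + _]addrC addrK exprSr; field.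
by rewrite expf_neq0.
Qed.

End Goursat.
(** * Cauchy estimates *)

Section CauchyEstimates.
Context {R : realType}.
Notation C := R[i].
Implicit Types (f g : C -> C) (a c d : C) (r M : R).

Lemma eq_tsum n (F F' : R -> C) g (a b : R) : F =1 F' -> tsum n F g a b = tsum n F' g a b.
Proof.
by move=> e; elim: n a b => [|n IH] a b /=; rewrite ?IH // /trapezoid !e.
Qed.

Lemma eq_cmean n c r f g : 0 <= r ->
  (forall z, cmod (z - c) = r -> f z = g z) -> cmean n c r f = cmean n c r g.
Proof.
move=> r0 fg; congr (_ * _); apply: eq_bigr => k _; apply: fg.
by rewrite [c + _]addrC addrK cmodM cmodX cmod_circ expr1n mulr1 cmod_real ger0_norm.
Qed.

Lemma cmeanD n c r f g :
  cmean n c r (fun z => f z + g z) = cmean n c r f + cmean n c r g.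
Proof. by rewrite /cmean big_split mulrDr. Qed.

Lemma cmeanZ n c r b f : cmean n c r (fun z => b * f z) = b * cmean n c r f.
Proof. by rewrite /cmean -mulr_sumr mulrCA. Qed.

Lemma cmean_bound n c r f M : 0 <= r ->
  (forall z, cmod (z - c) = r -> cmod (f z) <= M) -> cmod (cmean n c r f) <= M.
Proof.
move=> r0 fM; rewrite /cmean cmodM cmodV cmodX cmod_nat.
rewrite ler_pdivrMl ?exprn_gt0 //; apply: le_trans (cmod_sum _ _ _) _.
rewrite -natrX; have -> : (2 ^ n)%:R * M = \sum_(k < 2 ^ n) M.
  by rewrite sumr_const card_ord mulr_natl.
apply: ler_sum => k _; apply: fM.
by rewrite [c + _]addrC addrK cmodM cmodX cmod_circ expr1n mulr1 cmod_real ger0_norm.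
Qed.

Lemma cmean_cst n c r b : cmean n c r (fun=> b) = b.
Proof.
rewrite /cmean sumr_const card_ord -[b *+ _]mulr_natl natrX mulrA mulVf ?mul1r //.
Qed.

(** Cauchy's integral formula, with an integral approximated by means over the
    vertices of regular polygons.  The circles centred at c and at a bound the
    image of a square on which the integrand is differentiable. *)
Lemma cauchy_formula f a c r : cmod (a - c) < r ->
  (forall z, cmod (z - c) <= r -> cdifferentiable f z) ->
  climit (fun n => cmean n c r (fun z => (z - c) * (f z / (z - a)))) (f a).
Proof.
move=> ar df e e0.
have [d hd] := df a (ltW ar).
have e2 : 0 < e / 2 by lra.
have [rho rho0 hrho] := cdiff_cont hd e2.
have gap : 0 < r - cmod (a - c) by lra.
have [eps eps0 [epsrho epsgap]] := pos_below rho0 gap.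
have r0 : 0 < r by have := cmod_ge0 (a - c); lra.
(* the homotopy Phi shrinks the circle around c to a small circle around a *)
pose rad s : R := (1 - s) * r + s * eps.
pose Phi s t : C := c + s%:C * (a - c) + (rad s)%:C * circ t.
pose g z := f z / (z - a).
pose K : R := r + 1 + r * (4 * pi).
have K0 : 0 < K.
  by rewrite /K; have := pi_ge0 R; nra.
have rad_bd s : 0 <= s <= 1 -> 0 < rad s <= r.
  by rewrite /rad => /andP[s0 s1]; have := cmod_ge0 (a - c); nra.
have lip s t s' t' : 0 <= s <= 1 -> 0 <= t <= 1 -> 0 <= s' <= 1 -> 0 <= t' <= 1 ->
    cmod (Phi s t - Phi s' t') <= K * (`|s - s'| + `|t - t'|).
  move=> hs ht hs' ht'.
  have -> : Phi s t - Phi s' t' = (s - s')%:C * ((a - c) + (eps - r)%:C * circ t)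
      + (rad s')%:C * (circ t - circ t').
    by rewrite /Phi /rad !(rmorphD, rmorphB, rmorphM, rmorph1) /=; ring.
  apply: le_trans (cmodD _ _) _; rewrite !cmodM !cmod_real.
  have h1 : cmod ((a - c) + (eps - r)%:C * circ t) <= r + 1 + r * (4 * pi).
    apply: le_trans (cmodD _ _) _; rewrite cmodM cmod_circ mulr1 cmod_real.
    have : `|eps - r| = r - eps.
      by rewrite ler0_norm; have := cmod_ge0 (a - c); lra.
    have := pi_gt0 R; have := pi_ge2 R; nra.
  have h2 := circ_lip t t'.
  have := rad_bd _ hs'; move=> /andP[p1 p2]; rewrite (gtr0_norm p1).
  have h3 : rad s' * cmod (circ t - circ t') <= r * (4 * pi * `|t - t'|).
    by apply: ler_pM; rewrite ?cmod_ge0 // ltW.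
  have h4 : `|s - s'| * cmod (a - c + (eps - r)%:C * circ t) <= `|s - s'| * K.
    exact: ler_wpM2l.
  have : r * (4 * pi * `|t - t'|) <= K * `|t - t'|.
    by rewrite mulrA; apply: ler_wpM2r => //; rewrite /K; lra.
  lra.
have dg s t : 0 <= s <= 1 -> 0 <= t <= 1 -> cdifferentiable g (Phi s t).
  move=> hs ht; have /andP[p1 p2] := rad_bd _ hs; have /andP[s0 s1] := hs.
  have [|df' hdf'] := df (Phi s t).
    have -> : Phi s t - c = s%:C * (a - c) + (rad s)%:C * circ t by rewrite /Phi; ring.
    apply: le_trans (cmodD _ _) _; rewrite !cmodM !cmod_real cmod_circ.
    rewrite (gtr0_norm p1) ger0_norm // /rad.
    by have := cmod_ge0 (a - c); nra.
  have nz : Phi s t - a != 0.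
    rewrite -cmod_gt0.
    have -> : Phi s t - a = (rad s)%:C * circ t - (1 - s)%:C * (a - c).
      by rewrite /Phi rmorphB rmorph1; ring.
    apply: lt_le_trans (cmod_dist _ _); rewrite !cmodM !cmod_real cmod_circ.
    rewrite (gtr0_norm p1) ger0_norm ?subr_ge0 // /rad.
    by have := cmod_ge0 (a - c); nra.
  apply: cdfM; first by exists df'.
  by apply: (@cdfV _ (fun z => z - a)) nz _; apply: cdfB (cdf_id _) (cdf_cst _ _).
have [N hN] := goursat K0 lip dg e0.
exists (maxn N 2) => n; rewrite geq_max => /andP[/hN hn n2].
have w4 : 4 <= cmod (circ_weight n : C) := circ_weight_ge n2.
move: hn; rewrite /cell_sum.
have -> : tsum n (Phi^~ 1) g 0 1 = tsum n (Phi^~ 0) g 0 1.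
  by apply: eq_tsum => s; rewrite /Phi circ0 circ1.
rewrite (@eq_tsum _ (Phi 1) (fun t => a + eps%:C * circ t)); last first.
  by move=> t; rewrite /Phi /rad subrr mul0r add0r !mul1r; ring.
rewrite (@eq_tsum _ (Phi 0) (fun t => c + r%:C * circ t)); last first.
  by move=> t; rewrite /Phi /rad !mul0r subr0 mul1r !addr0.
rewrite !tsum_circle.
set A := cmean n a _ _; set B := cmean n c _ _ => hAB.
have {}hAB : cmod (A - B) <= e / 4.
  have e1 : cmod (circ_weight n) * cmod (A - B) <= e.
    by rewrite -cmodM; apply: le_trans hAB; rewrite le_eqVlt; apply/orP; left;
       apply/eqP; congr cmod; ring.
  by have := cmod_ge0 (A - B); nra.
have hA : cmod (A - f a) <= e / 2.
  have -> : A - f a = cmean n a eps (fun z => f z - f a).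
    rewrite cmeanD cmean_cst; congr (_ - _); apply: eq_cmean; first exact: ltW.
    move=> z hz; rewrite /g mulrCA mulfV ?mulr1 // -cmod_gt0 hz //.
  apply: cmean_bound => [|z hz]; first exact: ltW.
  by have := hrho (z - a); rewrite hz [a + _]addrC subrK; apply.
rewrite -/B; by have := cmod_tri A B (f a); rewrite [cmod (B - A)]cmodBC; lra.
Qed.

(** On the circle, z - c is at most twice as long as z - a. *)
Lemma cauchy_bound f a c r M : 0 < r -> cmod (a - c) <= r / 2 ->
  (forall z, cmod (z - c) <= r -> cdifferentiable f z) ->
  (forall z, cmod (z - c) = r -> cmod (f z) <= M) -> cmod (f a) <= 2 * M.
Proof.
move=> r0 ar df fM; have ar' : cmod (a - c) < r by lra.
apply: climit_le (cauchy_formula ar' df) _ => n.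
apply: cmean_bound => [|z hz]; first exact: ltW.
have za : r / 2 <= cmod (z - a).
  by have := cmod_dist (z - c) (a - c); rewrite opprB addrA subrK; lra.
rewrite mulrA cmodM cmodM hz cmodV ler_pdivrMr; last by lra.
by have := fM z hz; have := cmod_ge0 (f z); nra.
Qed.

(** Subtracting Cauchy's formula at c from that at c + h, the kernel
    (z - c) / (z - c - h) expands to second order in h.  The first order term is
    identified with d by letting h tend to 0. *)
Lemma cauchy_taylor f c d r M : 0 < r ->
  (forall z, cmod (z - c) <= r -> cdifferentiable f z) ->
  (forall z, cmod (z - c) = r -> cmod (f z) <= M) ->
  cdiff f c d ->
  cmod d <= M / r /\
  forall h, cmod h <= r / 2 ->
    cmod (f (c + h) - f c - d * h) <= 2 * M / r ^+ 2 * cmod h ^+ 2.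
Proof.
move=> r0 df fM hd.
have M0 : 0 <= M.
  apply: le_trans (cmod_ge0 _) (fM (c + r%:C) _).
  by rewrite [c + _]addrC addrK cmod_real gtr0_norm.
pose m0 n := cmean n c r f; pose m1 n := cmean n c r (fun z => f z / (z - c)).
pose m h n := cmean n c r (fun z => (z - c) * (f z / (z - (c + h)))).
have znz z : cmod (z - c) = r -> z - c != 0 by move=> hz; rewrite -cmod_gt0 hz.
have lim0 : climit m0 (f c).
  move=> e e0; have cc : cmod (c - c) < r by rewrite subrr cmod0.
  have [N hN] := cauchy_formula cc df e0.
  exists N => n /hN; rewrite (@eq_cmean n c r _ f) //; first exact: ltW.
  by move=> z /znz hz; rewrite mulrCA mulfV ?mulr1.
have limh h : cmod h <= r / 2 -> climit (m h) (f (c + h)).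
  move=> hh; apply: cauchy_formula => //; rewrite [c + h]addrC addrK; lra.
have est h n : cmod h <= r / 2 ->
    cmod (m h n - m0 n - h * m1 n) <= 2 * M / r ^+ 2 * cmod h ^+ 2.
  move=> hh.
  have zh z : cmod (z - c) = r -> r / 2 <= cmod (z - (c + h)).
    by move=> hz; rewrite opprD addrA; have := cmod_dist (z - c) h; lra.
  have -> : m h n - m0 n - h * m1 n =
      cmean n c r (fun z => h ^+ 2 * (f z / ((z - c) * (z - (c + h))))).
    have -> : m h n = cmean n c r (fun z => (f z + h * (f z / (z - c))) +
        h ^+ 2 * (f z / ((z - c) * (z - (c + h))))).
      apply: eq_cmean => [|z hz]; first exact: ltW.
      have n1 := znz z hz; have n2 : z - (c + h) != 0.
        by rewrite -cmod_gt0; apply: lt_le_trans (zh z hz); lra.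
      by field; rewrite n2 n1.
    by rewrite !cmeanD cmeanZ /m0 /m1; ring.
  rewrite cmeanZ cmodM cmodX mulrC; apply: ler_wpM2r; first by rewrite exprn_ge0 ?cmod_ge0.
  apply: cmean_bound => [|z hz]; first exact: ltW.
  have n1 := zh z hz.
  rewrite cmodM cmodV cmodM hz ler_pdivrMr; last by rewrite mulr_gt0 //; lra.
  apply: le_trans (fM z hz) _.
  have -> : 2 * M / r ^+ 2 * (r * cmod (z - (c + h))) = M * (cmod (z - (c + h)) / (r / 2)).
    by field; lra.
  by rewrite ler_peMr // ler_pdivlMr ?mul1r //; lra.
have lim1 : climit m1 d.
  move=> e e0; have e3 : 0 < e / 3 by lra.
  have [r1 r10 h1] := hd _ e3.
  have k0 : 0 < 2 * M / r ^+ 2 + 1.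
    have : 0 <= 2 * M / r ^+ 2 by rewrite divr_ge0 ?mulr_ge0 ?exprn_ge0 // ltW.
    lra.
  have [t t0 [tr1 tr]] := pos_below r10 (divr_gt0 r0 (ltr0n _ 2)).
  have [s s0 [st se]] := pos_below t0 (divr_gt0 e3 k0).
  have sm : cmod s%:C = s by rewrite cmod_real gtr0_norm.
  have sr : cmod s%:C <= r / 2 by rewrite sm; lra.
  have es : 0 < e / 6 * s by rewrite mulr_gt0 //; lra.
  have [N0 hN0] := lim0 _ es; have [N1 hN1] := limh _ sr _ es.
  exists (maxn N0 N1) => n; rewrite geq_max => /andP[/hN0 i0 /hN1 i1].
  have := h1 s%:C; rewrite sm => /(_ (lt_trans st tr1)) i2.
  have := est _ n sr; rewrite sm => i3.
  have i4 : 2 * M / r ^+ 2 * s ^+ 2 <= e / 3 * s.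
    have : s * (2 * M / r ^+ 2 + 1) < e / 3 by rewrite -ltr_pdivlMr.
    move: (2 * M / r ^+ 2) => k ks; rewrite expr2 mulrA; apply: ler_wpM2r; first exact: ltW.
    by nra.
  rewrite -(ler_pM2r s0) -{1}sm -cmodM.
  have -> : (m1 n - d) * s%:C = (f (c + s%:C) - f c - d * s%:C)
     - (m s%:C n - m0 n - s%:C * m1 n) + ((m s%:C n - f (c + s%:C)) - (m0 n - f c)).
    by ring.
  apply: le_trans (cmodD _ _) _.
  have := cmodB (f (c + s%:C) - f c - d * s%:C) (m s%:C n - m0 n - s%:C * m1 n).
  have := cmodB (m s%:C n - f (c + s%:C)) (m0 n - f c).
  lra.
split.
  apply: climit_le lim1 _ => n; apply: cmean_bound => [|z hz]; first exact: ltW.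
  by rewrite cmodM cmodV hz ler_pM2r ?invr_gt0 // fM.
move=> h hh; apply: (@climit_le R (fun n => m h n - m0 n - h * m1 n)); last first.
  by move=> n; apply: est.
rewrite [d * h]mulrC; apply: climitD; last exact/climitN/climitMl.
by apply: climitD; [exact: limh|exact: climitN].
Qed.

End CauchyEstimates.
(** * Consequences of the Cauchy estimates in one variable *)

Section OneVariable.
Context {R : realType}.
Notation C := R[i].
Implicit Types (f g : C -> C) (a c d : C) (r M : R).

Lemma cdiff_quadratic f c d r k : 0 < r -> 0 <= k ->
  (forall h, cmod h < r -> cmod (f (c + h) - f c - d * h) <= k * cmod h ^+ 2) ->
  cdiff f c d.
Proof.
move=> r0 k0 hq e e0; have k1 : 0 < k + 1 by lra.
have [t t0 [tr te]] := pos_below r0 (divr_gt0 e0 k1).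
exists t => // h ht; apply: le_trans (hq h (lt_trans ht tr)) _.
rewrite expr2 mulrA; apply: ler_wpM2r; first exact: cmod_ge0.
have : cmod h * (k + 1) < e by rewrite -ltr_pdivlMr // (lt_trans ht).
by have := cmod_ge0 h; nra.
Qed.

(** By the Cauchy estimates the derivatives of the approximants at the centre
    converge, and their Taylor remainders have a common bound. *)
Lemma weierstrass f c r M : 0 < r ->
  (forall z, cmod (z - c) <= r -> cmod (f z) <= M) ->
  (forall e : R, 0 < e -> exists g, forall z, cmod (z - c) <= r ->
     cdifferentiable g z /\ cmod (f z - g z) <= e) ->
  cdifferentiable f c.
Proof.
move=> r0 fM fg.
pose P (e : R) d := exists g, (forall z, cmod (z - c) <= r ->
     cdifferentiable g z /\ cmod (f z - g z) <= e) /\ cdiff g c d.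
have cr : cmod (c - c) <= r by rewrite subrr cmod0 ltW.
have exP e : 0 < e -> exists d, P e d.
  move=> /fg[g hg]; have [[d hd] _] := hg c cr.
  by exists d, g.
have cP (e e' : R) d d' : 0 < e -> 0 < e' -> P e d -> P e' d' ->
    cmod (d - d') <= r^-1 * (e + e').
  move=> e0 e'0 [g [hg hd]] [g' [hg' hd']].
  have [|||dle _] := @cauchy_taylor R (fun z => g z - g' z) c (d - d') r (e + e') r0.
  - by move=> z hz; apply: cdfB; [have [] := hg z hz|have [] := hg' z hz].
  - move=> z hz; have [_ h1] := hg z (eq_leW hz); have [_ h2] := hg' z (eq_leW hz).
    by have := cmod_tri (f z) (g z) (g' z); rewrite [cmod (g z - f z)]cmodBC; lra.
  - exact: cdiffB.
  by rewrite mulrC.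
have [l hl] := cauchy_choice exP cP.
have M0 : 0 <= M by apply: le_trans (fM c cr); apply: cmod_ge0.
exists l; apply: (@cdiff_quadratic _ _ _ (r / 2) (2 * (M + 1) / r ^+ 2)).
- by lra.
- by rewrite divr_ge0 ?mulr_ge0 ?exprn_ge0 //; lra.
move=> h hh; apply/ler_addgt0Pr => e e0.
pose k := 3 + cmod h / r; have k0 : 0 < k.
  have : 0 <= cmod h / r by rewrite divr_ge0 ?cmod_ge0 // ltW.
  by rewrite /k; lra.
have [eta eta0 [eta1 etae]] := pos_below ltr01 (divr_gt0 e0 k0).
have [d [g [hg hd]]] := exP _ eta0.
have dl := hl _ _ eta0 (ex_intro _ g (conj hg hd)).
have [||_ ht] := @cauchy_taylor R g c d r (M + 1) r0 _ _ hd.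
- by move=> z /hg[].
- move=> z hz; have [_ h1] := hg z (eq_leW hz); have h2 := fM z (eq_leW hz).
  by have := cmod_dist (g z) (f z); rewrite cmodBC; lra.
have hh2 : cmod h <= r / 2 by lra.
have {}ht := ht h hh2.
have [_ i1] := hg c cr; have [|_ i2] := hg (c + h).
  by rewrite [c + h]addrC addrK; lra.
have i3 : cmod ((d - l) * h) <= eta * (cmod h / r).
  rewrite cmodM; apply: le_trans (ler_wpM2r (cmod_ge0 h) dl) _.
  by rewrite mulrAC mulrC [_^-1 * _]mulrC.
have -> : f (c + h) - f c - l * h = (g (c + h) - g c - d * h) + (d - l) * h
    + ((f (c + h) - g (c + h)) - (f c - g c)) by ring.
have i4 : eta * k <= e by rewrite -ler_pdivlMr // ltW.
apply: le_trans (cmodD _ _) _; apply: le_trans (lerD (cmodD _ _) (cmodB _ _)) _.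
move: i4; rewrite /k; lra.
Qed.

(** Dividing f by (z - c)^n keeps it differentiable, as f vanishes near c; the
    Cauchy bound for the quotient gives |f(a)| <= 2 M (|a - c| / r)^n. *)
Lemma zero_disc f c r M (s : R) : 0 < r -> 0 < s ->
  (forall z, cmod (z - c) <= r -> cdifferentiable f z) ->
  (forall z, cmod (z - c) = r -> cmod (f z) <= M) ->
  (forall z, cmod (z - c) < s -> f z = 0) ->
  forall a, cmod (a - c) <= r / 2 -> f a = 0.
Proof.
move=> r0 s0 df fM f0 a ha.
have [as_|as_] := ltP (cmod (a - c)) s; first exact: f0.
have bnd n : cmod (f a) <= 2 * M * 2 ^- n.
  have dh z : cmod (z - c) <= r -> cdifferentiable (fun z => f z / (z - c) ^+ n) z.
    move=> hz; have [->|zc] := eqVneq z c.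
      apply: (@cdf_near _ _ (fun=> 0) c s) => //; last exact: cdf_cst.
      by move=> h hs; rewrite f0 ?mul0r // [c + h]addrC addrK.
    apply: cdfM; first exact: df.
    apply: (@cdfV _ (fun z => (z - c) ^+ n)); first by rewrite expf_neq0 // subr_eq0.
    by apply: (@cdfX _ (fun z => z - c)); apply: cdfB (cdf_id _) (cdf_cst _ _).
  have : cmod (f a / (a - c) ^+ n) <= 2 * (M / r ^+ n).
    apply: (cauchy_bound r0 ha dh).
    by move=> z hz; rewrite cmodM cmodV cmodX hz ler_pM2r ?fM // invr_gt0 exprn_gt0.
  rewrite cmodM cmodV cmodX ler_pdivrMr; last by rewrite exprn_gt0 // (lt_le_trans s0).
  move=> h; apply: le_trans h _.
  have M0 : 0 <= M.
    apply: le_trans (cmod_ge0 _) (fM (c + r%:C) _).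
    by rewrite [c + _]addrC addrK cmod_real gtr0_norm.
  rewrite -!mulrA; apply: ler_wpM2l => //; apply: ler_wpM2l => //.
  rewrite -!exprVn -exprMn; apply: lerXn2r; rewrite ?nnegrE ?mulr_ge0 ?cmod_ge0 ?invr_ge0 ?(ltW r0) //.
  by rewrite mulrC ler_pdivrMr // mulrC.
apply: cmod_small => e e0.
have M1 : 0 < 2 * `|M| + 1 by have := normr_ge0 M; lra.
have [n hn] := half_pow_small (divr_gt0 e0 M1).
apply: le_trans (bnd n) _; move: hn; rewrite ltr_pdivlMr // => hn.
have : 0 < 2 ^- n :> R by rewrite invr_gt0 exprn_gt0.
by have := ler_norm M; nra.
Qed.

(** A function vanishing on the real axis is differentiable after being replaced
    by 0 below the axis, and therefore vanishes above it as well. *)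
Lemma zero_real f r M : 0 < r ->
  (forall z, cmod z <= r -> cdifferentiable f z) ->
  (forall z, cmod z <= r -> cmod (f z) <= M) ->
  (forall x : R, `|x| <= r -> f x%:C = 0) ->
  forall z, cmod z <= r / 8 -> f z = 0.
Proof.
move=> r0 df fM f0.
suff half g : (forall z, cmod z <= r -> cdifferentiable g z) ->
    (forall z, cmod z <= r -> cmod (g z) <= M) ->
    (forall x : R, `|x| <= r -> g x%:C = 0) ->
    forall z, cmod z <= r / 8 -> 0 <= complex.Im z -> g z = 0.
  move=> z hz; have [zp|zn] := leP 0 (complex.Im z); first exact: (half f).
  rewrite -[z]opprK; apply: (half (fun z => f (- z))) => [y hy|y hy|x hx||].
  - apply: (@cdf_comp _ -%R); last by apply: df; rewrite cmodN.
    by exists (- 1); apply: cdiffN (cdiff_id _).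
  - by apply: fM; rewrite cmodN.
  - by rewrite -rmorphN f0 // normrN.
  - by rewrite cmodN.
  - by rewrite raddfN /= oppr_ge0 ltW.
move=> {f df fM f0} dg gM g0 z hz zp.
pose h z := if 0 <= complex.Im z then g z else 0.
(* a centre below the axis: h vanishes on a disc around it *)
pose p : C := 0 +i* - (r / 8).
have cp : cmod p = r / 8.
  by rewrite cmod_sqrt /= expr0n /= add0r sqrrN sqrtr_sqr ger0_norm //; lra.
have ImB (x y : C) : complex.Im (x + y) = complex.Im x + complex.Im y.
  by rewrite raddfD.
suff : h z = 0 by rewrite /h zp.
have inr y : cmod (y - p) <= r / 2 -> cmod y <= r / 8 * 5.
  by move=> hy; have := cmodD (y - p) p; rewrite subrK cp; lra.
apply: (@zero_disc h p (r / 2) M (r / 8)); rewrite ?divr_gt0 //.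
- move=> y /inr hy; have [yp|yn|y0] := ltgtP 0 (complex.Im y).
  + apply: (@cdf_near _ _ g y (complex.Im y)) => // [k hk|]; last by apply: dg; lra.
    rewrite /h ImB; have := cmod_Im k; rewrite ler_norml => /andP[k1 k2].
    by have -> : 0 <= complex.Im y + complex.Im k by lra.
  + apply: (@cdf_near _ _ (fun=> 0) y (- complex.Im y)) => // [|k hk|]; last exact: cdf_cst.
      by lra.
    rewrite /h ImB; have := cmod_Im k; rewrite ler_norml => /andP[k1 k2].
    by have -> : 0 <= complex.Im y + complex.Im k = false by lra.
  + have yE : y = (complex.Re y)%:C by rewrite {1}[y]complexE -y0 mulr0 addr0.
    have [d hd] : cdifferentiable g y by apply: dg; lra.
    have gr (t : R) : `|t| <= r / 8 -> g (y + t%:C) = 0.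
      move=> ht; rewrite yE -rmorphD g0 // -cmod_real rmorphD /= -yE.
      by apply: le_trans (cmodD _ _) _; rewrite cmod_real; lra.
    have gy : g y = 0 by have := gr 0; rewrite normr0 addr0; apply; lra.
    have d0 : d = 0.
      apply: cmod_small => e /hd[s s0 hs].
      have r8 : 0 < r / 8 by lra.
      have [t t0 [ts tr]] := pos_below s0 r8.
      have := hs t%:C; rewrite cmod_real gtr0_norm // gr ?gtr0_norm //; last exact: ltW.
      rewrite gy subrr sub0r cmodN cmodM cmod_real gtr0_norm // => /(_ ts).
      by rewrite ler_pM2r.
    exists 0 => e /hd[s s0 hs]; exists s => // k /hs; rewrite d0 mul0r subr0 /h -y0 lexx gy.
    rewrite !subr0 => hk; case: ifP => _ //.
    by rewrite cmod0 (le_trans (cmod_ge0 _) hk).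
- move=> y hy; rewrite /h; case: ifP => _; last first.
    by rewrite cmod0; apply: le_trans (cmod_ge0 _) (gM 0 _); rewrite cmod0 ltW.
  by apply: gM; have := inr y (eq_leW hy); lra.
- move=> y hy; rewrite /h; case: ifP => // y0; exfalso.
  have := le_lt_trans (cmod_Im _) hy; rewrite raddfB /= opprK ltr_norml.
  by move=> /andP[_]; lra.
by have := cmodB z p; rewrite cp; lra.
Qed.

(** The heart of Osgood's lemma: bounded and separately differentiable functions of
    two variables are differentiable along the diagonal.  The first partial
    derivative is continuous in the second variable at 0, being a uniform limit of
    difference quotients. *)
Lemma cdiff_diag (f : C -> C -> C) r M d1 d2 : 0 < r ->
  (forall x y, cmod x <= r -> cmod y <= r -> cmod (f x y) <= M) ->
  (forall x y, cmod x <= r -> cmod y <= r -> cdifferentiable (f^~ y) x) ->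
  cdifferentiable (f 0) 0 -> (forall x, cmod x <= r -> cdifferentiable (f x) 0) ->
  cdiff (f^~ 0) 0 d1 -> cdiff (f 0) 0 d2 ->
  cdiff (fun z => f z z) 0 (d1 + d2).
Proof.
move=> r0 fM df1 df00 df2 hd1 hd2.
have rr : cmod (0 : C) <= r by rewrite cmod0 ltW.
have M0 : 0 <= M by apply: le_trans (cmod_ge0 _) (fM 0 0 rr rr).
pose c1 y := cderiv (f^~ y) 0.
have c10 : c1 0 = d1 by apply: cderivE.
have taylor y h : cmod y <= r -> cmod h <= r / 2 ->
    cmod (f h y - f 0 y - c1 y * h) <= 2 * M / r ^+ 2 * cmod h ^+ 2.
  move=> hy; have [||_ ht] := @cauchy_taylor R (f^~ y) 0 (c1 y) r M r0 _ _
      (cderivP (df1 0 y rr hy)).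
  - by move=> z; rewrite subr0 => hz; apply: df1.
  - by move=> z; rewrite subr0 => hz; apply: fM (eq_leW hz) hy.
  by move=> hh; have := ht h hh; rewrite add0r.
pose k : R := 2 * M / r ^+ 2 + 1.
have k0 : 0 < k.
  have : 0 <= 2 * M / r ^+ 2 by rewrite divr_ge0 ?mulr_ge0 ?exprn_ge0 // ltW.
  by rewrite /k; lra.
have r2 : 0 < r / 2 by lra.
(* continuity at 0 of the partial derivative c1 *)
have c1_cont e : 0 < e -> exists2 s : R, 0 < s &
    forall y, cmod y < s -> cmod (c1 y - d1) <= e.
  move=> e0; have [t t0 [tr te]] := pos_below r2 (divr_gt0 e0 (mulr_gt0 (ltr0n _ 4) k0)).
  have tm : cmod t%:C = t by rewrite cmod_real gtr0_norm.
  have tr1 : cmod t%:C <= r by rewrite tm; lra.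
  have et : 0 < e * t / 4 by rewrite divr_gt0 ?mulr_gt0.
  have [[a ha] [b hb]] := (df2 _ tr1, df2 _ rr).
  have [s1 s10 hs1] := cdiff_cont ha et.
  have [s2 s20 hs2] := cdiff_cont hb et.
  have [s3 s30 [s31 s32]] := pos_below s10 s20.
  have [s s_0 [ss sr]] := pos_below s30 r0.
  exists s => // y hy.
  have := hs1 y (lt_trans hy (lt_trans ss s31)).
  have := hs2 y (lt_trans hy (lt_trans ss s32)).
  have := taylor y t%:C (ltW (lt_trans hy sr)); rewrite tm => /(_ (ltW tr)).
  have := taylor 0 t%:C rr; rewrite tm => /(_ (ltW tr)).
  rewrite c10 !add0r => i1 i2 i3 i4.
  rewrite -(ler_pM2r t0) -{1}tm -cmodM.
  have -> : (c1 y - d1) * t%:C = ((f t%:C 0 - f 0 0 - d1 * t%:C) -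
     (f t%:C y - f 0 y - c1 y * t%:C)) + ((f t%:C y - f t%:C 0) - (f 0 y - f 0 0)).
    by ring.
  apply: le_trans (cmodD _ _) _; apply: le_trans (lerD (cmodB _ _) (cmodB _ _)) _.
  have : 2 * M / r ^+ 2 * t ^+ 2 <= e * t / 4.
    have : t * (4 * k) < e by rewrite -ltr_pdivlMr // mulr_gt0.
    rewrite /k; move: (2 * M / r ^+ 2) => x hx.
    have xt : x * t <= e / 4 by lra.
    have := ler_wpM2r (ltW t0) xt; lra.
  lra.
move=> e e0; have e3 : 0 < e / 3 by lra.
have [s1 s10 hs1] := c1_cont _ e3; have [s2 s20 hs2] := hd2 _ e3.
have ek : 0 < e / 3 / k by rewrite divr_gt0.
have [s3 s30 [s31 s32]] := pos_below s10 s20.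
have [s4 s40 [s41 s42]] := pos_below r2 ek.
have [s s_0 [ss3 ss4]] := pos_below s30 s40.
exists s => // h hs.
have h3 := lt_trans hs ss3; have h4 := lt_trans hs ss4.
have hr : cmod h <= r / 2 by have := lt_trans h4 s41; lra.
have i1 := hs1 h (lt_trans h3 s31); have i2 := hs2 h (lt_trans h3 s32).
have i3 : cmod (f h h - f 0 h - c1 h * h) <= e / 3 * cmod h.
  apply: le_trans (taylor _ _ _ hr) _; first by have := cmod_ge0 h; lra.
  have : cmod h * k < e / 3 by rewrite -ltr_pdivlMr // (lt_trans h4).
  have := cmod_ge0 h; rewrite /k; move: (2 * M / r ^+ 2) (cmod h) => x y y0 hx.
  have xt : x * y <= e / 3 by lra.
  have := ler_wpM2r y0 xt; lra.
rewrite !add0r in i2 *.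
have -> : f h h - f 0 0 - (d1 + d2) * h = (f h h - f 0 h - c1 h * h) +
  (c1 h - d1) * h + (f 0 h - f 0 0 - d2 * h) by ring.
apply: le_trans (cmodD _ _) _; apply: le_trans (lerD (cmodD _ _) (lexx _)) _.
have : cmod ((c1 h - d1) * h) <= e / 3 * cmod h.
  by rewrite cmodM; apply: ler_wpM2r => //; apply: cmod_ge0.
lra.
Qed.

(** If the increment exceeded k + e times the length on the unit interval, it would
    do so on arbitrarily short intervals around a point, where f is nearly
    affine. *)
Lemma mean_value f (df : C -> C) (k : R) : 0 <= k ->
  (forall t : R, 0 <= t <= 1 -> cdiff f t%:C (df t%:C)) ->
  (forall t : R, 0 <= t <= 1 -> cmod (df t%:C) <= k) ->
  cmod (f 1 - f 0) <= k.
Proof.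
move=> k0 hdf dfk; apply/ler_addgt0Pr => e e0; rewrite leNgt; apply/negP => bad.
have [|a h h0 hP|x hx] := @nested_intervals R
    (fun (b h : R) => (k + e) * h < cmod (f (b + h)%:C - f b%:C)).
- by rewrite add0r mulr1 rmorph1 rmorph0.
- have tri := cmod_tri (f (a + h / 2)%:C) (f (a + h)%:C) (f a%:C).
  have [h1|h1] := ltP ((k + e) * (h / 2)) (cmod (f (a + h / 2)%:C - f a%:C)).
    by exists false; rewrite mul0r addr0.
  exists true; rewrite mul1r -addrA -splitr; lra.
have x01 : 0 <= x <= 1 by have [a [h [/andP[h0 _] /andP[? ?] /andP[? ?] _]]] := hx 1 ltr01; lra.
have [r r0 hr] := hdf x x01 _ e0.
have [a [h [/andP[h0 hsr] /andP[a0 ax] /andP[xa ah]]]] := hx r r0.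
apply/negP; rewrite -leNgt.
have near t : `|t - x| < r -> cmod (f t%:C - f x%:C) <= (k + e) * `|t - x|.
  move=> tx; have := hr (t - x)%:C; rewrite cmod_real => /(_ tx).
  have -> : x%:C + (t - x)%:C = t%:C :> C by rewrite -rmorphD /= addrC subrK.
  move=> h1.
  rewrite -[f _ - _](subrK (df x%:C * (t - x)%:C)).
  apply: le_trans (cmodD _ _) _; rewrite cmodM cmod_real.
  have := ler_wpM2r (normr_ge0 (t - x)) (dfk x x01); lra.
have n1 : `|a + h - x| = a + h - x by rewrite ger0_norm // subr_ge0.
have n2 : `|a - x| = x - a by rewrite distrC ger0_norm // subr_ge0.
have := near (a + h); rewrite n1 => h1; have := near a; rewrite n2 => h2.
have := cmod_tri (f x%:C) (f (a + h)%:C) (f a%:C).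
rewrite [cmod (f x%:C - f a%:C)]cmodBC.
have {}h1 := h1 ltac:(lra); have {}h2 := h2 ltac:(lra).
lra.
Qed.

End OneVariable.
(** * Holomorphic functions of several variables *)

(** The theory below uses no topology other than the balls of one real valued
    seminorm, and thus covers C^m and C^m x C^m with norms of one's choice. *)
Record cseminorm (R : realType) (E : lmodType R[i]) := CSeminorm {
  csn :> E -> R;
  csnD : forall u v, csn (u + v) <= csn u + csn v;
  csnZ : forall (a : R[i]) v, csn (a *: v) = cmod a * csn v }.

Section Holo.
Context {R : realType} {E : lmodType R[i]} (N : cseminorm E).
Notation C := R[i].
Implicit Types (Om : set E) (f g : E -> C) (p q u v : E).

Lemma csn0 : N 0 = 0.
Proof. by rewrite -(scale0r 0) csnZ cmod0 mul0r. Qed.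

Lemma csnN v : N (- v) = N v.
Proof. by rewrite -scaleN1r csnZ cmodN cmod1 mul1r. Qed.

Lemma csn_ge0 v : 0 <= N v.
Proof. by have := csnD N v (- v); rewrite subrr csn0 csnN; lra. Qed.

Lemma csnZr (t : R) v : N (t%:C *: v) = `|t| * N v.
Proof. by rewrite csnZ cmod_real. Qed.

Lemma csn_near p q u (r s : R) : N (q - p) < r -> N u <= s -> N (q + u - p) < r + s.
Proof.
by move=> hq hu; rewrite addrAC; have := csnD N (q - p) u; lra.
Qed.

(** Local boundedness together with differentiability along complex lines: for
    functions of several complex variables this is holomorphy. *)
Definition holo Om f : Prop := forall p, Om p ->
  (exists r M : R, 0 < r /\ forall q, N (q - p) < r -> Om q /\ cmod (f q) <= M) /\
  (forall v, cdifferentiable (fun z => f (p + z *: v)) 0).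

Definition dirD v f p : C := cderiv (fun z => f (p + z *: v)) 0.

Lemma holo_line Om f p v z : holo Om f -> Om (p + z *: v) ->
  cdiff (fun z => f (p + z *: v)) z (dirD v f (p + z *: v)).
Proof.
move=> hf /hf[_ /(_ v) /cderivP hd].
rewrite -[X in cdiff _ X]addr0; apply/cdiff_shift.
by apply: cdiff_ext hd => y; rewrite scalerDl addrA.
Qed.

Lemma dirDP Om f p v : holo Om f -> Om p ->
  cdiff (fun z => f (p + z *: v)) 0 (dirD v f p).
Proof. by move=> hf hp; apply/cderivP/(hf _ hp).2. Qed.

Lemma dirDE v f p d : cdiff (fun z => f (p + z *: v)) 0 d -> dirD v f p = d.
Proof. exact: cderivE. Qed.

(** The one-variable estimates on the complex line spanned by v.  The constants
    depend only on r and on the bound M, which makes these estimates uniform over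
    families of functions. *)
Lemma holo_cauchy Om f p (r M : R) : holo Om f -> 0 < r ->
  (forall q, N (q - p) < r -> Om q /\ cmod (f q) <= M) ->
  forall v t, N v <= t -> 0 < t -> cmod (dirD v f p) <= 2 * M / r * t /\
    (4 * t <= r -> cmod (f (p + v) - f p - dirD v f p) <= 8 * M / r ^+ 2 * t ^+ 2).
Proof.
move=> hf r0 hr v t vt t0; pose rho := r / (2 * t).
have [hOp _] : Om p /\ cmod (f p) <= M by apply: hr; rewrite subrr csn0.
have rho0 : 0 < rho by rewrite /rho divr_gt0 // mulr_gt0.
have inO z : cmod z <= rho -> Om (p + z *: v) /\ cmod (f (p + z *: v)) <= M.
  move=> hz; apply: hr; rewrite addrAC subrr add0r csnZ.
  have : cmod z * N v <= rho * t by apply: ler_pM => //; [exact: cmod_ge0|exact: csn_ge0].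
  have -> : rho * t = r / 2 by rewrite /rho; field; lra.
  lra.
have [||hd ht] := @cauchy_taylor R (fun z => f (p + z *: v)) 0 (dirD v f p) rho M rho0 _ _
   (dirDP v hf hOp).
- move=> z; rewrite subr0 => hz; exists (dirD v f (p + z *: v)).
  by apply: (holo_line hf); apply: (inO _ hz).1.
- by move=> z; rewrite subr0 => hz; apply: (inO _ (eq_leW hz)).2.
split; first by have -> : 2 * M / r * t = M / rho by [rewrite /rho; field; lra].
move=> tr; have := ht 1; rewrite cmod1 scale0r addr0 add0r scale1r mulr1 expr1n mulr1.
have r1 : 1 <= rho / 2.
  have -> : rho / 2 = r / (4 * t) by rewrite /rho; field; lra.
  by rewrite ler_pdivlMr ?mulr_gt0 // mul1r.
move=> /(_ r1) h; apply: le_trans h _.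
by apply: eq_leW; rewrite /rho; field; lra.
Qed.

Lemma holo_lipschitz Om f p (r M : R) v t : holo Om f -> 0 < r ->
  (forall q, N (q - p) < r -> Om q /\ cmod (f q) <= M) ->
  N v <= t -> 0 < t -> 4 * t <= r -> cmod (f (p + v) - f p) <= 4 * M / r * t.
Proof.
move=> hf r0 hr vt t0 tr; have [h1 /(_ tr) h2] := holo_cauchy hf r0 hr vt t0.
have [_ fM] : Om p /\ cmod (f p) <= M by apply: hr; rewrite subrr csn0.
have M0 : 0 <= M / r by rewrite divr_ge0 ?(le_trans _ fM) ?cmod_ge0 // ltW.
have h3 : 8 * M / r ^+ 2 * t ^+ 2 <= 2 * M / r * t.
  have -> : 8 * M / r ^+ 2 * t ^+ 2 = 2 * (M / r * t) * (4 * t / r) by field; lra.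
  have -> : 2 * M / r * t = 2 * (M / r * t) by field; lra.
  rewrite ler_piMr //; first by rewrite mulr_ge0 // mulr_ge0 // ltW.
  by rewrite ler_pdivrMr // mul1r.
have := cmodD (f (p + v) - f p - dirD v f p) (dirD v f p); rewrite subrK.
have -> : 4 * M / r * t = 2 * M / r * t + 2 * M / r * t by field; lra.
lra.
Qed.

Lemma holo_est Om f p : holo Om f -> Om p -> exists r M : R,
  [/\ 0 < r, 0 <= M & forall q, N (q - p) < r -> [/\ Om q, cmod (f q) <= M &
    forall v t, N v <= t -> 0 < t -> cmod (dirD v f q) <= M * t /\
      (t <= r -> cmod (f (q + v) - f q - dirD v f q) <= M * t ^+ 2)]].
Proof.
move=> hf hp; have [[r0 [M0 [r00 hr]]] _] := hf p hp.
have M00 : 0 <= M0.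
  by apply: le_trans (cmod_ge0 (f p)) _; apply: (hr p _).2; rewrite subrr csn0.
have r02 : 0 < r0 / 2 by lra.
pose k1 := 2 * M0 / (r0 / 2); pose k2 := 8 * M0 / (r0 / 2) ^+ 2.
have k10 : 0 <= k1 by rewrite /k1 divr_ge0 // ?mulr_ge0 // ltW.
have k20 : 0 <= k2 by rewrite /k2 divr_ge0 ?mulr_ge0 ?exprn_ge0 // ltW.
exists (r0 / 8), (M0 + k1 + k2); split; [by lra|by lra|] => q hq.
have [|hOq hfq] := hr q; first by lra.
split=> //; first by lra.
have hr' q' : N (q' - q) < r0 / 2 -> Om q' /\ cmod (f q') <= M0.
  move=> hq'; apply: hr; have := csnD N (q' - q) (q - p).
  by rewrite addrA subrK; lra.
move=> v t vt t0; have [h1 h2] := holo_cauchy hf r02 hr' vt t0.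
split.
  by apply: le_trans h1 _; rewrite -/k1 ler_pM2r //; lra.
move=> tr; apply: le_trans (h2 _) _; first by lra.
by rewrite -/k2 ler_pM2r ?exprn_gt0 //; lra.
Qed.

Lemma holo_cont Om f p (e : R) : holo Om f -> Om p -> 0 < e ->
  exists2 r : R, 0 < r & forall q, N (q - p) < r -> Om q /\ cmod (f q - f p) <= e.
Proof.
move=> hf hp e0; have [r [M [r0 M0 hr]]] := holo_est hf hp.
have k0 : 0 < 2 * M + 1 by lra.
have [s s0 [s1 s2]] := pos_below ltr01 (divr_gt0 e0 k0).
have [t t0 [tr ts]] := pos_below r0 s0.
exists t => // q hq; split; first by have [] := hr q (lt_trans hq tr).
have [_ _ /(_ (q - p) t (ltW hq) t0)[i1 /(_ (ltW tr)) i2]] := hr p ltac:(by rewrite subrr csn0).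
move: i2; rewrite [p + _]addrC subrK => i2.
rewrite -[f q - f p](subrK (dirD (q - p) f p)); apply: le_trans (cmodD _ _) _.
have : t * (2 * M + 1) < e by rewrite -ltr_pdivlMr // (lt_trans ts).
have : M * t ^+ 2 <= M * t.
  by rewrite expr2 mulrA ler_piMr ?mulr_ge0 ?(ltW t0) //; lra.
lra.
Qed.

Lemma holo_limit Om f :
  (forall p, Om p -> exists r M : R, [/\ 0 < r,
     forall q, N (q - p) < r -> Om q /\ cmod (f q) <= M &
     forall e : R, 0 < e -> exists2 g, holo Om g &
       forall q, N (q - p) < r -> cmod (f q - g q) <= e]) ->
  holo Om f.
Proof.
move=> hf p hp; have [r [M [r0 hM app]]] := hf p hp.
split; first by exists r, M.
move=> v; pose s := r / (2 * (N v + 1)).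
have v0 := csn_ge0 v.
have s0 : 0 < s by rewrite divr_gt0 // mulr_gt0 //; lra.
have inr z : cmod (z - 0) <= s -> N (p + z *: v - p) < r.
  rewrite subr0 => hz; rewrite addrAC subrr add0r csnZ.
  have : cmod z * (N v + 1) <= r / 2.
    have -> : r / 2 = s * (N v + 1) by rewrite /s; field; lra.
    by apply: ler_wpM2r => //; lra.
  by have := cmod_ge0 z; nra.
apply: (@weierstrass R _ 0 s M) => // [z /inr /hM[]//|e /app[g hg fg]].
exists (fun z => g (p + z *: v)) => z hz; split; last exact/fg/inr.
by exists (dirD v g (p + z *: v)); apply: (holo_line hg); apply: (hM _ (inr z hz)).1.
Qed.

(** Directional derivatives are locally uniform limits of difference quotients,
    with a rate given by the second order estimate. *)
Lemma holo_dirD Om f v : holo Om f -> holo Om (dirD v f).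
Proof.
move=> hf p hp; have [r [M [r0 M0 hr]]] := holo_est hf hp.
have v0 := csn_ge0 v; pose t := N v + 1; have t0 : 0 < t by rewrite /t; lra.
have vt : N v <= t by rewrite /t; lra.
split.
  exists r, (M * t); split=> // q /hr[Oq _ /(_ v t vt t0)[]//].
move=> u; have u0 := csn_ge0 u; pose s := r / (4 * (N u + 1)).
have s0 : 0 < s by rewrite divr_gt0 // mulr_gt0 //; lra.
have inr z : cmod (z - 0) <= s -> N (z *: u) <= r / 4.
  rewrite subr0 => hz; rewrite csnZ.
  have : cmod z * (N u + 1) <= r / 4.
    have -> : r / 4 = s * (N u + 1) by rewrite /s; field; lra.
    by apply: ler_wpM2r => //; lra.
  by have := cmod_ge0 z; nra.
have inr1 z : cmod (z - 0) <= s -> N (p + z *: u - p) < r.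
  by move=> /inr hz; rewrite addrAC subrr add0r; lra.
apply: (@weierstrass R _ 0 s (M * t)) => // [z /inr1 /hr[_ _ /(_ v t vt t0)[]//]|e e0].
have Mt0 : 0 < M * t ^+ 2 + 1.
  have : 0 <= M * t ^+ 2 by rewrite mulr_ge0 ?exprn_ge0 // ltW.
  lra.
have r2t : 0 < r / (2 * t) by rewrite divr_gt0 // mulr_gt0.
have [k k0 [ke kr]] := pos_below (divr_gt0 e0 Mt0) r2t.
have kn0 : k%:C != 0 :> C by rewrite -cmod_gt0 cmod_real gtr0_norm.
have ktr : k * t < r / 2.
  by have := kr; rewrite ltr_pdivlMr ?mulr_gt0 //; lra.
have Nkv : N (k%:C *: v) <= k * t by rewrite csnZr gtr0_norm // ler_pM2l.
exists (fun z => (f (p + k%:C *: v + z *: u) - f (p + z *: u)) / k%:C) => z hz.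
have Oz : Om (p + z *: u) by have [] := hr _ (inr1 z hz).
split.
  apply: cdfM (cdf_cst _ _); apply: cdfB.
    exists (dirD u f (p + k%:C *: v + z *: u)); apply: (holo_line hf).
    suff /hr[] : N (p + k%:C *: v + z *: u - p) < r by [].
    rewrite -(addrA p) [p + _]addrC addrK; apply: le_lt_trans (csnD _ _ _) _.
    by have := inr z hz; lra.
  by exists (dirD u f (p + z *: u)); apply: (holo_line hf).
have [_ _ /(_ (k%:C *: v) (k * t) Nkv (mulr_gt0 k0 t0))[_]] := hr _ (inr1 z hz).
move=> /(_ ltac:(lra)).
have -> : dirD (k%:C *: v) f (p + z *: u) = dirD v f (p + z *: u) * k%:C.
  apply: dirDE.
  have := @cdiff_comp R (fun y => 0 + y * k%:C) (fun y => f (p + z *: u + y *: v)) 0 k%:C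
    (dirD v f (p + z *: u)) (cdiff_affine _ _ _).
  rewrite mul0r addr0 => /(_ (dirDP v hf Oz)).
  by apply: cdiff_ext => y; rewrite add0r scalerA.
rewrite (addrAC p) => i.
rewrite -(ler_pM2r k0) -[X in _ * X <= _](gtr0_norm k0) -cmod_real -cmodM mulrBl mulfVK //.
rewrite cmodBC; apply: le_trans i _.
have : k * (M * t ^+ 2 + 1) < e by rewrite -ltr_pdivlMr.
move=> h; have : k * (k * (M * t ^+ 2 + 1)) <= k * e by rewrite ler_pM2l // ltW.
nra.
Qed.

End Holo.
Section HoloAlgebra.
Context {R : realType} {E : lmodType R[i]} (N : cseminorm E).
Notation C := R[i].
Implicit Types (Om : set E) (f g : E -> C) (p q u v : E).
Notation holo := (holo N).

Lemma dirDZ Om f p a v : holo Om f -> Om p -> dirD (a *: v) f p = a * dirD v f p.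
Proof.
move=> hf hp; apply: dirDE.
have := @cdiff_comp R (fun y => 0 + y * a) (fun y => f (p + y *: v)) 0 a
  (dirD v f p) (cdiff_affine _ _ _).
rewrite mul0r addr0 [_ * a]mulrC => /(_ (dirDP v hf hp)).
by apply: cdiff_ext => y; rewrite add0r scalerA.
Qed.

(** Linearity of the derivative in the direction is Osgood's lemma on the complex
    plane spanned by u and v. *)
Lemma dirD_add Om f p u v : holo Om f -> Om p ->
  dirD (u + v) f p = dirD u f p + dirD v f p.
Proof.
move=> hf hp; apply: dirDE.
have [[r [M [r0 hr]]] _] := hf p hp.
have u0 := csn_ge0 N u; have v0 := csn_ge0 N v.
pose s := r / (2 * (N u + N v + 1)).
have s0 : 0 < s by rewrite divr_gt0 // mulr_gt0 //; lra.
have inr x y : cmod x <= s -> cmod y <= s -> N (p + x *: u + y *: v - p) < r.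
  move=> hx hy; rewrite -(addrA p) [p + _]addrC addrK.
  apply: le_lt_trans (csnD N _ _) _; rewrite !csnZ.
  have : s * (N u + N v + 1) = r / 2 by rewrite /s; field; lra.
  have := ler_wpM2r u0 hx; have := ler_wpM2r v0 hy; lra.
have Or x y hx hy := (hr _ (inr x y hx hy)).1.
have ss : cmod (0 : C) <= s by rewrite cmod0 ltW.
apply: (@cdiff_ext R _ (fun z => f (p + z *: u + z *: v))).
  by move=> z; rewrite scalerDr addrA.
have lx x y : cmod x <= s -> cmod y <= s ->
    cdiff (fun z => f (p + z *: u + y *: v)) x (dirD u f (p + x *: u + y *: v)).
  move=> hx hy; rewrite addrAC; apply: (@cdiff_ext R _ (fun z => f (p + y *: v + z *: u))).
    by move=> z; rewrite addrAC.
  by apply: (holo_line hf); rewrite addrAC; apply: Or.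
have ly x y : cmod x <= s -> cmod y <= s ->
    cdiff (fun z => f (p + x *: u + z *: v)) y (dirD v f (p + x *: u + y *: v)).
  by move=> hx hy; apply: (holo_line hf); apply: Or.
apply: (@cdiff_diag R (fun x y => f (p + x *: u + y *: v)) s M) => //.
- by move=> x y hx hy; apply: (hr _ (inr x y hx hy)).2.
- by move=> x y hx hy; eexists; apply: lx.
- by eexists; apply: ly.
- by move=> x hx; eexists; apply: ly.
- by have := lx 0 0 ss ss; rewrite !scale0r !addr0.
- by have := ly 0 0 ss ss; rewrite !scale0r !addr0.
Qed.

Definition is_open Om := forall p, Om p ->
  exists2 r : R, 0 < r & forall q, N (q - p) < r -> Om q.

Lemma holo_cst Om a : is_open Om -> holo Om (fun=> a).
Proof.
move=> oO p hp; split; last by move=> v; apply: cdf_cst.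
by have [r r0 hr] := oO p hp; exists r, (cmod a); split=> // q /hr.
Qed.

Lemma holoD Om f g : holo Om f -> holo Om g -> holo Om (fun p => f p + g p).
Proof.
move=> hf hg p hp; have [[r [M [r0 hr]]] df] := hf p hp.
have [[r' [M' [r'0 hr']]] dg] := hg p hp.
have [t t0 [tr tr']] := pos_below r0 r'0.
split=> [|v]; last exact: (cdfD (df v) (dg v)).
exists t, (M + M'); split=> // q hq.
have [Oq h1] := hr q (lt_trans hq tr); have [_ h2] := hr' q (lt_trans hq tr').
by split=> //; apply: le_trans (cmodD _ _) _; lra.
Qed.

Lemma holoM Om f g : holo Om f -> holo Om g -> holo Om (fun p => f p * g p).
Proof.
move=> hf hg p hp; have [[r [M [r0 hr]]] df] := hf p hp.
have [[r' [M' [r'0 hr']]] dg] := hg p hp.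
have [t t0 [tr tr']] := pos_below r0 r'0.
split=> [|v]; last exact: (cdfM (df v) (dg v)).
exists t, (M * M'); split=> // q hq.
have [Oq h1] := hr q (lt_trans hq tr); have [_ h2] := hr' q (lt_trans hq tr').
by split=> //; rewrite cmodM ler_pM ?cmod_ge0.
Qed.

Lemma holo_open Om f : holo Om f -> is_open Om.
Proof.
by move=> hf p /hf[[r [M [r0 hr]]] _]; exists r => // q /hr[].
Qed.

Lemma holoZ Om f a : holo Om f -> holo Om (fun p => a * f p).
Proof. by move=> hf; apply: holoM => //; apply: holo_cst (holo_open hf). Qed.

Lemma eq_holo Om f g : (forall p, Om p -> f p = g p) -> holo Om g -> holo Om f.
Proof.
move=> fg hg p hp; have [[r [M [r0 hr]]] dg] := hg p hp; split.
  by exists r, M; split=> // q /hr[Oq]; rewrite fg.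
move=> v; have v0 := csn_ge0 N v.
apply: (@cdf_near _ _ (fun z => g (p + z *: v)) 0 (r / (N v + 1))) => //.
  by rewrite divr_gt0 //; lra.
move=> h hh; rewrite add0r; apply: fg; apply: (hr _ _).1.
rewrite addrAC subrr add0r csnZ; move: hh; rewrite ltr_pdivlMr; last by lra.
by have := cmod_ge0 h; nra.
Qed.

Lemma eq_dirD Om f g p v : is_open Om -> (forall p, Om p -> f p = g p) -> Om p ->
  dirD v f p = dirD v g p.
Proof.
move=> oO fg hp; rewrite /dirD /cderiv; congr xget; apply/seteqP.
have [r r0 hr] := oO p hp; have v0 := csn_ge0 N v.
have near h : cmod h < r / (N v + 1) -> f (p + (0 + h) *: v) = g (p + (0 + h) *: v).
  move=> hh; rewrite add0r; apply: fg; apply: hr.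
  rewrite addrAC subrr add0r csnZ; move: hh; rewrite ltr_pdivlMr; last by lra.
  by have := cmod_ge0 h; nra.
have rr : 0 < r / (N v + 1) by rewrite divr_gt0 //; lra.
by split=> d; apply: cdiff_near rr _ => h /near.
Qed.

Lemma holoN Om f : holo Om f -> holo Om (fun p => - f p).
Proof.
by move=> /(holoZ (-1)); apply: eq_holo => p _; rewrite mulN1r.
Qed.

Lemma holoB Om f g : holo Om f -> holo Om g -> holo Om (fun p => f p - g p).
Proof. by move=> hf /holoN; apply: holoD. Qed.

Lemma holo_sum (I : Type) (r : seq I) Om (F : I -> E -> C) : is_open Om ->
  (forall i, holo Om (F i)) -> holo Om (fun p => \sum_(i <- r) F i p).
Proof.
move=> oO hF; elim: r => [|i r IH].
  by apply: eq_holo (holo_cst 0 oO) => p _; rewrite big_nil.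
by apply: eq_holo (holoD (hF i) IH) => p _; rewrite big_cons.
Qed.

Lemma holoX Om f n : holo Om f -> holo Om (fun p => f p ^+ n).
Proof.
move=> hf; elim: n => [|n IH].
  by apply: eq_holo (holo_cst 1 (holo_open hf)) => p _; rewrite expr0.
by apply: eq_holo (holoM hf IH) => p _; rewrite exprS.
Qed.

Lemma holo_comp Om f (g : C -> C) : holo Om f ->
  (forall p, Om p -> cdifferentiable g (f p)) ->
  holo Om (fun p => g (f p)).
Proof.
move=> hf hg p hp; split; last first.
  move=> v; apply: (@cdf_comp _ (fun z => f (p + z *: v)) g).
    exact: (hf p hp).2.
  by rewrite scale0r addr0; apply: hg.
have [d hd] := hg p hp; have [s s0 hs] := cdiff_cont hd ltr01.
have [t t0 [ts _]] := pos_below s0 s0.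
have [r r0 hr] := holo_cont hf hp t0.
exists r, (cmod (g (f p)) + 1); split=> // q /hr[Oq fq]; split=> //.
have := hs (f q - f p) (le_lt_trans fq ts); rewrite [f p + _]addrC subrK.
by have := cmod_dist (g (f q)) (g (f p)); lra.
Qed.

Lemma holoV Om f : holo Om f -> (forall p, Om p -> f p != 0) ->
  holo Om (fun p => (f p)^-1).
Proof.
move=> hf f0; apply: (holo_comp hf) => p hp.
by eexists; apply: cdiff_inv; apply: f0.
Qed.

Lemma holo_subset Om Om' f : is_open Om' -> Om' `<=` Om -> holo Om f -> holo Om' f.
Proof.
move=> oO sub hf p hp; have [[r [M [r0 hr]]] df] := hf p (sub p hp).
have [r' r'0 hr'] := oO p hp; have [t t0 [tr tr']] := pos_below r0 r'0.
split=> //; exists t, M; split=> // q hq.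
by have [_ ?] := hr q (lt_trans hq tr); split=> //; apply: hr'; apply: lt_trans tr'.
Qed.

Lemma dirDD Om f g p v : holo Om f -> holo Om g -> Om p ->
  dirD v (fun q => f q + g q) p = dirD v f p + dirD v g p.
Proof. by move=> hf hg hp; exact: dirDE (cdiffD (dirDP v hf hp) (dirDP v hg hp)). Qed.

Lemma dirDM Om f g p v : holo Om f -> holo Om g -> Om p ->
  dirD v (fun q => f q * g q) p = dirD v f p * g p + f p * dirD v g p.
Proof.
move=> hf hg hp; apply/dirDE.
by have := cdiffM (dirDP v hf hp) (dirDP v hg hp); rewrite !scale0r !addr0.
Qed.

Lemma dirD_cst a p v : dirD v (fun=> a) p = 0.
Proof. exact/dirDE/cdiff_cst. Qed.

Lemma dirD_comp Om f (g : C -> C) p v d : holo Om f -> Om p -> cdiff g (f p) d ->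
  dirD v (fun q => g (f q)) p = d * dirD v f p.
Proof.
move=> hf hp hg; apply/dirDE.
apply: (@cdiff_comp _ (fun z => f (p + z *: v)) g); first exact: (dirDP v hf hp).
by rewrite scale0r addr0.
Qed.

Lemma dirDV Om f p v : holo Om f -> Om p -> f p != 0 ->
  dirD v (fun q => (f q)^-1) p = - (f p ^- 2) * dirD v f p.
Proof. by move=> hf hp f0; apply: (dirD_comp v hf hp (cdiff_inv f0)). Qed.

(** ** Compactness of segments and the identity theorem *)

(** Bisection of the segment: otherwise the conclusion would fail on arbitrarily
    short pieces around one of its points. *)
Lemma holo_tube Om f p v : holo Om f ->
  (forall t : R, 0 <= t <= 1 -> Om (p + t%:C *: v)) ->
  exists r M : R, [/\ 0 < r, 0 <= M & forall t q, 0 <= t <= 1 ->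
    N (q - (p + t%:C *: v)) < r -> Om q /\ cmod (f q) <= M].
Proof.
move=> hf seg.
pose good (a h : R) := exists r M : R, [/\ 0 < r, 0 <= M & forall t q, a <= t <= a + h ->
    N (q - (p + t%:C *: v)) < r -> Om q /\ cmod (f q) <= M].
suff : good 0 1 by rewrite /good add0r.
apply: contrapT => bad.
have [//||x hx] := @nested_intervals R (fun a h => ~ good a h).
  move=> a h h0; apply: contra_notP => /forallNP nb.
  have /contrapT[r [M [r0 M0 hr]]] := nb false.
  have /contrapT[r' [M' [r'0 M'0 hr']]] := nb true.
  have [s s0 [sr sr']] := pos_below r0 r'0.
  exists s, (M + M'); split=> //; first by lra.
  move=> t q ht hq; have [tm|tm] := leP t (a + h / 2).
    have [||Oq fq] := hr t q; last (by split=> //; lra).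
      by rewrite mul0r addr0; lra.
    exact: lt_trans sr.
  have [||Oq fq] := hr' t q; last (by split=> //; lra).
    by rewrite mul1r; lra.
  exact: lt_trans sr'.
have x01 : 0 <= x <= 1.
  by have [a [h [/andP[h0 _] /andP[? ?] /andP[? ?] _]]] := hx 1 ltr01; lra.
have [[r [M [r0 hr]]] _] := hf _ (seg x x01).
have v0 := csn_ge0 N v.
have d0 : 0 < r / (2 * (N v + 1)) by rewrite divr_gt0 // mulr_gt0 //; lra.
have [a [h [/andP[h0 hd] /andP[a0 ax] /andP[xa ah]]]] := hx _ d0; apply.
exists (r / 2), (Num.max M 0); split; [by lra|by rewrite le_max lexx orbT|].
move=> t q ht hq; have [|Oq fq] := hr q; last (by split=> //; rewrite le_max fq).
have -> : q - (p + x%:C *: v) = q - (p + t%:C *: v) + (t - x)%:C *: v.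
  rewrite rmorphB scalerBl /= -!addrA; congr (_ + _); rewrite !opprD -!addrA.
  by rewrite addKr.
apply: le_lt_trans (csnD N _ _) _; rewrite csnZr.
have tx : `|t - x| <= h by rewrite ler_norml; lra.
have : h * (N v + 1) < r / 2.
  rewrite -ltr_pdivlMr; last by lra.
  by apply: lt_le_trans hd _; rewrite invfM mulrA.
have := ler_wpM2r v0 tx; lra.
Qed.

(** The vanishing spreads along the segment in steps of a fixed size, provided by a
    tube on which f is bounded. *)
Lemma holo_identity Om f p v : holo Om f ->
  (forall t : R, 0 <= t <= 1 -> Om (p + t%:C *: v)) ->
  (exists2 s : R, 0 < s & forall z, cmod z < s -> f (p + z *: v) = 0) ->
  f (p + v) = 0.
Proof.
move=> hf seg; have [r [M [r0 M0 hr]]] := holo_tube hf seg => near0.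
have v0 := csn_ge0 N v.
pose d := r / (2 * (N v + 1)).
have d0 : 0 < d by rewrite divr_gt0 // mulr_gt0 //; lra.
have dv : d * (N v + 1) = r / 2 by rewrite /d; field; lra.
have inr (t : R) z : 0 <= t <= 1 -> cmod (z - t%:C) <= d ->
    Om (p + z *: v) /\ cmod (f (p + z *: v)) <= M.
  move=> ht hz; apply: (hr t) => //.
  rewrite opprD addrACA subrr add0r -scalerBl csnZ.
  have := ler_wpM2r (addr_ge0 v0 ler01) hz; have := cmod_ge0 (z - t%:C); lra.
pose F z := f (p + z *: v).
have step (t t' : R) : 0 <= t <= 1 -> `|t' - t| <= d / 4 ->
    (exists2 s : R, 0 < s & forall z, cmod (z - t%:C) < s -> F z = 0) ->
    exists2 s : R, 0 < s & forall z, cmod (z - t'%:C) < s -> F z = 0.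
  move=> ht tt' [s s0 hs]; exists (d / 4); first by lra.
  move=> z hz; apply: (@zero_disc R F t%:C d M s d0 s0) => // [y hy|y hy|].
  - by eexists; apply: (holo_line hf); apply: (inr t y ht hy).1.
  - by apply: (inr t y ht (eq_leW hy)).2.
  have := cmod_tri t'%:C z t%:C; rewrite -rmorphB /= cmod_real; lra.
have all_k k : exists2 s : R, 0 < s &
    forall z, cmod (z - (Num.min (k%:R * (d / 4)) 1)%:C) < s -> F z = 0.
  elim: k => [|k IH].
    have [s s0 hs] := near0; exists s => // z; rewrite mul0r min_l ?ler01 //.
    by rewrite subr0; apply: hs.
  have k0 : 0 <= k%:R * (d / 4) by rewrite mulr_ge0 // ?ler0n //; lra.
  apply: step IH; first by rewrite le_min k0 ler01 ge_min lexx orbT.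
  rewrite -natr1 mulrDl mul1r ler_norml.
  case: (leP (k%:R * (d / 4)) 1) => h1; case: (leP (k%:R * (d / 4) + d / 4) 1) => h2; lra.
have [s s0 hs] := all_k (truncn (4 / d)).+1.
have big : 1 <= (truncn (4 / d)).+1%:R * (d / 4).
  have e : 4 / d * (d / 4) = 1 by field; lra.
  apply: le_trans (eq_leW (esym e)) _; apply: ler_wpM2r; first by lra.
  exact: ltW (truncnS_gt _).
by have := hs 1; rewrite min_r // subrr cmod0 /F scale1r => /(_ s0).
Qed.

Lemma holo_mean_value Om f p v (k : R) : holo Om f -> 0 <= k ->
  (forall t : R, 0 <= t <= 1 -> Om (p + t%:C *: v)) ->
  (forall t : R, 0 <= t <= 1 -> cmod (dirD v f (p + t%:C *: v)) <= k) ->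
  cmod (f (p + v) - f p) <= k.
Proof.
move=> hf k0 seg hk.
have := @mean_value R (fun z => f (p + z *: v)) (fun z => dirD v f (p + z *: v)) k k0.
rewrite scale1r scale0r addr0; apply=> // t ht.
by apply: (holo_line hf); apply: seg.
Qed.

End HoloAlgebra.
(** * Holomorphy and Frechet differentiability *)

Section Frechet.
Context {R : realType}.
Notation C := R[i].

Lemma cmod_norm (z : C) : 0 <= z -> z = (cmod z)%:C.
Proof. by move=> z0; rewrite -cmodE ger0_norm. Qed.

Lemma mx_entry_le m n (A : 'M[C]_(m, n)) i j : cmod (A i j) <= cmod `|A|.
Proof.
apply/ler_addgt0Pr => e e0; rewrite -lecR -cmodE rmorphD /= -cmod_norm //.
have : ball (0 : 'M[C]_(m, n)) (`|A| + e%:C) A.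
  by rewrite -ball_normE /= sub0r normrN ltrDl ltcR.
by case=> _ /(_ i j); rewrite mxE -ball_normE /= sub0r normrN => /ltW.
Qed.

(** The two bridges between Frechet differentiability, which the definition of a
    kernel uses, and the elementary notion of holomorphy. *)
Lemma differentiable_entry m n (f : 'rV[C]_m -> 'M[C]_n) z v i j :
  differentiable f z -> cdifferentiable (fun t => f (z + t *: v) i j) 0.
Proof.
move=> /(diff_derivable (v := v)) /cvg_ex [l hl]; exists (l i j).
have := cvg_comp _ _ hl (@coord_continuous C n n i j l).
move=> /cvgrPdist_le h e e0.
have /h : 0 < e%:C :> C by rewrite ltcR.
move=> /nbhs_ballP[d /= d0 hd].
exists (cmod d); first by rewrite cmod_gt0 gt_eqF.
move=> x hx; rewrite add0r scale0r addr0.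
have [->|x0] := eqVneq x 0; first by rewrite scale0r addr0 subrr mulr0 subrr cmod0 mulr0.
have /hd /(_ x0) : ball (0 : C) d x.
  by rewrite -ball_normE /= sub0r normrN -(gtr0_norm d0) !cmodE ltcR.
rewrite /= !mxE cmodE lecR cmodBC [x *: v + z]addrC => hh.
have -> : f (z + x *: v) i j - f z i j - l i j * x =
   (x^-1 * (f (z + x *: v) i j - f z i j) - l i j) * x.
  by rewrite mulrBl mulrAC mulVf // mul1r.
by rewrite cmodM; apply: ler_wpM2r; rewrite ?cmod_ge0.
Qed.

Definition l1norm n (v : 'rV[C]_n) : R := \sum_i cmod (v 0 i).

Lemma l1normD n (u v : 'rV[C]_n) : l1norm (u + v) <= l1norm u + l1norm v.
Proof.
by rewrite -big_split /=; apply: ler_sum => i _; rewrite mxE cmodD.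
Qed.

Lemma l1normZ n a (v : 'rV[C]_n) : l1norm (a *: v) = cmod a * l1norm v.
Proof. by rewrite mulr_sumr; apply: eq_bigr => i _; rewrite mxE cmodM. Qed.

Definition l1 n : cseminorm 'rV[C]_n := CSeminorm (@l1normD n) (@l1normZ n).

Lemma l1_entry n (v : 'rV[C]_n) i : cmod (v 0 i) <= l1 n v.
Proof.
rewrite /= /l1norm (bigD1 i) //= lerDl; apply: sumr_ge0 => j _; exact: cmod_ge0.
Qed.

Lemma l1_le_norm n (v : 'rV[C]_n) : l1 n v <= n%:R * cmod `|v|.
Proof.
rewrite mulr_natl -[X in _ *+ X]card_ord -sumr_const.
by apply: ler_sum => i _; apply: mx_entry_le.
Qed.

Lemma holo_differentiable_scalar m (U : set 'rV[C]_m) (f : 'rV[C]_m -> C) z :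
  holo (l1 m) U f -> U z -> differentiable f z.
Proof.
move=> hf Uz; pose d v : C := dirD v f z.
have dlin : linear d.
  by move=> a u v; rewrite /d (dirD_add _ _ hf Uz) (dirDZ _ _ hf Uz).
pose dl : {linear 'rV[C]_m -> C} := HB.pack d (GRing.isLinear.Build _ _ _ _ _ dlin).
have [r [M [r0 M0 /(_ z)]]] := holo_est hf Uz; rewrite subrr csn0 => /(_ r0)[_ _ hd].
pose k : R := m%:R + 1; have k0 : 0 < k by rewrite /k ltr_wpDl // ler0n.
have l1k (v : 'rV[C]_m) t : cmod `|v| <= t -> 0 < t -> l1 m v <= k * t.
  move=> vt t0; apply: le_trans (l1_le_norm v) _.
  by apply: ler_pM => //; [exact: cmod_ge0|rewrite /k; lra].
have nE (v : 'rV[C]_m) : `|v| = (cmod `|v|)%:C by apply: cmod_norm.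
have dc : continuous dl.
  move=> x; apply/(@cvgrPdist_le _ _ _ (nbhs (x : 'rV[C]_m))) => e e0; apply/nbhs_ballP.
  have ce : 0 < cmod e by rewrite cmod_gt0 gt_eqF.
  have Mk : 0 < M * k + 1 by apply: ltr_wpDl => //; rewrite mulr_ge0 // ltW.
  exists (cmod e / (M * k + 1))%:C => /=; first by rewrite ltcR divr_gt0.
  move=> y; rewrite -ball_normE /= -normrN opprB nE ltcR => hy.
  have -> : d x - d y = - dl (y - x) by rewrite linearB opprB.
  rewrite normrN cmodE (cmod_norm (ltW e0)) lecR.
  set t := cmod e / (M * k + 1) in hy; have t0 : 0 < t by rewrite divr_gt0.
  have [i _] := hd (y - x) (k * t) (l1k _ _ (ltW hy) t0) (mulr_gt0 k0 t0).
  apply: le_trans i _.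
  have : t * (M * k + 1) = cmod e by rewrite /t mulfVK // gt_eqF.
  lra.
pose V : normedModType C := 'rV[C]_m; pose W : normedModType C := C.
have fE : (f : V -> W) \o shift (z : V) = cst (f z : W) + (dl : V -> W) +o_ (0 : V) id.
  apply/eqaddoP => e e0; apply/nbhs_ballP.
  have ce : 0 < cmod e by rewrite cmod_gt0 gt_eqF.
  have Mk : 0 < M * k ^+ 2 + 1 by apply: ltr_wpDl => //; rewrite mulr_ge0 ?exprn_ge0 // ltW.
  have [s s0 [sr se]] := pos_below (divr_gt0 r0 k0) (divr_gt0 ce Mk).
  exists s%:C => /=; first by rewrite ltcR.
  move=> y; rewrite -ball_normE /= sub0r normrN nE ltcR => hy.
  rewrite (nE y) (cmod_norm (ltW e0)) cmodE -rmorphM /= lecR.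
  set t := cmod `|y| in hy *.
  have -> : (f \o shift z - (cst (f z) + dl)) y = f (z + y) - f z - dl y.
    by rewrite /= fctE /= [y + z]addrC opprD addrA.
  have [y0|y0] := eqVneq y 0.
    by rewrite y0 addr0 subrr linear0 subr0 cmod0 mulr_ge0 // ?cmod_ge0 // ltW.
  have t0 : 0 < t by rewrite /t cmod_gt0 normr_eq0.
  have [_] := hd y (k * t) (l1k _ _ (lexx _) t0) (mulr_gt0 k0 t0).
  have -> : k * t <= r.
    by rewrite mulrC -ler_pdivlMr // ltW // (lt_trans hy).
  move=> /(_ isT) i; apply: le_trans i _.
  have : t * (M * k ^+ 2 + 1) < cmod e by rewrite -ltr_pdivlMr // (lt_trans hy).
  rewrite cmod_real gtr0_norm // => i.
  have -> : M * (k * t) ^+ 2 = t * (M * k ^+ 2) * t by ring.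
  by rewrite ler_pM2r //; lra.
have dE : 'd (f : V -> W) (z : V) = dl :> (V -> W) := diff_unique dc fE.
by apply/diff_locallyP; rewrite dE; split.
Qed.

Lemma holo_differentiable m n (U : set 'rV[C]_m) (f : 'rV[C]_m -> 'M[C]_n) z :
  (forall i j, holo (l1 m) U (fun w => f w i j)) -> U z -> differentiable f z.
Proof.
move=> hf Uz.
have -> : f = \sum_(i < n) \sum_(j < n) (fun w => f w i j *: delta_mx i j).
  apply/funext => w; rewrite {1}(matrix_sum_delta (f w)) fct_sumE.
  by apply: eq_bigr => i _; rewrite fct_sumE.
apply: differentiable_sum => i; apply: differentiable_sum => j.
by apply: differentiableZl; apply: holo_differentiable_scalar (hf i j) Uz.
Qed.

End Frechet.
(** * Kernels on the ball as holomorphic functions *)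

Section PairHolo.
Context {R : realType}.
Notation C := R[i].

Section Affine.
Context {E E' : lmodType C} (N : cseminorm E) (N' : cseminorm E').

Lemma holo_affine (A T : E -> E') (k : R) (Om : set E') (f : E' -> C) :
  0 <= k -> (forall p (z : C) v, A (p + z *: v) = A p + z *: T v) ->
  (forall v, N' (T v) <= k * N v) -> holo N' Om f ->
  holo N (A @^-1` Om) (fun p => f (A p)).
Proof.
move=> k0 AT Tk hf p Op; have [[r [M [r0 hr]]] df] := hf _ Op; split; last first.
  move=> v; have [d hd] := df (T v); exists d.
  by apply: cdiff_ext hd => z; rewrite AT.
have k1 : 0 < k + 1 by lra.
exists (r / (k + 1)), M; split; first by rewrite divr_gt0.
move=> q hq; apply: hr.
have -> : A q - A p = T (q - p).
  by rewrite -[q in LHS](subrK p) [_ + p]addrC -[q - p in LHS]scale1r AT scale1r addrC addKr.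
apply: le_lt_trans (Tk _) _; move: hq; rewrite ltr_pdivlMr // => hq.
by have := csn_ge0 N (q - p); nra.
Qed.

Definition pair_norm (p : E * E') : R := N p.1 + N' p.2.

Lemma pair_normD p q : pair_norm (p + q) <= pair_norm p + pair_norm q.
Proof.
by have := csnD N p.1 q.1; have := csnD N' p.2 q.2; rewrite /pair_norm /=; lra.
Qed.

Lemma pair_normZ a p : pair_norm (a *: p) = cmod a * pair_norm p.
Proof. by rewrite /pair_norm /= !csnZ mulrDr. Qed.

Definition pairn : cseminorm (E * E')%type := CSeminorm pair_normD pair_normZ.

(** Osgood's lemma: on the line through p in direction (a, b) the function is the
    restriction to the diagonal of a separately differentiable function of two
    complex variables. *)
Lemma osgood (Om : set (E * E')) (f : E * E' -> C) :
  (forall p, Om p -> exists r M : R, 0 < r /\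
     forall q, pairn (q - p) < r -> Om q /\ cmod (f q) <= M) ->
  (forall p, Om p -> (forall a, cdifferentiable (fun z => f (p + z *: (a, 0))) 0) /\
     (forall b, cdifferentiable (fun z => f (p + z *: (0, b))) 0)) ->
  holo pairn Om f.
Proof.
move=> bd sep p hp; split; first exact: bd.
case=> a b; have [r [M [r0 hr]]] := bd p hp.
have a0 := csn_ge0 N a; have b0 := csn_ge0 N' b.
pose s := r / (2 * (N a + N' b + 1)).
have s0 : 0 < s by rewrite divr_gt0 // mulr_gt0 //; lra.
pose q x y := p + x *: (a, 0) + y *: (0, b).
have inr x y : cmod x <= s -> cmod y <= s -> pairn (q x y - p) < r.
  move=> hx hy; rewrite /q -(addrA p) [p + _]addrC addrK.
  rewrite /= /pair_norm /= !scaler0 addr0 add0r !csnZ.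
  have : s * (N a + N' b + 1) = r / 2 by rewrite /s; field; lra.
  have := ler_wpM2r a0 hx; have := ler_wpM2r b0 hy; lra.
have Oq x y hx hy := (hr _ (inr x y hx hy)).1.
have ss : cmod (0 : C) <= s by rewrite cmod0 ltW.
have lx x y : cmod x <= s -> cmod y <= s -> cdifferentiable (fun z => f (q z y)) x.
  move=> hx hy; have [/(_ a)[d hd] _] := sep _ (Oq x y hx hy); exists d.
  rewrite -[x]addr0; apply/cdiff_shift; apply: cdiff_ext hd => z.
  by rewrite /q scalerDl !addrA (addrAC _ (y *: _)).
have ly x y : cmod x <= s -> cmod y <= s -> cdifferentiable (fun z => f (q x z)) y.
  move=> hx hy; have [_ /(_ b)[d hd]] := sep _ (Oq x y hx hy); exists d.
  rewrite -[y]addr0; apply/cdiff_shift; apply: cdiff_ext hd => z.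
  by rewrite /q scalerDl !addrA.
have [d1 hd1] := lx 0 0 ss ss; have [d2 hd2] := ly 0 0 ss ss.
exists (d1 + d2).
apply: (@cdiff_ext R _ (fun z => f (q z z))).
  move=> z; rewrite /q -addrA; congr (f (_ + _)).
  by apply/pair_equal_spec; rewrite /= !scaler0 addr0 add0r.
apply: (@cdiff_diag R (fun x y => f (q x y)) s M) => //.
- by move=> x y hx hy; apply: (hr _ (inr x y hx hy)).2.
- exact: ly.
- by move=> x hx; apply: ly.
Qed.

End Affine.

(** ** Conjugation *)

Lemma cdiff_conj (f : C -> C) p d : cdiff f p d ->
  cdiff (fun z => conjC (f (conjC z))) (conjC p) (conjC d).
Proof.
move=> h e /h[r r0 hr]; exists r => // k hk.
have := hr (conjC k); rewrite cmodJ => /(_ hk).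
have -> : conjC (conjC p + k) = p + conjC k by rewrite rmorphD /= conjCK.
rewrite conjCK -cmodJ -[(_ - _ - _)^*%C]/(conjC _).
by rewrite rmorphB rmorphB rmorphM /= conjCK.
Qed.

Definition conjv n (v : 'rV[C]_n) : 'rV[C]_n := map_mx conjC v.

Lemma conjvK n : involutive (@conjv n).
Proof. by move=> v; apply/rowP => i; rewrite !mxE conjCK. Qed.

Lemma conjvD n (u v : 'rV[C]_n) : conjv (u + v) = conjv u + conjv v.
Proof. by apply/rowP => i; rewrite !mxE rmorphD. Qed.

Lemma conjvB n (u v : 'rV[C]_n) : conjv (u - v) = conjv u - conjv v.
Proof. by apply/rowP => i; rewrite !mxE rmorphB. Qed.

Lemma conjvZ n a (v : 'rV[C]_n) : conjv (a *: v) = conjC a *: conjv v.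
Proof. by apply/rowP => i; rewrite !mxE rmorphM. Qed.

Lemma l1_conjv n (v : 'rV[C]_n) : l1 n (conjv v) = l1 n v.
Proof. by apply: eq_bigr => i _; rewrite mxE cmodJ. Qed.

Lemma holo_conj n (U : set 'rV[C]_n) (f : 'rV[C]_n -> C) : holo (l1 n) U f ->
  holo (l1 n) (@conjv n @^-1` U) (fun w => conjC (f (conjv w))).
Proof.
move=> hf w Uw; have [[r [M [r0 hr]]] df] := hf _ Uw; split.
  exists r, M; split=> // q hq; rewrite cmodJ; apply: hr.
  by rewrite -conjvB l1_conjv.
move=> v; have [d hd] := df (conjv v); exists (conjC d).
have := cdiff_conj hd; rewrite rmorph0; apply: cdiff_ext => z.
by rewrite conjvD conjvZ.
Qed.

(** ** The unit ball *)

Context {m : nat}.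
Notation V := 'rV[C]_m.
Notation B := (@unit_ball R m).

Definition sqn (v : V) : R := \sum_i cmod (v 0 i) ^+ 2.

Lemma vdotE (v : V) : vdot v v = (sqn v)%:C.
Proof.
rewrite /vdot /sqn rmorph_sum; apply: eq_bigr => i _.
by rewrite -normCK cmodE rmorphXn.
Qed.

Lemma unit_ballE v : B v <-> sqn v < 1.
Proof. by rewrite /unit_ball /= vdotE ltcR. Qed.

Lemma sqn_conjv v : sqn (conjv v) = sqn v.
Proof. by apply: eq_bigr => i _; rewrite mxE cmodJ. Qed.

Lemma unit_ball_conjv v : B (conjv v) <-> B v.
Proof. by rewrite !unit_ballE sqn_conjv. Qed.

Lemma unit_ball_conjv_preim : @conjv m @^-1` B = B.
Proof. by apply/seteqP; split=> v /= /unit_ball_conjv. Qed.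

Lemma unit_ball0 : B 0.
Proof.
apply/unit_ballE; rewrite /sqn big1 ?ltr01 // => i _.
by rewrite mxE cmod0 expr0n.
Qed.

Lemma unit_ball_convex v w (t : R) : B v -> B w -> 0 <= t <= 1 ->
  B (v + t%:C *: (w - v)).
Proof.
rewrite !unit_ballE => hv hw /andP[t0 t1].
suff : sqn (v + t%:C *: (w - v)) <= (1 - t) * sqn v + t * sqn w.
  move=> h; apply: le_lt_trans h _.
  have i1 : 0 <= t * (1 - sqn w) by rewrite mulr_ge0 //; lra.
  have [tlt1|t1'] := ltP t 1; last by (have -> : t = 1 by lra); lra.
  have : 0 < (1 - t) * (1 - sqn v) by rewrite mulr_gt0 //; lra.
  lra.
rewrite /sqn !mulr_sumr -big_split /=; apply: ler_sum => i _.
rewrite !mxE; set a := v 0 i; set b := w 0 i.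
have -> : a + t%:C * (b - a) = (1 - t)%:C * a + t%:C * b.
  by rewrite rmorphB rmorph1; ring.
have h : cmod ((1 - t)%:C * a + t%:C * b) <= (1 - t) * cmod a + t * cmod b.
  apply: le_trans (cmodD _ _) _; rewrite !cmodM !cmod_real !ger0_norm //; lra.
apply: (@le_trans _ _ (((1 - t) * cmod a + t * cmod b) ^+ 2)).
  by rewrite ler_sqr ?nnegrE ?cmod_ge0 // addr_ge0 ?mulr_ge0 ?cmod_ge0 //; lra.
have : 0 <= t * (1 - t) * (cmod a - cmod b) ^+ 2.
  by rewrite mulr_ge0 ?sqr_ge0 // mulr_ge0 //; lra.
lra.
Qed.

Lemma unit_ballZ v (t : R) : B v -> 0 <= t <= 1 -> B (t%:C *: v).
Proof. by move=> hv ht; have := unit_ball_convex unit_ball0 hv ht; rewrite add0r subr0. Qed.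

Lemma unit_ball_open : is_open (l1 m) B.
Proof.
move=> v /unit_ballE hv.
have g0 : 0 < (1 - sqn v) / 3 by lra.
have [r r0 [r1 rg]] := pos_below ltr01 g0; exists r => // q hq.
apply/unit_ballE; pose u := q - v.
have -> : q = v + u by rewrite /u addrC subrK.
have vi i : cmod (v 0 i) <= 1.
  have : cmod (v 0 i) ^+ 2 < 1.
    apply: le_lt_trans hv; rewrite /sqn (bigD1 i) //= lerDl.
    by apply: sumr_ge0 => j _; rewrite exprn_ge0 ?cmod_ge0.
  by rewrite expr_lt1 ?cmod_ge0 // => /ltW.
have : sqn (v + u) <= sqn v + 3 * l1 m u.
  rewrite /sqn /= /l1norm mulr_sumr -big_split /=; apply: ler_sum => i _.
  rewrite mxE; have ui : cmod (u 0 i) <= 1.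
    by apply: le_trans (l1_entry u i) _; apply: ltW; apply: lt_trans r1.
  have := vi i; have := cmod_ge0 (v 0 i); have := cmod_ge0 (u 0 i).
  have := cmodD (v 0 i) (u 0 i); have := cmod_ge0 (v 0 i + u 0 i).
  by nra.
by move: hq; rewrite -/u; lra.
Qed.

Lemma vdot_lt1 v w : B v -> B w -> cmod (vdot v w) < 1.
Proof.
rewrite !unit_ballE => hv hw; apply: le_lt_trans (cmod_sum _ _ _) _.
apply: (@le_lt_trans _ _ ((sqn v + sqn w) / 2)); last by lra.
rewrite /sqn -big_split /= mulr_suml; apply: ler_sum => i _.
rewrite cmodM cmodJ; have := sqr_ge0 (cmod (v 0 i) - cmod (w 0 i)); lra.
Qed.

Definition BB : set (V * V) := [set p | B p.1 /\ B p.2].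

Definition nVV : cseminorm (V * V)%type := pairn (l1 m) (l1 m).

Lemma nVVE a b : nVV (a, b) = l1 m a + l1 m b.
Proof. by []. Qed.

(** Conjugating the second argument turns a kernel, holomorphic in the first and
    anti-holomorphic in the second variable, into a holomorphic function on B x B;
    the diagonal becomes the set of the points (w, conj w). *)
Definition sharp (L : V -> V -> C) (p : V * V) : C := L p.1 (conjv p.2).

Lemma BB_open : is_open nVV BB.
Proof.
move=> [z w] [/unit_ball_open[r r0 hr] /unit_ball_open[s s0 hs]].
have [t t0 [tr ts]] := pos_below r0 s0; exists t => // -[a b].
rewrite /= /pair_norm /= => h.
have := csn_ge0 (l1 m) (a - z); have := csn_ge0 (l1 m) (b - w) => h1 h2.
by split; [apply: hr|apply: hs] => /=; move: h h1 h2 => /=; lra.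
Qed.

Lemma BB_convex p q (t : R) : BB p -> BB q -> 0 <= t <= 1 -> BB (p + t%:C *: (q - p)).
Proof. by move=> [p1 p2] [q1 q2] ht; split; apply: unit_ball_convex. Qed.

Lemma BB_diag w : BB (w, conjv w) <-> B w.
Proof. by split=> [[]|hw] //; split=> //; apply/unit_ball_conjv. Qed.

Lemma sharp_diag L w : sharp L (w, conjv w) = L w w.
Proof. by rewrite /sharp /= conjvK. Qed.

Lemma sesqui_holo n (L : V -> V -> 'M[C]_n) i j : sesquiholomorphic B L ->
  (forall p, BB p -> exists r M : R, 0 < r /\
     forall q, nVV (q - p) < r -> cmod (sharp (fun z w => L z w i j) q) <= M) ->
  holo nVV BB (sharp (fun z w => L z w i j)).
Proof.
move=> [h1 h2] bd; apply: osgood.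
  move=> p hp; have [r [M [r0 hr]]] := bd p hp; have [s s0 hs] := BB_open hp.
  have [t t0 [tr ts]] := pos_below r0 s0; exists t, M; split=> // q hq.
  by split; [apply: hs; apply: lt_trans ts|apply: hr; apply: lt_trans tr].
move=> [z w] [/= Bz /unit_ball_conjv Bw]; split=> [a|b].
  have [d hd] := differentiable_entry a i j (h1 _ Bw _ Bz); exists d.
  by apply: cdiff_ext hd => t; rewrite /sharp /= scaler0 addr0.
have [d hd] := differentiable_entry (conjv b) i j (h2 _ Bz _ Bw).
exists (conjC d); have := cdiff_conj hd; rewrite rmorph0; apply: cdiff_ext => t.
by rewrite mxE conjCK /sharp /= scaler0 addr0 conjvD conjvZ.
Qed.

Lemma holo_sesqui n (L : V -> V -> 'M[C]_n) :
  (forall i j, holo nVV BB (sharp (fun z w => L z w i j))) -> sesquiholomorphic B L.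
Proof.
move=> hL.
have pre (A : V -> V * V) (T : V -> V * V) f :
    (forall p (z : C) v, A (p + z *: v) = A p + z *: T v) ->
    (forall v, nVV (T v) <= 1 * l1 m v) -> holo nVV BB f ->
    holo (l1 m) (A @^-1` BB) (fun p => f (A p)).
  by move=> AT Tk hf; apply: (holo_affine ler01 AT Tk hf).
split=> [w Bw|z Bz].
  move=> z Bz; apply: (@holo_differentiable R m n ((fun z => (z, conjv w)) @^-1` BB)).
    move=> i j; have := pre (fun z => (z, conjv w)) (fun v => (v, 0)) _ _ _ (hL i j).
    rewrite /sharp /= conjvK; apply=> [p t v|v].
      by apply/pair_equal_spec; rewrite /= scaler0 addr0.
    by rewrite /pair_norm csn0 addr0 mul1r.
  by split=> //; apply/unit_ball_conjv.
move=> w Bw; apply: (@holo_differentiable R m n (@conjv m @^-1` ((fun w => (z, w)) @^-1` BB))).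
  move=> i j; have := pre (fun w => (z, w)) (fun v => (0, v)) _ _ _ (hL i j).
  move=> /(_ _ _)/holo_conj h; apply: eq_holo (h _ _) => [q _|q t v|v].
  - by rewrite mxE /sharp /= conjvK.
  - by apply/pair_equal_spec; rewrite /= scaler0 addr0.
  - by rewrite nVVE csn0 add0r mul1r.
by split=> //; apply/unit_ball_conjv.
Qed.

Lemma holo_fst (f : V -> C) : holo (l1 m) B f -> holo nVV BB (fun p => f p.1).
Proof.
move=> hf; apply: (@holo_subset _ _ _ (fst @^-1` B)); [exact: BB_open|by move=> p []|].
apply: (@holo_affine _ _ nVV (l1 m) fst fst 1 B f) => // v.
by rewrite mul1r -[nVV v]/(l1 m v.1 + l1 m v.2) lerDl csn_ge0.
Qed.

Lemma holo_snd (f : V -> C) : holo (l1 m) B f -> holo nVV BB (fun p => f p.2).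
Proof.
move=> hf; apply: (@holo_subset _ _ _ (snd @^-1` B)); [exact: BB_open|by move=> p []|].
apply: (@holo_affine _ _ nVV (l1 m) snd snd 1 B f) => // v.
by rewrite mul1r -[nVV v]/(l1 m v.1 + l1 m v.2) lerDr csn_ge0.
Qed.

End PairHolo.
(** * Complex exponential and logarithm *)

Section ExpLog.
Context {R : realType}.
Notation C := R[i].

Lemma is_derive_small (f : R -> R) (x d : R) : is_derive x (1 : R) f d ->
  forall e : R, 0 < e -> exists2 r : R, 0 < r &
    forall t, `|t| < r -> `|f (x + t) - f x - d * t| <= e * `|t|.
Proof.
move=> [df dv] e e0; move: df; rewrite /derivable => /cvg_ex[l hl].
have ld : l = d by rewrite -dv; apply/esym/cvg_lim.
move: hl; rewrite ld => /cvgrPdist_le /(_ e e0) /nbhs_ballP[r /= r0 hr].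
exists r => // t tr; have [->|t0] := eqVneq t 0.
  by rewrite addr0 subrr mulr0 subrr normr0 mulr0.
have /hr /(_ t0) : ball (0 : R) r t by rewrite -ball_normE /= sub0r normrN.
rewrite /= -[t *: 1]/(t * 1) mulr1 [t + x]addrC distrC => h.
have -> : f (x + t) - f x - d * t = (t^-1 * (f (x + t) - f x) - d) * t.
  by rewrite mulrBl mulrAC mulVf // mul1r.
by rewrite normrM; apply: ler_wpM2r.
Qed.

Definition cexp (z : C) : C :=
  (expR (complex.Re z))%:C * (cos (complex.Im z) +i* sin (complex.Im z)).

Lemma cexpD z w : cexp (z + w) = cexp z * cexp w.
Proof.
rewrite /cexp !raddfD /= expRD cosD sinD; apply/eqP; rewrite eq_complex /=.
by apply/andP; split; apply/eqP; ring.
Qed.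

Lemma cexp_real (x : R) : cexp x%:C = (expR x)%:C.
Proof. by rewrite /cexp /= cos0 sin0 -[1 +i* 0]/(1 : C) mulr1. Qed.

Lemma cexp0 : cexp 0 = 1.
Proof. by have := cexp_real 0; rewrite expR0. Qed.

Lemma cexp_nat n z : cexp (n%:R * z) = cexp z ^+ n.
Proof.
elim: n => [|n IH]; first by rewrite mul0r cexp0.
by rewrite -natr1 mulrDl mul1r cexpD IH exprSr.
Qed.

Lemma cmod_cexp z : cmod (cexp z) = expR (complex.Re z).
Proof.
rewrite cmodM cmod_real ger0_norm ?expR_ge0 // cmod_sqrt /=.
by rewrite cos2Dsin2 sqrtr1 mulr1.
Qed.

Lemma cexpJ z : cexp (conjC z) = conjC (cexp z).
Proof.
case: z => x y; rewrite /cexp /= cosN sinN; apply/eqP; rewrite eq_complex /=.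
by apply/andP; split; apply/eqP; ring.
Qed.

(** From the real derivatives of expR, cos and sin at 0; elsewhere cexpD takes
    over. *)
Lemma cdiff_cexp0 : cdiff cexp 0 1.
Proof.
move=> e e0; pose k := Num.min (e / 20) (1 / 10).
have k0 : 0 < k by rewrite lt_min divr_gt0 //=; lra.
have ke : k <= e / 20 by rewrite ge_min lexx.
have k1 : k <= 1 / 10 by rewrite ge_min lexx orbT.
have [r1 r10 h1] := is_derive_small (is_derive_expR 0) k0.
have [r2 r20 h2] := is_derive_small (is_derive_cos 0) k0.
have [r3 r30 h3] := is_derive_small (is_derive_sin 0) k0.
have [r4 r40 [r41 r42]] := pos_below r10 r20.
have [r5 r50 [r53 r5k]] := pos_below r30 k0.
have [r r0 [r4_ r5_]] := pos_below r40 r50.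
exists r => // -[x y] hr; have hx : `|x| < r by apply: le_lt_trans (cmod_Re _) hr.
have hy : `|y| < r by apply: le_lt_trans (cmod_Im _) hr.
have := h1 x (lt_trans hx (lt_trans r4_ r41)).
have := h2 y (lt_trans hy (lt_trans r4_ r42)).
have := h3 y (lt_trans hy (lt_trans r5_ r53)).
rewrite !add0r sin0 cos0 expR0 !mul1r oppr0 mul0r !subr0 !addr0 => i3 i2 i1.
rewrite cexp0; apply: le_trans (cmod_le_ReIm _) _.
set h := x +i* y in hr *.
have xh : `|x| <= cmod h := cmod_Re h; have yh : `|y| <= cmod h := cmod_Im h.
rewrite !raddfB /= subr0 !mul0r !(subr0, addr0).
move: i1 i2 i3; set A := expR x - 1 - x; set Bc := cos y - 1; set S := sin y - y.
move=> i1 i2 i3.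
have xk : `|x| <= k by apply: ltW; apply: lt_trans hx (lt_trans r5_ r5k).
have yk : `|y| <= k by apply: ltW; apply: lt_trans hy (lt_trans r5_ r5k).
have -> : expR x * cos y - 1 - x = A + Bc * (1 + x + A) by rewrite /A /Bc; ring.
have -> : expR x * sin y - y = S + (x + A) * (y + S) by rewrite /A /S; ring.
have c0 := cmod_ge0 h; have a0 := normr_ge0 x; have b0 := normr_ge0 y.
have kA : `|A| <= k * cmod h by apply: le_trans i1 _; rewrite ler_pM2l.
have kB : `|Bc| <= k * cmod h by apply: le_trans i2 _; rewrite ler_pM2l.
have kS : `|S| <= k * cmod h by apply: le_trans i3 _; rewrite ler_pM2l.
have A1 : `|A| <= k by apply: le_trans i1 _; nra.
have S1 : `|S| <= `|y| by apply: le_trans i3 _; nra.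
have j1 : `|A + Bc * (1 + x + A)| <= 3 * k * cmod h.
  apply: le_trans (ler_normD _ _) _; rewrite normrM.
  have : `|1 + x + A| <= 2.
    apply: le_trans (ler_normD _ _) _; have := ler_normD 1 x; rewrite normr1; lra.
  by have := normr_ge0 Bc; have := normr_ge0 (1 + x + A); nra.
have j2 : `|S + (x + A) * (y + S)| <= 5 * k * cmod h.
  apply: le_trans (ler_normD _ _) _; rewrite normrM.
  have : `|x + A| <= 2 * k by have := ler_normD x A; lra.
  have : `|y + S| <= 2 * cmod h by have := ler_normD y S; lra.
  by have := normr_ge0 (x + A); have := normr_ge0 (y + S); nra.
nra.
Qed.

Lemma cdiff_cexp z : cdiff cexp z (cexp z).
Proof.
rewrite -{1}[z]addr0; apply/cdiff_shift.
have := cdiffZ (cexp z) cdiff_cexp0; rewrite mulr1; apply: cdiff_ext => w.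
by rewrite cexpD.
Qed.

Lemma cdiff_inverse (f g : C -> C) (z d : C) : d != 0 -> cdiff f (g z) d ->
  (forall e : R, 0 < e -> exists2 r : R, 0 < r &
     forall h, cmod h < r -> cmod (g (z + h) - g z) <= e) ->
  (exists2 r : R, 0 < r & forall h, cmod h < r -> f (g (z + h)) = z + h) ->
  cdiff g z d^-1.
Proof.
move=> d0 hf cg [r1 r10 fg] e e0.
have D0 : 0 < cmod d by rewrite cmod_gt0.
pose k := Num.min (cmod d / 2) (e * cmod d ^+ 2 / 2).
have k0 : 0 < k by rewrite lt_min !divr_gt0 ?mulr_gt0 ?exprn_gt0.
have [s s0 hs] := hf _ k0.
have [s' s'0 [s's _]] := pos_below s0 s0.
have [r2 r20 hg] := cg _ s'0.
have [r r0 [rr1 rr2]] := pos_below r10 r20.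
exists r => // h hr.
have hk := hg h (lt_trans hr rr2); set u := g (z + h) - g z in hk *.
have := hs u (le_lt_trans hk s's).
have -> : g z + u = g (z + h) by rewrite /u addrC subrK.
have := fg 0; rewrite cmod0 !addr0 => ->//; rewrite fg ?(lt_trans hr) //.
rewrite [z + h]addrC addrK => i.
have kd : k <= cmod d / 2 by rewrite ge_min lexx.
have ke : k <= e * cmod d ^+ 2 / 2 by rewrite ge_min lexx orbT.
have ub : cmod u <= 2 * cmod h / cmod d.
  rewrite ler_pdivlMr //; have := cmod_dist (d * u) h; rewrite [cmod (_ - h)]cmodBC cmodM.
  have := ler_wpM2r (cmod_ge0 u) kd; lra.
have -> : u - d^-1 * h = - (d^-1 * (h - d * u)) by field.
rewrite cmodN cmodM cmodV ler_pdivrMl //.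
apply: le_trans i _; apply: le_trans (ler_wpM2r (cmod_ge0 _) ke) _.
apply: (@le_trans _ _ (e * cmod d ^+ 2 / 2 * (2 * cmod h / cmod d))).
  by apply: ler_wpM2l => //; rewrite divr_ge0 // mulr_ge0 ?exprn_ge0 // ltW.
by apply: eq_leW; field; rewrite gt_eqF.
Qed.

(** The principal branch, meaningful for numbers of positive real part, where the
    argument is the arc tangent of the slope. *)
Definition clog (z : C) : C :=
  ln (cmod z) +i* atan (complex.Im z / complex.Re z).

Lemma clog_real (x : R) : 0 < x -> clog x%:C = (ln x)%:C.
Proof. by move=> x0; rewrite /clog cmod_real gtr0_norm //= mul0r atan0. Qed.

Lemma clogK z : 0 < complex.Re z -> cexp (clog z) = z.
Proof.
move=> x0; have z0 : 0 < cmod z by rewrite cmod_gt0; apply: contraTneq x0 => ->; rewrite /= ltxx.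
have sin_atan (t : R) : sin (atan t) = t * (Num.sqrt (1 + t ^+ 2))^-1.
  have ct : cos (atan t) != 0.
    by rewrite cos_atan invr_neq0 // sqrtr_eq0 -ltNge ltr_wpDr // sqr_ge0.
  by rewrite -cos_atan -{2}[t]atanK /tan mulfVK.
rewrite /cexp /clog /= lnK ?posrE // cos_atan sin_atan.
have -> : Num.sqrt (1 + (complex.Im z / complex.Re z) ^+ 2) = cmod z / complex.Re z.
  rewrite cmod_sqrt; set a := complex.Re z in x0 *; set b := complex.Im z.
  have -> : 1 + (b / a) ^+ 2 = (a ^+ 2 + b ^+ 2) / a ^+ 2 by field; rewrite gt_eqF.
  by rewrite sqrtrM ?addr_ge0 ?sqr_ge0 // sqrtrV ?sqr_ge0 // sqrtr_sqr gtr0_norm.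
move: z0 x0; case: (z) => a b /=; set c := cmod _ => c0 a0.
by apply/eqP; rewrite eq_complex /=; apply/andP; split; apply/eqP; field; rewrite !gt_eqF.
Qed.

Lemma continuous_small (f : R -> R) x (e : R) : {for x, continuous f} -> 0 < e ->
  exists2 r : R, 0 < r & forall y, `|y - x| < r -> `|f y - f x| <= e.
Proof.
move=> cf e0; have /cvgrPdist_le /(_ e e0) /nbhs_ballP[r /= r0 hr] := cf.
exists r => // y yr; rewrite distrC; apply: hr.
by rewrite -ball_normE /= distrC.
Qed.

Lemma cdiff_clog z : 0 < complex.Re z -> cdiff clog z z^-1.
Proof.
move=> x0; have z0 : z != 0 by apply: contraTneq x0 => ->; rewrite /= ltxx.
have c0 : 0 < cmod z by rewrite cmod_gt0.
apply: (@cdiff_inverse cexp) => //.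
- by rewrite -{2}(clogK x0); apply: cdiff_cexp.
- move=> e e0; have e2 : 0 < e / 2 by lra.
  have [r1 r10 h1] := continuous_small (continuous_ln c0) e2.
  have [r2 r20 h2] := continuous_small (@continuous_atan R (complex.Im z / complex.Re z)) e2.
  set x := complex.Re z in x0 h2 *; set y := complex.Im z in h2 *.
  have q0 : 0 < r2 * x ^+ 2 / (2 * (x + `|y|)).
    by rewrite divr_gt0 ?mulr_gt0 ?exprn_gt0 // ltr_wpDr.
  have x20 : 0 < x / 2 by lra.
  have [r3 r30 [r31 r32]] := pos_below r10 q0.
  have [r r0 [rr rx]] := pos_below r30 x20.
  exists r => // h hr; apply: le_trans (cmod_le_ReIm _) _.
  rewrite /clog !raddfB /= !raddfD /= -/x -/y.
  have i1 : `|ln (cmod (z + h)) - ln (cmod z)| <= e / 2.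
    apply: h1; apply: le_lt_trans (lt_trans hr (lt_trans rr r31)).
    rewrite ler_norml; have := cmodD z h; have := cmod_dist z (- h).
    by rewrite cmodN opprK; lra.
  have i2 : `|atan ((y + complex.Im h) / (x + complex.Re h)) - atan (y / x)| <= e / 2.
    apply: h2; have := cmod_Re h; have := cmod_Im h.
    set a := complex.Re h; set b := complex.Im h => hb ha.
    have xa : x / 2 < x + a by move: ha; rewrite ler_norml; lra.
    have -> : (y + b) / (x + a) - y / x = (b * x - y * a) / (x * (x + a)).
      by field; rewrite !gt_eqF //; lra.
    rewrite normrM normfV [`|x * _|]gtr0_norm; last by rewrite mulr_gt0 //; lra.
    rewrite ltr_pdivrMr; last by rewrite mulr_gt0 //; lra.
    have : `|b * x - y * a| <= cmod h * (x + `|y|).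
      apply: le_trans (ler_normB _ _) _; rewrite !normrM (gtr0_norm x0).
      by have := normr_ge0 y; nra.
    have : cmod h < r2 * x ^+ 2 / (2 * (x + `|y|)) by apply: lt_trans (lt_trans rr r32).
    rewrite ltr_pdivlMr; last by rewrite mulr_gt0 // ltr_wpDr.
    move=> j1 j2.
    have : r2 * (x * (x / 2)) <= r2 * (x * (x + a)).
      by rewrite ler_pM2l // ler_pM2l // ltW.
    lra.
  lra.
exists (complex.Re z) => // h hr; apply: clogK; rewrite raddfD /=.
by have := cmod_Re h; rewrite ler_norml; lra.
Qed.

End ExpLog.
(** * Functions on the diagonal *)

Section Diagonal.
Context {R : realType} {m : nat}.
Notation C := R[i].
Notation V := 'rV[C]_m.
Notation B := (@unit_ball R m).
Notation BB := (@BB R m).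
Notation nVV := (@nVV R m).

(** One variable at a time: a function vanishing at real points of a disc vanishes
    near its centre. *)
Lemma zero_real2 (Om : set (V * V)) (F : V * V -> C) p u v : holo nVV Om F -> Om p ->
  (exists2 s : R, 0 < s & forall x y : R, `|x| <= s -> `|y| <= s ->
     F (p + x%:C *: u + y%:C *: v) = 0) ->
  exists2 s : R, 0 < s & forall x y : C, cmod x <= s -> cmod y <= s ->
     F (p + x *: u + y *: v) = 0.
Proof.
move=> hF hp [s1 s10 Fr]; have [[r [M [r0 hr]]] _] := hF p hp.
have u0 := csn_ge0 nVV u; have v0 := csn_ge0 nVV v.
have [s s0 [ss1 sr]] : exists2 s : R, 0 < s & s < s1 /\ s < r / (2 * (nVV u + nVV v + 1)).
  by apply: pos_below => //; rewrite divr_gt0 // mulr_gt0 //; lra.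
have inr x y : cmod x <= s -> cmod y <= s ->
    Om (p + x *: u + y *: v) /\ cmod (F (p + x *: u + y *: v)) <= M.
  move=> hx hy; apply: hr; rewrite -(addrA p) [p + _]addrC addrK.
  apply: le_lt_trans (csnD nVV _ _) _; rewrite !csnZ.
  have : s * (2 * (nVV u + nVV v + 1)) < r.
    by rewrite -ltr_pdivlMr // mulr_gt0 //; lra.
  have := ler_wpM2r u0 hx; have := ler_wpM2r v0 hy; lra.
have lx x y : cmod x <= s -> cmod y <= s -> cdifferentiable (fun z => F (p + z *: u + y *: v)) x.
  move=> hx hy; exists (dirD u F (p + y *: v + x *: u)).
  apply: (@cdiff_ext R _ (fun z => F (p + y *: v + z *: u))).
    by move=> z; rewrite addrAC.
  by apply: (holo_line hF); rewrite addrAC; apply: (inr x y hx hy).1.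
have ly x y : cmod x <= s -> cmod y <= s -> cdifferentiable (fun z => F (p + x *: u + z *: v)) y.
  move=> hx hy; exists (dirD v F (p + x *: u + y *: v)).
  by apply: (holo_line hF); apply: (inr x y hx hy).1.
have h1 (y : R) : `|y| <= s -> forall x, cmod x <= s / 8 -> F (p + x *: u + y%:C *: v) = 0.
  move=> hy; have hy' : cmod y%:C <= s by rewrite cmod_real.
  apply: (@zero_real R (fun x => F (p + x *: u + y%:C *: v)) s M s0) => [x hx|x hx|x hx].
  - exact: lx.
  - by apply: (inr x _ hx hy').2.
  - by apply: Fr; [apply: le_trans hx _|apply: le_trans hy _]; apply: ltW.
exists (s / 8) => [|x y hx]; first by lra.
have hx' : cmod x <= s by lra.
apply: (@zero_real R (fun y => F (p + x *: u + y *: v)) s M s0) => [z hz|z hz|z hz].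
- exact: ly.
- by apply: (inr x z hx' hz).2.
- exact: h1.
Qed.

(** The points (a + (x + i y) b, conj a + (x - i y) conj b) with x and y real are on
    the diagonal.  For complex x and y the coefficients x + i y and x - i y are
    independent, so that F vanishes near (a, conj a) in the direction (0, conj b) as
    well; the segment in this direction leads to (a, c). *)
Lemma polarization_zero (F : V * V -> C) : holo nVV BB F ->
  (forall w, B w -> F (w, conjv w) = 0) -> forall p, BB p -> F p = 0.
Proof.
move=> hF Fd [a c] [/= Ba Bc]; pose b := conjv c - a.
have Baa : BB (a, conjv a) by apply/BB_diag.
have [r r0 hr] := unit_ball_open Ba.
have b0 := csn_ge0 (l1 m) b.
have [|s s0 hs] := @zero_real2 BB F (a, conjv a) (b, conjv b) ('i%C *: b, - ('i%C *: conjv b)) hF Baa.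
  exists (r / (4 * (l1 m b + 1))); first by rewrite divr_gt0 // mulr_gt0 //; lra.
  move=> x y hx hy.
  pose w := a + (x%:C + 'i%C * y%:C) *: b.
  have -> : (a, conjv a) + x%:C *: (b, conjv b) + y%:C *: ('i%C *: b, - ('i%C *: conjv b)) =
      (w, conjv w).
    apply/pair_equal_spec; split; rewrite /= /w.
      by rewrite scalerDl addrA scalerA [y%:C * _]mulrC.
    rewrite conjvD conjvZ rmorphD rmorphM /= -!addrA; congr (_ + _).
    have cr (t : R) : conjC t%:C = t%:C :> C by apply: conjc_real.
    have ci : conjC 'i%C = - 'i%C :> C by apply/eqP; rewrite eq_complex /= oppr0 !eqxx.
    by rewrite !cr ci scalerDl scalerN scalerA mulNr scaleNr [y%:C * _]mulrC.
  apply: Fd; apply: hr; rewrite /w addrAC subrr add0r csnZ.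
  have : cmod (x%:C + 'i%C * y%:C) <= `|x| + `|y|.
    by apply: le_trans (cmodD _ _) _; rewrite cmodM cmodi mul1r !cmod_real.
  set t := r / _ in hx hy; have : t * (4 * (l1 m b + 1)) = r by rewrite /t mulfVK // gt_eqF // mulr_gt0 //; lra.
  have := normr_ge0 x; have := normr_ge0 y; have := cmod_ge0 (x%:C + 'i%C * y%:C) => i1 i2 i3 i4 i5.
  have : cmod (x%:C + 'i%C * y%:C) * l1 m b <= (t + t) * (l1 m b) by apply: ler_wpM2r => //; lra.
  lra.
have -> : (a, c) = (a, conjv a) + (0, conjv b).
  by apply/pair_equal_spec; rewrite /= addr0 /b conjvB conjvK addrC subrK.
apply: (holo_identity hF).
  move=> t ht; split; first by rewrite /= scaler0 addr0.
  rewrite /= /b conjvB conjvK; apply: unit_ball_convex => //.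
  exact/unit_ball_conjv.
exists s => // z hz.
have := hs (z / 2) ('i%C * z / 2).
rewrite !cmodM cmodi mul1r cmodV cmod_nat => h.
have zs : cmod z / 2 <= s by have := cmod_ge0 z; lra.
rewrite -[RHS](h zs zs); congr (F _); apply/pair_equal_spec; split=> /=.
  rewrite scaler0 addr0 scalerA -addrA -scalerDl.
  have -> : z / 2 + 'i%C * z / 2 * 'i%C = z / 2 * (1 + 'i%C ^+ 2) by ring.
  by rewrite sqr_i subrr mulr0 scale0r addr0.
rewrite scalerN scalerA -addrA -scalerBl; congr (_ + _ *: _).
have -> : z / 2 - 'i%C * z / 2 * 'i%C = z / 2 * (1 - 'i%C ^+ 2) by ring.
by rewrite sqr_i; field.
Qed.

Lemma polarization_unique (F G : V * V -> C) : holo nVV BB F -> holo nVV BB G ->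
  (forall w, B w -> F (w, conjv w) = G (w, conjv w)) -> forall p, BB p -> F p = G p.
Proof.
move=> hF hG FG p hp; apply/eqP; rewrite -subr_eq0; apply/eqP.
apply: (polarization_zero (holoB hF hG)) => // w /FG ->; exact: subrr.
Qed.

(** ** Real directional derivatives on the diagonal *)

Lemma derive1_small (g : R -> R) (d : R) :
  (forall e : R, 0 < e -> exists2 r : R, 0 < r &
     forall t, `|t| < r -> `|g t - g 0 - d * t| <= e * `|t|) ->
  derive1 g 0 = d.
Proof.
move=> h; rewrite /derive1; apply/cvg_lim => //.
apply/cvgrPdist_le => e /h[r r0 hr]; apply/nbhs_ballP; exists r => // t.
rewrite -ball_normE /= sub0r normrN => /hr; rewrite addr0 => {}hr t0.
rewrite -[t^-1 *: _]/(t^-1 * _) -(ler_pM2r (_ : 0 < `|t|)) ?normr_gt0 // -normrM.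
apply: le_trans hr; apply: eq_leW; rewrite -normrN; congr (`|_|).
by rewrite mulrBl mulrAC mulVf // mul1r opprB.
Qed.

Lemma real_dir_deriv_small (v : V) (f : V -> C) w (d : C) :
  (forall e : R, 0 < e -> exists2 r : R, 0 < r & forall t : R, `|t| < r ->
     cmod (f (w + t%:C *: v) - f w - d * t%:C) <= e * `|t|) ->
  real_dir_deriv v f w = d.
Proof.
move=> h.
have dRe (t : R) : complex.Re (d * t%:C) = complex.Re d * t.
  by case: (d) => a b /=; rewrite mulr0 subr0.
have dIm (t : R) : complex.Im (d * t%:C) = complex.Im d * t.
  by case: (d) => a b /=; rewrite mulr0 add0r.
rewrite /real_dir_deriv (@derive1_small _ (complex.Re d)); last first.
  move=> e /h[r r0 hr]; exists r => // t /hr; apply: le_trans.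
  by rewrite scale0r addr0 -dRe -!raddfB cmod_Re.
rewrite (@derive1_small _ (complex.Im d)); last first.
  move=> e /h[r r0 hr]; exists r => // t /hr; apply: le_trans.
  by rewrite scale0r addr0 -dIm -!raddfB cmod_Im.
by case: (d).
Qed.

Definition agree_near (w : V) (f : V -> C) (F : V * V -> C) :=
  exists2 r : R, 0 < r & forall q, l1 m (q - w) < r -> f q = F (q, conjv q).

(** Moving w to w + t v with t real moves (w, conj w) in the complex direction
    (v, conj v). *)
Lemma real_dir_deriv_holo (Om : set (V * V)) (F : V * V -> C) f v w :
  holo nVV Om F -> Om (w, conjv w) -> agree_near w f F ->
  real_dir_deriv v f w = dirD (v, conjv v) F (w, conjv w).
Proof.
move=> hF hO [r r0 fF]; apply: real_dir_deriv_small => e e0.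
have [s s0 hs] := dirDP (v, conjv v) hF hO e0.
have v0 := csn_ge0 (l1 m) v.
have rv : 0 < r / (l1 m v + 1) by rewrite divr_gt0 //; lra.
have [t t0 [ts tr]] := pos_below s0 rv.
exists t => // x hx; rewrite !fF; last 2 first.
- by rewrite subrr csn0.
- rewrite addrAC subrr add0r csnZr.
  have : `|x| * (l1 m v + 1) < r by rewrite -ltr_pdivlMr ?(lt_trans hx) //; lra.
  by have := normr_ge0 x; lra.
have := hs x%:C; rewrite cmod_real scale0r addr0 add0r => /(_ (lt_trans hx ts)).
have cx : conjC x%:C = x%:C :> C := conjc_real x.
by rewrite -[(w, conjv w) + _]/(w + x%:C *: v, conjv w + x%:C *: conjv v) conjvD conjvZ cx.
Qed.

Definition dz i : V * V := (delta_mx 0 i, 0).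
Definition dw i : V * V := (0, delta_mx 0 i).

Lemma conjv_delta i : conjv (delta_mx 0 i : V) = delta_mx 0 i.
Proof. by apply/rowP => j; rewrite !mxE; case: (_ && _); rewrite ?rmorph1 ?rmorph0. Qed.

Lemma real_dir_deriv_delta (Om : set (V * V)) (F : V * V -> C) f i w :
  holo nVV Om F -> Om (w, conjv w) -> agree_near w f F ->
  real_dir_deriv (delta_mx 0 i) f w = dirD (dz i) F (w, conjv w) + dirD (dw i) F (w, conjv w) /\
  real_dir_deriv ('i%C *: delta_mx 0 i) f w =
    'i%C * (dirD (dz i) F (w, conjv w) - dirD (dw i) F (w, conjv w)).
Proof.
move=> hF hO fF; split; rewrite (real_dir_deriv_holo _ hF hO fF).
  have -> : (delta_mx 0 i, conjv (delta_mx 0 i)) = dz i + dw i :> V * V.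
    by rewrite conjv_delta; apply/pair_equal_spec; rewrite /= addr0 add0r.
  by rewrite (dirD_add (dz i) (dw i) hF hO).
rewrite conjvZ conjv_delta.
have ci : conjC 'i%C = - 'i%C :> C by apply/eqP; rewrite eq_complex /= oppr0 !eqxx.
have -> : ('i%C *: delta_mx 0 i, conjC 'i%C *: delta_mx 0 i) = 'i%C *: dz i + (- 'i%C) *: dw i :> V * V.
  by apply/pair_equal_spec; rewrite /= !scaler0 addr0 add0r ci.
by rewrite (dirD_add ('i%C *: dz i) (- 'i%C *: dw i) hF hO) !(dirDZ _ _ hF hO) mulrBr mulNr.
Qed.

Lemma d_dw_holo Om (F : V * V -> C) f i w :
  holo nVV Om F -> Om (w, conjv w) -> agree_near w f F ->
  d_dw i f w = dirD (dz i) F (w, conjv w).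
Proof.
move=> hF hO fF; rewrite /d_dw.
have [-> ->] := real_dir_deriv_delta i hF hO fF; rewrite mulrA -expr2 sqr_i.
by move: (dirD (dz i) F _) (dirD (dw i) F _) => a b; field.
Qed.

Lemma d_dwbar_holo Om (F : V * V -> C) f i w :
  holo nVV Om F -> Om (w, conjv w) -> agree_near w f F ->
  d_dwbar i f w = dirD (dw i) F (w, conjv w).
Proof.
move=> hF hO fF; rewrite /d_dwbar.
have [-> ->] := real_dir_deriv_delta i hF hO fF; rewrite mulrA -expr2 sqr_i.
by move: (dirD (dz i) F _) (dirD (dw i) F _) => a b; field.
Qed.

(** The mixed second derivative of log F, meaningful wherever F is not 0 and not
    only where log F has been defined. *)
Definition ddlog (F : V * V -> C) i j p : C :=
  (dirD (dz i) (dirD (dw j) F) p * F p - dirD (dw j) F p * dirD (dz i) F p) / F p ^+ 2.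

(** Near the diagonal point F has positive real part, so that log F is the
    composition with the principal branch; the Wirtinger derivatives of its
    restriction are partial derivatives of this holomorphic function. *)
Lemma ddbar_logE (L : V -> V -> C) w i j : holo nVV BB (sharp L) ->
  (forall w, B w -> 0 < L w w) -> B w ->
  ddbar_log L w i j = ddlog (sharp L) i j (w, conjv w).
Proof.
move=> hL L0 Bw; set F := sharp L in hL *.
have FL q : F (q, conjv q) = L q q by rewrite /F sharp_diag.
pose P : set (V * V) := [set p | BB p /\ 0 < complex.Re (F p)].
have P_open : is_open nVV P.
  move=> p [hp Fp]; have e0 : 0 < complex.Re (F p) / 2 by lra.
  have [r r0 hr] := holo_cont hL hp e0; exists r => // q /hr[hq Fq]; split=> //.
  have := le_trans (cmod_Re _) Fq; rewrite raddfB /= ler_norml; lra.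
have hLP : holo nVV P F by apply: holo_subset hL => // p [].
have P_diag q : B q -> P (q, conjv q).
  move=> Bq; split; first exact/BB_diag.
  by rewrite FL; have := L0 q Bq; rewrite ltcE => /andP[].
have Fn0 p : P p -> F p != 0.
  by case=> _; apply: contraTneq => ->; rewrite /= ltxx.
have hlog : holo nVV P (fun p => clog (F p)).
  by apply: (holo_comp hLP) => p [_ Fp]; exists (F p)^-1; apply: cdiff_clog.
have [r r0 hr] := unit_ball_open Bw.
have first_deriv q : l1 m (q - w) < r -> d_dwbar j (log_diag L) q =
    (fun p => dirD (dw j) F p * (F p)^-1) (q, conjv q).
  move=> hq; have Bq := hr q hq.
  rewrite (@d_dwbar_holo P (fun p => clog (F p))); [|exact: hlog|exact: P_diag|].
    rewrite (dirD_comp _ hLP (P_diag _ Bq) (cdiff_clog _)); first by rewrite mulrC.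
    by case: (P_diag q Bq).
  have [s s0 hs] := unit_ball_open Bq; exists s => // u /hs Bu.
  have := L0 u Bu; rewrite FL /log_diag; case: (L u u) => a b; rewrite ltcE /=.
  by move=> /andP[/eqP -> a0]; rewrite clog_real.
rewrite mxE (@d_dw_holo P (fun p => dirD (dw j) F p * (F p)^-1)).
- have PP := P_diag w Bw; have hD := holo_dirD (dw j) hLP; have F0 := Fn0 _ PP.
  rewrite (dirDM _ hD (holoV hLP Fn0) PP) (dirDV _ hLP PP F0) /ddlog.
  move: (dirD (dz i) (dirD (dw j) F) _) (dirD (dw j) F _) (dirD (dz i) F _) => a b c.
  by move: (F _) F0 => d d0; field.
- exact: holoM (holo_dirD _ hLP) (holoV hLP Fn0).
- exact: P_diag.
- by exists r.
Qed.

End Diagonal.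
(** * Positive definite kernels *)

Section PositiveDefinite.
Context {R : realType} {m : nat}.
Notation C := R[i].
Notation V := 'rV[C]_m.
Notation B := (@unit_ball R m).
Notation BB := (@BB R m).
Notation nVV := (@nVV R m).

Lemma vdot_mulmx n (A : 'M[C]_n) (x y : 'cV[C]_n) :
  vdot (A *m x)^T y^T = \sum_i \sum_j A i j * x j 0 * conjC (y i 0).
Proof.
by apply: eq_bigr => i _; rewrite !mxE mulr_suml.
Qed.

(** Expanded inner products: the estimates below concern single matrix entries. *)
Definition pos_form n (G : V -> V -> 'M[C]_n) := forall (l : nat) (u : 'I_l -> V)
    (c : 'I_l -> 'I_n -> C), (forall p, B (u p)) ->
  0 <= \sum_p \sum_q \sum_i \sum_j G (u p) (u q) i j * c q j * conjC (c p i).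

Lemma pos_formP n (G : V -> V -> 'M[C]_n) :
  pos_def_kernel B G <-> sesquiholomorphic B G /\ pos_form G.
Proof.
split=> -[hs hG]; split=> // l u c hu.
  apply: etrans (hG l u (fun p => \col_i c p i) hu); congr (_ <= _).
  apply: eq_bigr => p _; apply: eq_bigr => q _; rewrite vdot_mulmx.
  by apply: eq_bigr => i _; apply: eq_bigr => j _; rewrite !mxE.
apply: etrans (hG l u (fun p i => c p i 0) hu); congr (_ <= _).
by apply: eq_bigr => p _; apply: eq_bigr => q _; rewrite vdot_mulmx.
Qed.

Lemma pos_form_diag n (G : V -> V -> 'M[C]_n) z i : pos_form G -> B z -> 0 <= G z z i i.
Proof.
move=> hG Bz; have := hG 1%N (fun=> z) (fun _ j => (j == i)%:R) (fun=> Bz).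
rewrite !big_ord_recl !big_ord0 !addr0.
rewrite (bigD1 i) //= [X in _ + X]big1 ?addr0; last first.
  move=> k /negPf ki; apply: big1 => j _; rewrite ki rmorph0 mulr0 //.
rewrite (bigD1 i) //= [X in _ + X]big1 ?addr0; last first.
  by move=> k /negPf ki; rewrite ki mulr0 mul0r.
have e : (i == i)%:R = 1 :> C by rewrite eqxx.
by rewrite e rmorph1 !mulr1.
Qed.

Lemma pos_form_two n (G : V -> V -> 'M[C]_n) z w i j (a b : C) :
  pos_form G -> B z -> B w ->
  0 <= G z z i i * a * conjC a + G z w i j * b * conjC a
     + G w z j i * a * conjC b + G w w j j * b * conjC b.
Proof.
move=> hG Bz Bw.
pose u (p : 'I_2) := if p == 0 then z else w.
pose c (p : 'I_2) (k : 'I_n) := if p == 0 then a * (k == i)%:R else b * (k == j)%:R.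
have hu p : B (u p) by rewrite /u; case: ifP.
have := hG 2 u c hu.
have one (A : 'M[C]_n) (x y : C) k k' :
    \sum_i0 \sum_j0 A i0 j0 * (x * (j0 == k')%:R) * conjC (y * (i0 == k)%:R) =
    A k k' * x * conjC y.
  rewrite (bigD1 k) //= [X in _ + X]big1 ?addr0; last first.
    by move=> h /negPf hk; apply: big1 => ? _; rewrite hk mulr0 rmorph0 mulr0.
  rewrite (bigD1 k') //= [X in _ + X]big1 ?addr0; last first.
    by move=> h /negPf hk; rewrite hk !mulr0 mul0r.
  have e k0 : (k0 == k0 :> 'I_n)%:R = 1 :> C by rewrite eqxx.
  by rewrite !e !mulr1.
rewrite !big_ord_recl !big_ord0 !addr0 /u /c /= !one.
by rewrite !addrA.
Qed.

(** The quadratic form in two variables of the previous lemma, evaluated at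
    (1, 1), (1, -1), (1, i) and (1, -i). *)
Lemma pos_form_entry n (G : V -> V -> 'M[C]_n) z w i j :
  pos_form G -> B z -> B w ->
  G w z j i = conjC (G z w i j) /\
  cmod (G z w i j) <= complex.Re (G z z i i) + complex.Re (G w w j j).
Proof.
move=> hG Bz Bw.
have := pos_form_diag i hG Bz; have := pos_form_diag j hG Bw.
have h := pos_form_two i j _ _ hG Bz Bw.
have := h 1 1; have := h 1 (-1); have := h 1 'i%C; have := h 1 (- 'i%C).
case: (G z w i j) => x1 x2; case: (G w z j i) => y1 y2.
case: (G z z i i) => a1 a2; case: (G w w j j) => b1 b2.
rewrite !lecE /=; simpc.
move=> /andP[/eqP h1 h1'] /andP[/eqP h2 h2'] /andP[/eqP h3 h3'] /andP[/eqP h4 h4'].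
move=> /andP[/eqP h5 h5'] /andP[/eqP h6 h6'].
have e1 : y1 = x1 by lra.
have e2 : y2 = - x2 by lra.
split; first by apply/eqP; rewrite eq_complex /= e1 e2 !eqxx.
apply: le_trans (cmod_le_ReIm _) _ => /=.
have : `|x1| <= (a1 + b1) / 2 by rewrite ler_norml; lra.
have : `|x2| <= (a1 + b1) / 2 by rewrite ler_norml; lra.
lra.
Qed.

(** Positive definiteness turns a bound on the diagonal into a bound
    everywhere, which makes separately holomorphic kernels holomorphic. *)
Lemma pos_def_holo n (G : V -> V -> 'M[C]_n) i j : pos_def_kernel B G ->
  (forall k w, B w -> exists r M : R, 0 < r /\
     forall q, B q -> l1 m (q - w) < r -> complex.Re (G q q k k) <= M) ->
  holo nVV BB (sharp (fun z w => G z w i j)).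
Proof.
move=> /pos_formP[hs hG] bd; apply: sesqui_holo hs _ => -[z w] [/= Bz Bw].
have [r [M [r0 hr]]] := bd i z Bz.
have [s [M' [s0 hs']]] := bd j (conjv w) (iffRL (unit_ball_conjv w) Bw).
have [t1 t10 [tr ts]] := pos_below r0 s0.
have [t2 t20 ht2] := BB_open (conj Bz Bw : BB (z, w)).
have [t t0 [tt1 tt2]] := pos_below t10 t20.
exists t, (M + M'); split=> // -[a b] hq.
have [/= Ba Bb] := ht2 _ (lt_trans hq tt2).
have Bb' : B (conjv b) by apply/unit_ball_conjv.
have [_ h] := pos_form_entry i j hG Ba Bb'; apply: le_trans h _.
have {}hq : l1 m (a - z) + l1 m (b - w) < t := hq.
have := csn_ge0 (l1 m) (a - z); have := csn_ge0 (l1 m) (b - w) => h1 h2.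
apply: lerD; first by apply: hr => //; lra.
by apply: hs' => //; rewrite -conjvB l1_conjv; lra.
Qed.

(** ** Coordinates *)

Lemma holo_coord i : holo (l1 m) B (fun v => v 0 i).
Proof.
move=> p hp; split=> [|v]; last first.
  by exists (v 0 i); apply: cdiff_ext (cdiff_affine (p 0 i) (v 0 i) 0) => z; rewrite !mxE.
have [r r0 hr] := unit_ball_open hp; exists r, (cmod (p 0 i) + r); split=> // q hq.
split; first exact: hr.
by have := cmod_dist (q 0 i) (p 0 i); have := l1_entry (q - p) i; rewrite !mxE; lra.
Qed.

Lemma holo_coord1 i : holo nVV BB (fun p : V * V => p.1 0 i).
Proof. exact: holo_fst (holo_coord i). Qed.

Lemma holo_coord2 i : holo nVV BB (fun p : V * V => p.2 0 i).
Proof. exact: holo_snd (holo_coord i). Qed.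

Lemma holo_vdot : holo nVV BB (fun p : V * V => 1 - vdot p.1 (conjv p.2)).
Proof.
apply: holoB; first exact/holo_cst/BB_open.
apply: (@eq_holo _ _ _ _ _ (fun p : V * V => \sum_(k < m) p.1 0 k * p.2 0 k)).
  by move=> p _; apply: eq_bigr => k _; rewrite mxE conjCK.
apply: holo_sum; first exact: BB_open.
by move=> k; apply: holoM (holo_coord1 k) (holo_coord2 k).
Qed.

Lemma one_sub_vdot_neq0 z w : B z -> B w -> 1 - vdot z w != 0.
Proof.
move=> Bz Bw; rewrite subr_eq0; apply: contraTneq (vdot_lt1 Bz Bw) => <-.
by rewrite cmod1 ltxx.
Qed.

Lemma one_sub_vdot_gt0 w : B w -> 0 < 1 - vdot w w :> C.
Proof. by rewrite /unit_ball /= subr_gt0. Qed.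

Lemma ddlogM (F G : V * V -> C) i j p : holo nVV BB F -> holo nVV BB G -> BB p ->
  F p != 0 -> G p != 0 ->
  ddlog (fun q => F q * G q) i j p = ddlog F i j p + ddlog G i j p.
Proof.
move=> hF hG hp F0 G0; rewrite /ddlog.
have hFj := holo_dirD (dw j) hF; have hGj := holo_dirD (dw j) hG.
have -> : dirD (dz i) (dirD (dw j) (fun q => F q * G q)) p =
    dirD (dz i) (fun q => dirD (dw j) F q * G q + F q * dirD (dw j) G q) p.
  by apply: (eq_dirD _ (@BB_open R m)) => // q hq; rewrite (dirDM _ hF hG hq).
rewrite (dirDD _ (holoM hFj hG) (holoM hF hGj) hp).
rewrite (dirDM _ hFj hG hp) (dirDM _ hF hGj hp) !(dirDM _ hF hG hp).
move: (dirD (dz i) (dirD (dw j) F) _) (dirD (dw j) F _) (dirD (dz i) F _) => a b c.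
move: (dirD (dz i) (dirD (dw j) G) _) (dirD (dw j) G _) (dirD (dz i) G _) => a' b' c'.
move: (F p) (G p) F0 G0 => d d' d0 d'0; field.
by rewrite d0 d'0.
Qed.

Lemma ddlog_holo Om (F : V * V -> C) i j : holo nVV Om F -> (forall q, Om q -> F q != 0) ->
  holo nVV Om (ddlog F i j).
Proof.
move=> hF F0; have hi := holo_dirD (dz i) hF; have hj := holo_dirD (dw j) hF.
apply: holoM; last by apply: holoV => [|q hq]; [exact: holoX|rewrite expf_neq0 ?F0].
exact: holoB (holoM (holo_dirD (dz i) hj) hF) (holoM hj hi).
Qed.

Lemma ddlog_cst (a : C) i j (p : V * V) : ddlog (fun=> a) i j p = 0.
Proof.
have e : dirD (dw j) (fun=> a) = (fun=> 0) :> (V * V -> C).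
  by apply/funext => q; apply: dirD_cst.
by rewrite /ddlog e !dirD_cst !mul0r subrr mul0r.
Qed.

End PositiveDefinite.
(** * An open mapping theorem *)

Section OpenMapping.
Context {R : realType} {E F : lmodType R[i]} (N : cseminorm E) (P : cseminorm F).
Context (D : E -> F).
Hypothesis D_lin : forall (a : R[i]) x y, D (a *: x + y) = a *: D x + D y.
Hypothesis P_definite : forall y, P y = 0 -> y = 0.
Hypothesis D_cont : forall e : R, 0 < e -> exists2 d : R, 0 < d &
  forall x, N x < d -> P (D x) <= e.
Hypothesis N_complete : forall (u : nat -> E) (c : R), 0 < c ->
  (forall n, N (u n.+1 - u n) <= c * 2 ^- n) ->
  exists x, forall n, N (x - u n) <= 2 * c * 2 ^- n.
Hypothesis range_complete : forall u : nat -> E,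
  (forall n, P (D (u n.+1) - D (u n)) <= 2 ^- n) ->
  exists x, forall n, P (D x - D (u n)) <= 2 * 2 ^- n.

Let D0 : D 0 = 0.
Proof. by have := D_lin (-1) 0 0; rewrite scaler0 addr0 scaleN1r addNr. Qed.

Let DB x y : D (x - y) = D x - D y.
Proof. by rewrite addrC -scaleN1r D_lin scaleN1r addrC. Qed.

Let DZ (a : R[i]) x : D (a *: x) = a *: D x.
Proof. by rewrite -[_ *: x]addr0 D_lin D0 addr0. Qed.

(** Baire's argument: otherwise one could choose successively balls of the range,
    nested and shrinking, the n-th avoiding the image of the ball of radius n; by
    completeness they have a common point in the range, a contradiction. *)
Let baire : exists n (x0 : E) (rho : R), 0 < rho /\ forall x, P (D x - D x0) < rho ->
  forall eta : R, 0 < eta -> exists2 x', N x' <= n%:R & P (D x' - D x) < eta.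
Proof.
apply: contrapT => nb.
have step (n : nat) (x0 : E) (rho : R) : 0 < rho -> exists x (eta : R),
    [/\ 0 < eta, P (D x - D x0) < rho &
        forall x', N x' <= n%:R -> eta <= P (D x' - D x)].
  move=> rho0; apply: contrapT => ns; apply: nb; exists n, x0, rho; split=> // x hx eta eta0.
  apply: contrapT => ne; apply: ns; exists x, eta; split=> // x' hx'.
  by rewrite leNgt; apply/negP => lt; apply: ne; exists x'.
have /choice[G hG] : forall s : nat * E * R, exists t : E * R, 0 < s.2 ->
    [/\ 0 < t.2, P (D t.1 - D s.1.2) < s.2 / 2, t.2 <= s.2 / 2 &
        forall x', N x' <= s.1.1%:R -> 2 * t.2 <= P (D x' - D t.1)].
  move=> [[n x0] rho] /=; have [rho0|/negP nrho] := boolP (0 < rho); last by exists (0, 0).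
  have [|x [eta [eta0 hx far]]] := step n x0 (rho / 2); first by lra.
  exists (x, Num.min (eta / 2) (rho / 2)) => _; split=> //=.
  - by rewrite lt_min !divr_gt0.
  - by rewrite ge_min lexx orbT.
  move=> x' /far; apply: le_trans.
  have : Num.min (eta / 2) (rho / 2) <= eta / 2 by rewrite ge_min lexx.
  lra.
pose fix u n : E * R := if n is n'.+1 then G (n', (u n').1, (u n').2) else (0, 1).
have u0 n : 0 < (u n).2.
  elim: n => [|n IH]; first by rewrite /= ltr01.
  by have [] := hG (n, (u n).1, (u n).2) IH.
have uS n : [/\ P (D (u n.+1).1 - D (u n).1) < (u n).2 / 2, (u n.+1).2 <= (u n).2 / 2 &
    forall x', N x' <= n%:R -> 2 * (u n.+1).2 <= P (D x' - D (u n.+1).1)].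
  by have [] := hG (n, (u n).1, (u n).2) (u0 n).
have u2 n : (u n).2 <= 2 ^- n.
  elim: n => [|n IH]; first by rewrite /= expr0 invr1.
  have [_ h _] := uS n; apply: le_trans h _.
  by rewrite exprS invfM mulrC ler_pM2l // invr_gt0.
have [|x hx] := @range_complete (fun n => (u n).1).
  move=> n; have [h _ _] := uS n; apply: ltW; apply: lt_le_trans h _.
  by have := u0 n; have := u2 n; lra.
have tail n k : P (D (u (n + k)%N).1 - D (u n).1) <= (u n).2 - (u (n + k)%N).2.
  elim: k => [|k IH]; first by rewrite addn0 !subrr csn0.
  rewrite addnS; have [h1 h2 _] := uS (n + k)%N.
  have := csnD P (D (u (n + k).+1).1 - D (u (n + k)%N).1) (D (u (n + k)%N).1 - D (u n).1).
  rewrite addrA subrK; lra.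
pose n := (truncn (N x)).+1.
have Nx : N x <= n%:R by rewrite ltW // truncnS_gt.
have [_ _ /(_ x Nx)] := uS n.
apply/negP; rewrite -ltNge.
have un := u0 n.+1.
have [k hk] := half_pow_small (divr_gt0 un (ltr0n _ 2)).
have kk : 2 ^- (n.+1 + k) <= 2 ^- k :> R.
  rewrite lef_pV2 ?posrE ?exprn_gt0 // ler_eXn2l ?leq_addl // ltr1n //.
have h1 := hx (n.+1 + k)%N; have h2 := tail n.+1 k; have h3 := u0 (n.+1 + k)%N.
have := csnD P (D x - D (u (n.+1 + k)%N).1) (D (u (n.+1 + k)%N).1 - D (u n.+1).1).
rewrite addrA subrK; lra.
Qed.

(** Translating and scaling the ball found by Baire's argument. *)
Let almost : exists2 c : R, 0 < c & forall x (t : R), 0 < t -> P (D x) <= t ->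
  forall eta : R, 0 < eta -> exists2 x', N x' <= c * t & P (D x' - D x) < eta.
Proof.
have [n [x0 [rho [rho0 h]]]] := baire.
exists (4 * (n%:R + 1) / rho) => [|x t t0 hx eta eta0].
  by rewrite divr_gt0 // mulr_gt0 // ltr_wpDl.
pose k := rho / (2 * t); have k0 : 0 < k by rewrite divr_gt0 // mulr_gt0.
have kn0 : k%:C != 0 :> R[i] by rewrite -cmod_gt0 cmod_real gtr0_norm.
have hke : 0 < k * eta / 2 by rewrite divr_gt0 // mulr_gt0.
have [|y1 n1 e1] := h (k%:C *: x + x0) _ _ hke.
  rewrite D_lin addrK csnZr gtr0_norm //.
  have : k * P (D x) <= k * t by rewrite ler_pM2l.
  have -> : k * t = rho / 2 by rewrite /k; field; lra.
  lra.
have [|y2 n2 e2] := h x0 _ _ hke; first by rewrite subrr csn0.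
exists ((k^-1)%:C *: (y1 - y2)).
  rewrite csnZr ger0_norm ?invr_ge0 ?(ltW k0) //.
  have : N (y1 - y2) <= 2 * n%:R by have := csnD N y1 (- y2); rewrite csnN; lra.
  move=> h12; apply: (@le_trans _ _ (k^-1 * (2 * n%:R))).
    by apply: ler_wpM2l => //; rewrite invr_ge0 ltW.
  have -> : 4 * (n%:R + 1) / rho * t = k^-1 * (2 * (n%:R + 1)) by rewrite /k; field; lra.
  by apply: ler_wpM2l; [rewrite invr_ge0 ltW|lra].
have -> : D ((k^-1)%:C *: (y1 - y2)) - D x =
    (k^-1)%:C *: ((D y1 - D (k%:C *: x + x0)) - (D y2 - D x0)).
  have kk : (k^-1)%:C * k%:C = 1 :> R[i] by rewrite -rmorphM /= mulVf // gt_eqF.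
  have -> : D y1 - D (k%:C *: x + x0) - (D y2 - D x0) = D y1 - D y2 - k%:C *: D x.
    by rewrite D_lin opprB opprD !addrA subrK addrAC.
  by rewrite DZ DB [in RHS]scalerBr scalerA kk scale1r.
rewrite csnZr ger0_norm ?invr_ge0 ?(ltW k0) // ltr_pdivrMl //.
have := csnD P (D y1 - D (k%:C *: x + x0)) (- (D y2 - D x0)); rewrite csnN.
lra.
Qed.

(** Correcting an approximate preimage infinitely often, with errors halved at each
    step, gives an exact one with a norm bounded by a geometric series. *)
Lemma open_mapping : exists2 c : R, 0 < c & forall x (t : R), 0 < t -> P (D x) <= t ->
  exists2 y, N y <= c * t & D y = D x.
Proof.
have [c c0 h] := almost; exists (2 * c) => [|x t t0 hx]; first by rewrite mulr_gt0.
have t2 n : 0 < t * 2 ^- n by rewrite mulr_gt0 // invr_gt0 exprn_gt0.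
have /choice[G hG] : forall s : E * nat, exists y, P (D s.1) <= t * 2 ^- s.2 ->
    N y <= c * (t * 2 ^- s.2) /\ P (D (s.1 - y)) <= t * 2 ^- s.2.+1.
  move=> [z n] /=; have [hz|nz] := pselect (P (D z) <= t * 2 ^- n); last by exists 0.
  have [y hy1 hy2] := h z _ (t2 n) hz _ (t2 n.+1); exists y => _; split=> //.
  by rewrite DB -csnN opprB ltW.
pose fix u n : E := if n is n'.+1 then u n' + G (x - u n', n') else 0.
have res n : P (D (x - u n)) <= t * 2 ^- n.
  elim: n => [|n IH]; first by rewrite /= subr0 expr0 invr1 mulr1.
  by have [_] := hG (x - u n, n) IH; rewrite /= opprD addrA.
have [|y hy] := @N_complete u (c * t) (mulr_gt0 c0 t0).
  move=> n.
  have [h1 _] := hG (x - u n, n) (res n).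
  by rewrite -mulrA [N _](_ : _ = N (G (x - u n, n))) //= addrC addKr.
exists y.
  by have := hy 0%N; rewrite /= subr0 expr0 invr1 mulr1 mulrA.
apply/eqP; rewrite -subr_eq0 -DB; apply/eqP/P_definite/eqP.
rewrite eq_le csn_ge0 andbT; apply/ler_addgt0Pr => e e0; rewrite add0r.
have e2 : 0 < e / 2 by lra.
have [d d0 hd] := D_cont e2.
have ct : 0 < d / (2 * (c * t) + 1).
  by rewrite divr_gt0 // ltr_wpDl // ltW // !mulr_gt0.
have [s s0 [s1 s2]] := pos_below ct (divr_gt0 e2 t0).
have [n hn] := half_pow_small s0.
have hn1 : N (y - u n) < d.
  apply: le_lt_trans (hy n) _.
  have : 2 ^- n < d / (2 * (c * t) + 1) by apply: lt_trans s1.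
  rewrite ltr_pdivlMr; last by rewrite ltr_wpDl // ltW // !mulr_gt0.
  by have : 0 < 2 ^- n :> R by [rewrite invr_gt0 exprn_gt0]; lra.
have h1 := hd _ hn1; have h2 := res n.
have : 2 ^- n * t < e / 2 by rewrite -ltr_pdivlMr // (lt_trans hn).
have -> : y - x = (y - u n) - (x - u n) by rewrite opprB addrA subrK.
rewrite DB; have := csnD P (D (y - u n)) (- D (x - u n)); rewrite csnN.
lra.
Qed.

End OpenMapping.
(** * Local boundedness of the reproducing kernel *)

Section HilbertSpace.
Context {R : realType} (H : hilbert R).
Notation C := R[i].
Notation "<< x , y >>" := (inner H x y) (at level 0).

Definition hnorm (x : H) : R := cmod `|x|.

Lemma hnormE (x : H) : `|x| = (hnorm x)%:C.
Proof. exact: cmod_norm. Qed.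

Lemma hnormD' x y : hnorm (x + y) <= hnorm x + hnorm y.
Proof. by rewrite -lecR rmorphD /= -!hnormE ler_normD. Qed.

Lemma hnormZ' (a : C) x : hnorm (a *: x) = cmod a * hnorm x.
Proof. by apply: complexI; rewrite rmorphM /= -!hnormE -cmodE normrZ. Qed.

Definition hN : cseminorm H := CSeminorm hnormD' hnormZ'.

Lemma hN_eq0 x : hN x = 0 -> x = 0.
Proof. by move=> h; apply/normr0_eq0; rewrite hnormE -[hnorm x]/(hN x) h. Qed.

Lemma inner_sq x : << x, x >> = (hN x ^+ 2)%:C.
Proof. by rewrite -innerE hnormE rmorphXn. Qed.

Lemma innerC x y : << y, x >> = conjC << x, y >>.
Proof. by rewrite hermC /= expr0 mul1r. Qed.

Lemma innerBl x y z : << x - y, z >> = << x, z >> - << y, z >>.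
Proof. by rewrite linearBl. Qed.

Lemma innerBr x y z : << z, x - y >> = << z, x >> - << z, y >>.
Proof. by rewrite linearBr. Qed.

Lemma innerZl a x y : << a *: x, y >> = a * << x, y >>.
Proof. by rewrite linearZl_LR. Qed.

Lemma innerZr a x y : << x, a *: y >> = conjC a * << x, y >>.
Proof. by rewrite linearZr_LR. Qed.

Lemma inner_cauchy_schwarz x y : cmod << x, y >> <= hN x * hN y.
Proof.
have [y0|y0] := eqVneq (hN y) 0.
  by rewrite (hN_eq0 y0) linear0r cmod0 mulr_ge0 // csn_ge0.
have yp : 0 < hN y by rewrite lt_def y0 csn_ge0.
set a := << x, y >>; set d := hN y ^+ 2.
have d0 : 0 < d by rewrite exprn_gt0.
pose z := x - (a / d%:C) *: y.
have dn : d%:C != 0 :> C by rewrite -cmod_gt0 cmod_real gtr0_norm.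
have zz : << z, z >> = (hN x ^+ 2 - cmod a ^+ 2 / d)%:C.
  have zy : << z, y >> = 0.
    by rewrite /z innerBl innerZl inner_sq -/d -/a mulfVK // subrr.
  rewrite {2}/z innerBr innerZr zy mulr0 subr0 /z innerBl innerZl.
  rewrite inner_sq [<< y, x >>]innerC -/a mulrAC -normCK cmodE.
  have dV : (d^-1)%:C = (d%:C)^-1 :> C by rewrite fmorphV.
  have aX : (cmod a ^+ 2)%:C = (cmod a)%:C ^+ 2 :> C by rewrite rmorphXn.
  by rewrite -aX -dV -rmorphM -rmorphB.
have : 0 <= hN x ^+ 2 - cmod a ^+ 2 / d.
  by rewrite -lecR -zz inner_sq lecR sqr_ge0.
rewrite subr_ge0 ler_pdivrMr // /d -exprMn => h.
by rewrite -ler_sqr ?nnegrE ?cmod_ge0 // mulr_ge0 ?csn_ge0.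
Qed.

Lemma hN_tail (E : lmodType C) (N : cseminorm E) (u : nat -> E) (c : R) : 0 < c ->
  (forall n, N (u n.+1 - u n) <= c * 2 ^- n) ->
  forall n k, N (u (n + k)%N - u n) <= 2 * c * 2 ^- n.
Proof.
move=> c0 hu n k.
suff : N (u (n + k)%N - u n) <= 2 * c * 2 ^- n - 2 * c * 2 ^- (n + k).
  have : 0 <= 2 * c * 2 ^- (n + k) by rewrite !mulr_ge0 ?invr_ge0 ?exprn_ge0 // ltW.
  lra.
elim: k => [|k IH]; first by rewrite addn0 !subrr csn0.
rewrite addnS; have := hu (n + k)%N.
have := csnD N (u (n + k).+1 - u (n + k)%N) (u (n + k)%N - u n); rewrite addrA subrK.
have -> : 2 ^- (n + k).+1 = 2 ^- (n + k) / 2 :> R by rewrite exprS invfM mulrC.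
by move: (2 ^- (n + k)) (2 ^- n) IH => a b; lra.
Qed.

Lemma hN_complete (u : nat -> H) (c : R) : 0 < c ->
  (forall n, hN (u n.+1 - u n) <= c * 2 ^- n) ->
  exists x, forall n, hN (x - u n) <= 2 * c * 2 ^- n.
Proof.
move=> c0 hu; have tail := hN_tail c0 hu.
have : cvg (u @ \oo).
  apply/cauchy_cvgP/cauchy_exP => e e0.
  have ce : 0 < cmod e by rewrite cmod_gt0 gt_eqF.
  have [N hN'] := half_pow_small (divr_gt0 ce (mulr_gt0 (ltr0n R 2) c0)).
  exists (u N); exists N => // n /= Nn; rewrite -ball_normE /=.
  rewrite hnormE (cmod_norm (ltW e0)) ltcR -[hnorm _]/(hN _) -csnN opprB.
  have := tail N (n - N)%N; rewrite subnKC // => h; apply: le_lt_trans h _.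
  by rewrite mulrC -ltr_pdivlMr // mulr_gt0.
move=> /cvg_ex[x hx]; exists x => n; apply/ler_addgt0Pr => e e0.
have /cvgrPdist_le /(_ e%:C) := hx; rewrite ltcR => /(_ e0)[N _ hN'].
have := hN' (n + N)%N (leq_addl _ _); rewrite /= hnormE lecR -[hnorm _]/(hN _) => h1.
have := tail n N; have := csnD hN (x - u (n + N)%N) (u (n + N)%N - u n).
by rewrite addrA subrK; move: (2 * c / _) => a; lra.
Qed.

Lemma linear_small (T : {linear H -> H}) (e : R) : continuous T -> 0 < e ->
  exists2 d : R, 0 < d & forall x, hN x < d -> hN (T x) <= e.
Proof.
move=> cT e0; have /cvgrPdist_le /(_ e%:C) := cT 0; rewrite ltcR => /(_ e0).
move=> /nbhs_ballP[d /= d0 hd]; exists (cmod d); first by rewrite cmod_gt0 gt_eqF.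
move=> x hx; have /hd : ball (0 : H) d x.
  by rewrite -ball_normE /= sub0r normrN hnormE (cmod_norm (ltW d0)) ltcR.
by rewrite /= linear0 sub0r normrN hnormE lecR.
Qed.

Section Tuple.
Context {m : nat}.
Notation V := 'rV[C]_m.

Definition tuple_norm (y : {ffun 'I_m -> H}) : R := \sum_i hN (y i).

Lemma tuple_normD x y : tuple_norm (x + y) <= tuple_norm x + tuple_norm y.
Proof.
by rewrite -big_split /=; apply: ler_sum => i _; rewrite ffunE csnD.
Qed.

Lemma tuple_normZ (a : C) x : tuple_norm (a *: x) = cmod a * tuple_norm x.
Proof. by rewrite mulr_sumr; apply: eq_bigr => i _; rewrite ffunE csnZ. Qed.

Definition hNm : cseminorm {ffun 'I_m -> H} := CSeminorm tuple_normD tuple_normZ.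

Lemma hNm_entry (y : {ffun 'I_m -> H}) i : hN (y i) <= hNm y.
Proof.
rewrite /= /tuple_norm (bigD1 i) //= lerDl; apply: sumr_ge0 => j _; exact: (csn_ge0 hN).
Qed.

(** Closedness of the range is what makes the range complete, as the open mapping
    theorem requires. *)
Lemma D_op_open (T : 'I_m -> {linear H -> H}) (w : V) :
  (forall i, continuous (T i)) -> closed (range (D_op T w)) ->
  exists2 c : R, 0 < c & forall x (t : R), 0 < t ->
    \sum_i hN (T i x - w 0 i *: x) <= t ->
    exists2 y, hN y <= c * t & forall i, T i y - w 0 i *: y = T i x - w 0 i *: x.
Proof.
move=> cT cl.
pose D x : {ffun 'I_m -> H} := [ffun i => T i x - w 0 i *: x].
have D_lin (a : C) x y : D (a *: x + y) = a *: D x + D y.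
  apply/ffunP => i; rewrite !ffunE linearP scalerDr scalerBr !scalerA.
  by rewrite [w 0 i * a]mulrC opprD !addrA; congr (_ - _); rewrite -!addrA; congr (_ + _);
     rewrite addrC.
have DE x : hNm (D x) = \sum_i hN (T i x - w 0 i *: x).
  by apply: eq_bigr => i _; rewrite ffunE.
have P_def y : hNm y = 0 -> y = 0.
  move=> y0; apply/ffunP => i; rewrite ffunE; apply: hN_eq0; apply/eqP.
  by rewrite eq_le csn_ge0 andbT -y0 hNm_entry.
have D_cont (e : R) : 0 < e -> exists2 d : R, 0 < d & forall x, hN x < d -> hNm (D x) <= e.
  move=> e0; pose k : R := e / (m%:R + 1).
  have m1 : 0 < m%:R + 1 :> R by rewrite ltr_wpDl.
  have k2 : 0 < k / 2 by rewrite !divr_gt0.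
  have /choice[d hd] : forall i, exists d : R, 0 < d /\ forall x, hN x < d -> hN (T i x) <= k / 2.
    by move=> i; have [d d0 hd] := linear_small (cT i) k2; exists d.
  have l0 := csn_ge0 (l1 m) w.
  have lk : 0 < k / 2 / (l1 m w + 1) by rewrite divr_gt0 //; lra.
  have [s s0 hs] : exists2 s : R, 0 < s & forall i, s <= d i.
    exists (\big[Num.min/1]_i d i).
      by apply/bigmin_gtP; split=> // i _; have [] := hd i.
    by move=> i; apply: bigmin_le_cond.
  have [r r0 [rs rk]] := pos_below s0 lk; exists r => // x hx.
  rewrite DE; apply: (@le_trans _ _ (\sum_(i < m) k)).
    apply: ler_sum => i _.
    have h1 : hN (T i x) <= k / 2 by apply: (hd i).2; apply: lt_le_trans (lt_trans hx rs) (hs i).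
    have h2 : cmod (w 0 i) * hN x <= k / 2.
      have : hN x * (l1 m w + 1) < k / 2.
        by rewrite -ltr_pdivlMr ?(lt_trans hx) //; lra.
      by have := l1_entry w i; have := csn_ge0 hN x; nra.
    by have := csnD hN (T i x) (- (w 0 i *: x)); rewrite csnN csnZ; lra.
  rewrite sumr_const card_ord -[leLHS]mulr_natl /k mulrCA ler_piMr //; first exact: ltW.
  by rewrite ler_pdivrMr // mul1r; lra.
have R_complete (u : nat -> H) : (forall n, hNm (D (u n.+1) - D (u n)) <= 2 ^- n) ->
    exists x, forall n, hNm (D x - D (u n)) <= 2 * 2 ^- n.
  move=> hu.
  have /choice[y hy] : forall i, exists y : H, forall n, hN (y - D (u n) i) <= 2 * 1 * 2 ^- n.
    move=> i; apply: (hN_complete ltr01) => n; rewrite mul1r.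
    by have := hNm_entry (D (u n.+1) - D (u n)) i; rewrite !ffunE => h; apply: le_trans h _.
  have : closure (range (D_op T w)) (\row_i y i).
    move=> U /nbhs_ballP[e /= e0 hU].
    have ce : 0 < cmod e by rewrite cmod_gt0 gt_eqF.
    have [n hn] := half_pow_small (divr_gt0 ce (ltr0n R 2)).
    exists (D_op T w (u n)); split; first by exists (u n).
    apply: hU; split=> // i j; rewrite !mxE -ball_normE /= hnormE (cmod_norm (ltW e0)) ltcR.
    have := hy j n; rewrite ffunE -[hnorm _]/(hN _) => h; apply: le_lt_trans h _.
    by rewrite mulr1 mulrC -ltr_pdivlMr.
  rewrite -(closure_id _).1 // => -[x _ hx].
  have xy i : y i = D x i by have /rowP/(_ i) := hx; rewrite !mxE ffunE.
  exists x => n; apply/ler_addgt0Pr => e e0.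
  have tl := hN_tail ltr01 (u := fun n => D (u n)) (N := hNm).
  have m1 : 0 < 2 * (m%:R + 1) :> R by rewrite mulr_gt0 // ltr_wpDl.
  have [k hk] := half_pow_small (divr_gt0 e0 m1).
  have kn : 2 ^- (n + k) <= 2 ^- k :> R.
    by rewrite lef_pV2 ?posrE ?exprn_gt0 // ler_eXn2l ?leq_addl // ltr1n.
  have h1 : hNm (D (u (n + k)%N) - D (u n)) <= 2 * 2 ^- n.
    have hu1 j : hNm (D (u j.+1) - D (u j)) <= 1 * 2 ^- j by rewrite mul1r.
    by have := tl hu1 n k; rewrite mulr1.
  have h2 : hNm (D x - D (u (n + k)%N)) <= e.
    apply: (@le_trans _ _ (\sum_(i < m) 2 * 2 ^- k)).
      apply: ler_sum => i _; rewrite !ffunE; have := hy i (n + k)%N.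
      rewrite xy mulr1 !ffunE => h; apply: le_trans h _.
      by rewrite ler_pM2l.
    rewrite sumr_const card_ord -[leLHS]mulr_natl.
    move: hk; rewrite ltr_pdivlMr // => hk; apply: le_trans (ltW hk).
    have : 0 < 2 ^- k :> R by rewrite invr_gt0 exprn_gt0.
    by move: (2 ^- k) => a a0; lra.
  have := csnD hNm (D x - D (u (n + k)%N)) (D (u (n + k)%N) - D (u n)).
  rewrite addrA subrK; move: (2 * 2 ^- n) h1 => a; lra.
have [c c0 hc] := open_mapping D_lin P_def D_cont hN_complete R_complete.
exists c => // x t t0; rewrite -DE => hx; have [y hy Dy] := hc x t t0 hx.
by exists y => // i; have /ffunP/(_ i) := Dy; rewrite !ffunE.
Qed.

End Tuple.
End HilbertSpace.
Section ReproducingKernel.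
Context {R : realType} {m : nat} (H : hilbert R).
Notation C := R[i].
Notation V := 'rV[C]_m.
Notation B := (@unit_ball R m).
Notation "<< x , y >>" := (inner H x y) (at level 0).
Notation hN := (hN H).

(** This is where the hypothesis on the adjoint tuple enters.  The kernel function
    k_q, an eigenvector of the adjoint tuple for conj q, is nearly annihilated by
    the operator D at conj w when q is near w.  By the open mapping theorem it is
    within hN (k_q) / 4 of the kernel of this operator, which is spanned by k_w.
    The coefficient of k_w is controlled by the inner product of k_q and k_w, that
    is, by K(w, q), which is continuous in q. *)
Lemma kernel_diag_bounded (K : V -> V -> C) (ev : H -> V -> C)
    (M Mstar : 'I_m -> {linear H -> H}) :
  sesquiholomorphic B (scalar_kernel K) ->
  (forall w, B w -> 0 < K w w) ->
  is_rkhs B K ev -> coordinate_multiplication B ev M ->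
  adjoint_tuple M Mstar -> in_B1 B Mstar ->
  forall w, B w -> exists r C0 : R, 0 < r /\
    forall q, B q -> l1 m (q - w) < r -> complex.Re (K q q) <= C0.
Proof.
move=> [_ hK] K0 [_ _ rep] Mm adj [_ cM _ ker _] w Bw.
have /choice[k hk] : forall q, exists x : H, B q -> (forall z, B z -> ev x z = K z q) /\
    forall f : H, ev f q = << f, x >>.
  move=> q; have [Bq|nB] := pselect (B q); last by exists 0.
  by have [x h1 h2] := rep q Bq; exists x.
have kE z q : B z -> B q -> << k q, k z >> = K z q.
  by move=> Bz Bq; rewrite -(hk z Bz).2 (hk q Bq).1.
have eig q i : B q -> Mstar i (k q) = conjC (q 0 i) *: k q.
  move=> Bq; apply/eqP; rewrite -subr_eq0; apply/eqP; apply: hN_eq0.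
  have h x : << x, Mstar i (k q) - conjC (q 0 i) *: k q >> = 0.
    rewrite innerBr innerZr conjCK -adj -(hk q Bq).2 -(hk q Bq).2.
    by rewrite (Mm i).2 // subrr.
  have := h (Mstar i (k q) - conjC (q 0 i) *: k q); rewrite inner_sq.
  by move=> /complexI /eqP; rewrite expf_eq0 /= => /eqP.
have kn q : B q -> hN (k q) ^+ 2 = complex.Re (K q q).
  by move=> Bq; rewrite -(kE q q Bq Bq) inner_sq.
have kpos q : B q -> 0 < hN (k q).
  move=> Bq; rewrite lt_def csn_ge0 andbT; apply/eqP => h.
  have := K0 q Bq; rewrite ltcE => /andP[_ /=]; rewrite -(kn q Bq) h expr0n /=.
  by rewrite ltxx.
have Bcw : B (conjv w) by apply/unit_ball_conjv.
have [cl [e e0 kere]] := ker _ Bcw.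
have [c c0 hc] := D_op_open cM cl.
have [a ha] : exists a : C, k w = a *: e.
  have : ker_D Mstar (conjv w) (k w) by move=> i; rewrite eig // mxE.
  by rewrite kere => -[a _ <-]; exists a.
have a0 : a != 0.
  by apply: contraTneq (kpos w Bw) => a0; rewrite ha a0 scale0r csn0 ltxx.
(* the values K w q stay bounded for q near w *)
have [r1 [M1 [r10 hr1]]] : exists r M1 : R, 0 < r /\
    forall q, l1 m (q - w) < r -> cmod (K w q) <= M1.
  have /differentiable_continuous cK := hK w Bw w Bw.
  have /cvgrPdist_le /(_ 1 ltr01) /nbhs_ballP[d /= d0 hd] := cK.
  exists (cmod d), (cmod (K w w) + 1); split; first by rewrite cmod_gt0 gt_eqF.
  move=> q hq.
  have /hd : ball (w : V) d q.
    split=> // i j; rewrite ord1 -ball_normE /= cmodE (cmod_norm (ltW d0)) ltcR.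
    apply: le_lt_trans hq; rewrite cmodBC; have := l1_entry (q - w) j.
    by rewrite !mxE.
  rewrite /= (cmod_norm (normr_ge0 _)) -(rmorph1 (real_complex R)) lecR => h.
  have := le_trans (mx_entry_le _ 0 0) h; rewrite !mxE eqxx !mulr1n -rmorphB /=.
  rewrite -[conjC _]/((_)^*%C) cmodJ => h1.
  by have := cmod_dist (K w q) (K w w); rewrite cmodBC; lra.
have rc : 0 < (4 * c)^-1 by rewrite invr_gt0 mulr_gt0.
have [r r0 [rr1 rrc]] := pos_below r10 rc.
exists r, ((2 * M1 / hN (k w)) ^+ 2); split=> // q Bq hq.
rewrite -(kn q Bq) ler_sqr ?nnegrE ?csn_ge0 //; last first.
  by rewrite divr_ge0 ?csn_ge0 // mulr_ge0 //; apply: le_trans (cmod_ge0 (K w q)) (hr1 q (lt_trans hq rr1)).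
have t0 : 0 < r * hN (k q) by rewrite mulr_gt0 // kpos.
have [|y hy Dy] := hc (k q) _ t0.
  apply: (@le_trans _ _ (\sum_i cmod ((q - w) 0 i) * hN (k q))).
    by apply: ler_sum => i _; rewrite eig // !mxE -scalerBl csnZ -rmorphB /= cmodJ.
  by rewrite -mulr_suml ler_pM2r ?kpos //; apply: ltW.
have ysmall : hN y <= hN (k q) / 4.
  apply: le_trans hy _; rewrite mulrA [leRHS]mulrC ler_pM2r ?kpos //.
  have : r * (4 * c) < 1 by rewrite -ltr_pdivlMr ?mulr_gt0 // div1r.
  lra.
(* k q - y is in the one-dimensional kernel *)
have [b hb] : exists b : C, k q - y = b *: k w.
  have : ker_D Mstar (conjv w) (k q - y).
    move=> i; have /eqP := Dy i; rewrite linearB scalerBr subr_eq => /eqP ->.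
    by rewrite opprD opprB addrA; congr (_ - _); rewrite addrC subrK.
  rewrite kere => -[b _ hb]; exists (b / a).
  by rewrite ha scalerA mulfVK.
have W0 := kpos w Bw.
have i1 : cmod b * hN (k w) ^+ 2 <= M1 + hN y * hN (k w).
  have : b * (hN (k w) ^+ 2)%:C = K w q - << y, k w >>.
    by rewrite -inner_sq -innerZl -hb innerBl kE.
  move=> /(congr1 cmod); rewrite cmodM cmod_real ger0_norm ?sqr_ge0 // => ->.
  apply: le_trans (cmodB _ _) _; apply: lerD; first exact/hr1/(lt_trans hq).
  exact: inner_cauchy_schwarz.
have i2 : hN (k q) <= hN y + cmod b * hN (k w).
  by rewrite -csnZ -hb; apply: le_trans (csnD hN _ _); rewrite addrC subrK.
have i3 : cmod b * hN (k w) <= M1 / hN (k w) + hN y.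
  rewrite -(ler_pM2r W0) -mulrA -expr2 mulrDl mulfVK ?gt_eqF //.
lra.
Qed.

End ReproducingKernel.
(** * Operations on positive definite kernels *)

Section PositiveKernels.
Context {R : realType}.
Notation C := R[i].

(** Scalar kernels on an arbitrary set; matrix-valued kernels are the case where
    the points carry a matrix index. *)
Definition pdk (X : Type) (D : set X) (k : X -> X -> C) : Prop :=
  forall (I : finType) (u : I -> X) (c : I -> C), (forall p, D (u p)) ->
    0 <= \sum_p \sum_q k (u p) (u q) * c q * conjC (c p).

Lemma eq_pdk X (D : set X) (k k' : X -> X -> C) :
  (forall x y, D x -> D y -> k x y = k' x y) -> pdk D k' -> pdk D k.
Proof.
move=> kk' h I u c hu; have := h I u c hu; congr (_ <= _).
by apply: eq_bigr => p _; apply: eq_bigr => q _; rewrite kk'.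
Qed.

(** A finite combination of the values of a positive definite kernel, the same in
    both variables, amounts to repeating the points and weighting the
    coefficients. *)
Lemma pdk_combination X Y (J : finType) (D : set X) (D' : set Y)
    (k : Y -> Y -> C) (g : X -> J -> Y) (f : X -> J -> C) :
  pdk D' k -> (forall x a, D x -> D' (g x a)) ->
  pdk D (fun x y => \sum_a \sum_b k (g x a) (g y b) * f x a * conjC (f y b)).
Proof.
move=> hk hg I u c hu.
have := hk (I * J)%type (fun s => g (u s.1) s.2) (fun s => c s.1 * conjC (f (u s.1) s.2))
  (fun s => hg _ _ (hu s.1)).
congr (_ <= _).
rewrite -(pair_bigA _ (fun p a => \sum_s k (g (u p) a) (g (u s.1) s.2) *
  (c s.1 * conjC (f (u s.1) s.2)) * conjC (c p * conjC (f (u p) a)))) /=.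
apply: eq_bigr => p _.
under eq_bigr => a _ do rewrite -(pair_bigA _ (fun q b => k (g (u p) a) (g (u q) b) *
  (c q * conjC (f (u q) b)) * conjC (c p * conjC (f (u p) a)))) /=.
rewrite exchange_big; apply: eq_bigr => q _ /=.
rewrite !mulr_suml; apply: eq_bigr => a _; rewrite !mulr_suml; apply: eq_bigr => b _.
by rewrite rmorphM /= conjCK; ring.
Qed.

Lemma pdk_limit X (D : set X) (k : nat -> X -> X -> C) l :
  (forall n, pdk D (k n)) ->
  (forall x y, D x -> D y -> climit (fun n => k n x y) (l x y)) -> pdk D l.
Proof.
move=> hk hl I u c hu; apply: (@climit_ge0 _ (fun n =>
    \sum_p \sum_q k n (u p) (u q) * c q * conjC (c p))); last by move=> n; apply: hk.
apply: climit_sum => p; apply: climit_sum => q.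
rewrite -mulrA mulrC; under [X in climit X _]funext => n do rewrite -mulrA mulrC.
exact/climitMl/hl.
Qed.

Lemma pdkD X (D : set X) (k k' : X -> X -> C) : pdk D k -> pdk D k' ->
  pdk D (fun x y => k x y + k' x y).
Proof.
move=> h h' I u c hu; have := addr_ge0 (h I u c hu) (h' I u c hu); congr (_ <= _).
rewrite -big_split; apply: eq_bigr => p _; rewrite -big_split; apply: eq_bigr => q _ /=.
by rewrite -!mulrDl.
Qed.

Lemma pdkZ X (D : set X) (k : X -> X -> C) a : 0 <= a -> pdk D k ->
  pdk D (fun x y => a * k x y).
Proof.
move=> a0 h I u c hu; have := mulr_ge0 a0 (h I u c hu); congr (_ <= _).
rewrite mulr_sumr; apply: eq_bigr => p _; rewrite mulr_sumr; apply: eq_bigr => q _.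
by rewrite !mulrA.
Qed.

Lemma pdk1 X (D : set X) : pdk D (fun _ _ => 1).
Proof.
move=> I u c hu.
have -> : \sum_(p : I) \sum_(q : I) 1 * c q * conjC (c p) = (\sum_q c q) * conjC (\sum_q c q).
  rewrite rmorph_sum mulr_sumr; apply: eq_bigr => p _; rewrite mulr_suml.
  by apply: eq_bigr => q _; rewrite mul1r.
by rewrite -normCK exprn_ge0.
Qed.

Lemma pdk_rank1 X (D : set X) (f : X -> C) : pdk D (fun x y => f x * conjC (f y)).
Proof.
have := pdk_combination (D := D) (g := fun x _ => x) (fun x (_ : unit) => f x) (@pdk1 X D).
move=> /(_ (fun x _ Dx => Dx)); apply: eq_pdk => x y _ _.
by rewrite (bigD1 tt) //= (bigD1 tt) //= !big1 ?addr0 ?mul1r // => -[].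
Qed.

(** ** Schur's product theorem *)

Definition psd_mx n (A : 'M[C]_n) := forall c : 'I_n -> C,
  0 <= \sum_p \sum_q A p q * c q * conjC (c p).

(** The quadratic form on the span of two basis vectors, at (1, 1), (1, -1), (1, i)
    and (1, -i). *)
Lemma psd_mx_hermitian n (A : 'M[C]_n) p q : psd_mx A -> A q p = conjC (A p q).
Proof.
move=> hA; have two a b : 0 <= A p p * a * conjC a + A p q * b * conjC a
     + A q p * a * conjC b + A q q * b * conjC b.
  have := hA (fun r => a * (r == p)%:R + b * (r == q)%:R).
  have one (f : 'I_n -> C) : \sum_r f r * (a * (r == p)%:R + b * (r == q)%:R) =
      f p * a + f q * b.
    under eq_bigr => r _ do rewrite mulrDr 2!mulrA.
    rewrite big_split (bigD1 p) //= big1 ?addr0; last first.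
      by move=> r /negPf ->; rewrite mulr0.
    rewrite (bigD1 q) //= [X in _ + (_ + X)]big1 ?addr0; last first.
      by move=> r /negPf ->; rewrite mulr0.
    by rewrite !eqxx !mulr1.
  under eq_bigr => r _ do rewrite -mulr_suml one.
  have onec (f : 'I_n -> C) : \sum_r f r * conjC (a * (r == p)%:R + b * (r == q)%:R) =
      f p * conjC a + f q * conjC b.
    rewrite -[LHS]conjCK rmorph_sum; under eq_bigr => r _ do rewrite rmorphM /= conjCK.
    by rewrite (one (fun r => conjC (f r))) rmorphD !rmorphM /= !conjCK.
  by rewrite onec !mulrDl !addrA; congr (_ <= _); ring.
have := two 1 1; have := two 1 (-1); have := two 1 'i%C; have := two 1 (- 'i%C).
case: (A p q) => x1 x2; case: (A q p) => y1 y2.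
case: (A p p) => a1 a2; case: (A q q) => b1 b2.
rewrite !lecE /=; simpc.
move=> /andP[/eqP h1 h1'] /andP[/eqP h2 h2'] /andP[/eqP h3 h3'] /andP[/eqP h4 h4'].
by apply/eqP; rewrite eq_complex /=; apply/andP; split; apply/eqP; lra.
Qed.

(** Diagonalizing one factor in an orthonormal basis writes it as a sum of rank
    one matrices, and a product with a rank one matrix only changes the vector
    to which the other factor is applied. *)
Lemma psd_mx_schur n (A A' : 'M[C]_n) : psd_mx A -> psd_mx A' ->
  psd_mx (\matrix_(p, q) (A p q * A' p q)).
Proof.
move=> hA hA' c; set P := spectralmx A'; set d := spectral_diag A'.
have Pu : P \is unitarymx := spectral_unitarymx A'.
have nA' : A' \is normalmx.
  have -> : A' = map_mx conjC A'^T.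
    by apply/matrixP => p q; rewrite !mxE (psd_mx_hermitian q p hA').
  by apply/normalmxP; rewrite map_trmx; congr (_ *m _); apply/matrixP => p q;
     rewrite !mxE conjCK (psd_mx_hermitian q p hA').
have A'E p q : A' p q = \sum_r d 0 r * (conjC (P r p) * P r q).
  rewrite (orthomx_spectralP nA') (invmx_unitary Pu) !mxE; apply: eq_bigr => r _.
  rewrite mul_mx_diag !mxE -/d -/P; ring.
have dE r : d 0 r = \sum_p \sum_q A' p q * conjC (P r q) * conjC (conjC (P r p)).
  have : diag_mx d = P *m A' *m map_mx conjC P^T.
    rewrite [in RHS](orthomx_spectralP nA') (invmx_unitary Pu) -/P -/d.
    by rewrite !mulmxA (unitarymxP Pu) mul1mx -mulmxA (unitarymxP Pu) mulmx1.
  move=> /(congr1 (fun M : 'M[C]_n => M r r)); rewrite !mxE eqxx mulr1n => ->.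
  rewrite exchange_big; apply: eq_bigr => q _; rewrite !mxE mulr_suml.
  by apply: eq_bigr => p _; rewrite conjCK; ring.
have -> : \sum_p \sum_q (\matrix_(p, q) (A p q * A' p q)) p q * c q * conjC (c p) =
    \sum_r d 0 r * \sum_p \sum_q A p q * (P r q * c q) * conjC (P r p * c p).
  under [RHS]eq_bigr => r _ do rewrite mulr_sumr.
  rewrite [RHS]exchange_big; apply: eq_bigr => p _ /=.
  under [RHS]eq_bigr => r _ do rewrite mulr_sumr.
  rewrite [RHS]exchange_big; apply: eq_bigr => q _ /=.
  rewrite mxE A'E mulr_sumr !mulr_suml; apply: eq_bigr => r _.
  by rewrite rmorphM; ring.
apply: sumr_ge0 => r _; apply: mulr_ge0; last exact: hA.
by rewrite dE; apply: hA'.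
Qed.

Lemma pdkM X (D : set X) (k k' : X -> X -> C) : pdk D k -> pdk D k' ->
  pdk D (fun x y => k x y * k' x y).
Proof.
move=> hk hk' I u c hu.
pose mx (k : X -> X -> C) := \matrix_(p, q) k (u (@enum_val I I p)) (u (@enum_val I I q)).
have psd k0 : pdk D k0 -> psd_mx (mx k0).
  move=> h0 b; have := h0 _ (fun p => u (@enum_val I I p)) b (fun p => hu _).
  by congr (_ <= _); apply: eq_bigr => p _; apply: eq_bigr => q _; rewrite mxE.
have := psd_mx_schur (psd _ hk) (psd _ hk') (fun p => c (enum_val p)).
have reI (F : I -> C) : \sum_p F p = \sum_p F (@enum_val I I p).
  by rewrite -(big_enum_val F); apply: eq_bigl.
congr (_ <= _); rewrite [RHS]reI; apply: eq_bigr => p _; rewrite [RHS]reI.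
by apply: eq_bigr => q _; rewrite !mxE.
Qed.

Lemma pdkX X (D : set X) (k : X -> X -> C) n : pdk D k -> pdk D (fun x y => k x y ^+ n).
Proof.
move=> hk; elim: n => [|n IH].
  by apply: (@eq_pdk _ _ _ (fun _ _ => 1)); [move=> *; rewrite expr0|exact: pdk1].
by apply: (@eq_pdk _ _ _ (fun x y => k x y * k x y ^+ n)); [move=> *; rewrite exprS|exact: pdkM].
Qed.

End PositiveKernels.
(** * Mixed derivatives of positive definite kernels *)

Section KernelDerivative.
Context {R : realType} {m : nat}.
Notation C := R[i].
Notation V := 'rV[C]_m.
Notation B := (@unit_ball R m).
Notation BB := (@BB R m).
Notation nVV := (@nVV R m).

Lemma pos_form_pdk n (G : V -> V -> 'M[C]_n) : pos_form G <->
  pdk [set x : V * 'I_n | B x.1] (fun x y => G x.1 y.1 x.2 y.2).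
Proof.
split=> [hG I u c hu|hG l u c hu]; last first.
  have := hG ('I_l * 'I_n)%type (fun s => (u s.1, s.2)) (fun s => c s.1 s.2) (fun s => hu _).
  congr (_ <= _); rewrite -(pair_bigA _ (fun p i => \sum_s G (u p) (u s.1) i s.2 *
    c s.1 s.2 * conjC (c p i))) /=.
  apply: eq_bigr => p _; rewrite exchange_big /=.
  rewrite -(pair_bigA _ (fun q j => \sum_i G (u p) (u q) i j * c q j * conjC (c p i))) /=.
  by apply: eq_bigr => q _; rewrite exchange_big.
have reI (F : I -> C) : \sum_p F p = \sum_p F (@enum_val I I p).
  by rewrite -(big_enum_val F); apply: eq_bigl.
have := hG _ (fun p => (u (@enum_val I I p)).1)
  (fun p i => c (enum_val p) * (i == (u (@enum_val I I p)).2)%:R) (fun p => hu _).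
congr (_ <= _); rewrite [RHS]reI; apply: eq_bigr => p _; rewrite [RHS]reI.
apply: eq_bigr => q _.
rewrite (bigD1 (u (enum_val p)).2) //= [X in _ + X]big1 ?addr0; last first.
  by move=> i /negPf ->; apply: big1 => j _; rewrite mulr0 rmorph0 mulr0.
rewrite (bigD1 (u (enum_val q)).2) //= [X in _ + X]big1 ?addr0; last first.
  by move=> i /negPf ->; rewrite !mulr0 mul0r.
by rewrite !eqxx !mulr1.
Qed.

(** The second difference over a small square approximates the mixed derivative to
    third order: the remainder of the first difference is a small holomorphic
    function, hence Lipschitz with a small constant.  The estimate is uniform in
    the base point and in the two directions. *)
Lemma second_difference (E : lmodType C) (N : cseminorm E) Om (f : E -> C) p :
  holo N Om f -> Om p -> exists r k : R, 0 < r /\ forall q u v (h : R),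
    N (q - p) < r -> N u <= 1 -> N v <= 1 -> 0 < h -> h < r -> Om q /\
    cmod (f (q + h%:C *: u + h%:C *: v) - f (q + h%:C *: u) - f (q + h%:C *: v) + f q
          - (h ^+ 2)%:C * dirD u (dirD v f) q) <= k * h ^+ 3.
Proof.
move=> hf hp; have [r [M [r0 M0 hr]]] := holo_est hf hp.
exists (r / 16), (4 * M / (r / 4) + 8 * M / (r / 2) ^+ 2); split; first by lra.
move=> q u v h hq u1 v1 h0 hlt; have hg := holo_dirD v hf.
have Nh w : N w <= 1 -> N (h%:C *: w) <= h.
  by move=> w1; rewrite csnZr gtr0_norm // ler_piMr // ltW.
have near_q x (s : R) : N (x - q) < s -> N (x - p) < s + r / 16.
  by move=> hx; have := csnD N (x - q) (q - p); rewrite addrA subrK; lra.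
have small : h <= r by lra.
have [Oq _ _] := hr q ltac:(lra); split=> //.
pose phi x := f (x + h%:C *: v) - f x - h%:C * dirD v f x.
have hphi : holo N [set x | N (x - q) < r / 4] phi.
  have op (k : R) : is_open N [set x | N (x - q) < k].
    move=> x hx; exists (k - N (x - q)); first by move: hx => /=; lra.
    by move=> y hy; rewrite /=; have := csnD N (y - x) (x - q); rewrite addrA subrK; lra.
  have sub : [set x | N (x - q) < r / 4] `<=` Om.
    by move=> x /= /near_q hx; have [|//] := hr x; lra.
  apply: holoB; last exact/holoZ/(holo_subset _ sub)/hg.
  apply: holoB; last exact/(holo_subset _ sub).
  have := @holo_affine _ _ _ N N (fun x => x + h%:C *: v) id 1 Om f ler01 _ _ hf.
  move=> h1; apply: holo_subset (h1 _ _) => // [x /= /near_q hx|x z w|w].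
  - have [|//] := hr (x + h%:C *: v).
    by have := csn_near hx (Nh v v1); lra.
  - by rewrite addrAC.
  - by rewrite mul1r.
have phiM x : N (x - q) < r / 4 -> [set x | N (x - q) < r / 4] x /\ cmod (phi x) <= M * h ^+ 2.
  move=> hx; split=> //; have [|Ox _ hd] := hr x; first by have := near_q _ _ hx; lra.
  have [_ /(_ small)] := hd _ _ (Nh v v1) h0.
  by rewrite (dirDZ _ _ hf Ox).
have := holo_lipschitz hphi (_ : 0 < r / 4) phiM (Nh u u1) h0.
move=> /(_ ltac:(lra) ltac:(lra)); rewrite /phi => e1.
have gM x : N (x - q) < r / 2 -> Om x /\ cmod (dirD v f x) <= M.
  move=> hx; have [|Ox _ hd] := hr x; first by have := near_q _ _ hx; lra.
  by split=> //; have [] := hd v 1 v1 ltr01; rewrite mulr1.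
have r20 : 0 < r / 2 by lra.
have [_ /(_ ltac:(lra))] := holo_cauchy hg r20 gM (Nh u u1) h0.
rewrite (dirDZ _ _ hg Oq) => e2.
have := cmodD (f (q + h%:C *: u + h%:C *: v) - f (q + h%:C *: u) - h%:C * dirD v f (q + h%:C *: u)
   - (f (q + h%:C *: v) - f q - h%:C * dirD v f q))
  (h%:C * (dirD v f (q + h%:C *: u) - dirD v f q - h%:C * dirD u (dirD v f) q)).
rewrite cmodM cmod_real gtr0_norm // => e3.
have e4 : h * cmod (dirD v f (q + h%:C *: u) - dirD v f q - h%:C * dirD u (dirD v f) q)
    <= h * (8 * M / (r / 2) ^+ 2 * h ^+ 2) by rewrite ler_pM2l.
have := le_trans e3 (lerD e1 e4); congr (_ <= _).
  congr cmod; rewrite rmorphXn /=.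
  move: (dirD v f _) (dirD v f _) (dirD u _ _) => a b c.
  move: (f _) (f _) (f _) (f _) => a1 a2 a3 a4; ring.
field; lra.
Qed.

(** Differentiating a scalar kernel once in each variable gives a matrix-valued
    kernel, the limit of combinations of the scalar one over the pairs of points
    w, w + h e_i. *)
Lemma pdk_derivative (F : V * V -> C) : holo nVV BB F ->
  pdk B (fun z w => F (z, conjv w)) ->
  pdk [set x : V * 'I_m | B x.1]
    (fun x y => dirD (dz x.2) (dirD (dw y.2) F) (x.1, conjv y.1)).
Proof.
move=> hF pF; have [h h0 hsmall] : exists2 h : nat -> R, (forall n, 0 < h n) &
    forall e : R, 0 < e -> exists N, forall n, (N <= n)%N -> h n < e.
  exists (fun n => n.+1%:R^-1) => [n|e e0]; first by rewrite invr_gt0 ltr0n.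
  have e2 : 0 < e / 2 by lra.
  have [N hN] := harmonic_small 1 e2; exists N => n /hN; rewrite mul1r.
  by move=> h; apply: le_lt_trans h _; lra.
(* where w + h e_i leaves the ball, the combination is replaced by 0 *)
pose e n (x : V * 'I_m) (b : bool) := if b then x.1 + (h n)%:C *: delta_mx 0 x.2 else x.1.
pose ok n (x : V * 'I_m) := `[< B (e n x true) >].
pose g n x b := if ok n x then e n x b else x.1.
pose f n x (b : bool) : C := if ok n x then ((-1) ^+ b / h n)%:C else 0.
apply: (@pdk_limit _ _ _ (fun n x y => \sum_a \sum_b F (g n x a, conjv (g n y b)) *
    f n x a * conjC (f n y b))).
  move=> n; apply: (pdk_combination (f n) pF).
  by move=> x b Bx; rewrite /g /ok; case: asboolP => // Bt; case: b.
move=> [z i] [w j] /= Bz Bw eps eps0.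
have hp : BB (z, conjv w) by split=> //; apply/unit_ball_conjv.
have [r [k [r0 hk]]] := second_difference hF hp.
have [rz rz0 hrz] := unit_ball_open Bz; have [rw rw0 hrw] := unit_ball_open Bw.
have [s1 s10 [s1z s1w]] := pos_below rz0 rw0.
have k0 : 0 < eps / (`|k| + 1) by rewrite divr_gt0 // ltr_wpDl.
have [s2 s20 [s2r s2k]] := pos_below r0 k0.
have [s s0 [ss1 ss2]] := pos_below s10 s20.
have [N hN] := hsmall s s0; exists N => n /hN hn.
have Nd i' : l1 m (delta_mx 0 i') = 1.
  rewrite /= /l1norm (bigD1 i') //= big1 ?addr0 => [|j' /negPf ne]; rewrite !mxE.
    by rewrite !eqxx cmod1.
  by rewrite ne andbF cmod0.
have Ni (a : V) i' : l1 m (a + (h n)%:C *: delta_mx 0 i' - a) <= h n.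
  by rewrite addrAC subrr add0r csnZr gtr0_norm // Nd mulr1.
have okz : ok n (z, i) by apply/asboolP/hrz; apply: le_lt_trans (Ni _ _) _; lra.
have okw : ok n (w, j) by apply/asboolP/hrw; apply: le_lt_trans (Ni _ _) _; lra.
rewrite big_bool /= !big_bool /g /f okz okw /e /=.
have hc : (h n)%:C != 0 :> C by rewrite -cmod_gt0 cmod_real gtr0_norm.
have cj : conjC (h n)%:C = (h n)%:C :> C := conjc_real _.
have cf (t : R) : conjC t%:C = t%:C :> C := conjc_real _.
have hi b : ((-1) ^+ b / h n)%:C = (-1) ^+ b / (h n)%:C :> C.
  by rewrite rmorphM /= rmorphXn /= rmorphN1 fmorphV.
rewrite !cf !hi expr0 expr1.
have Nz : nVV (dz i) <= 1 by rewrite nVVE Nd csn0 addr0.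
have Nw : nVV (dw j) <= 1 by rewrite nVVE Nd csn0 add0r.
have := hk (z, conjv w) (dz i) (dw j) (h n) ltac:(by rewrite subrr csn0) Nz Nw (h0 n) ltac:(lra).
move=> [_].
have -> : (z, conjv w) + (h n)%:C *: dz i + (h n)%:C *: dw j =
    (z + (h n)%:C *: delta_mx 0 i, conjv (w + (h n)%:C *: delta_mx 0 j)).
  apply/pair_equal_spec; rewrite conjvD conjvZ cj conjv_delta /=.
  by rewrite !scaler0 !addr0.
have -> : (z, conjv w) + (h n)%:C *: dz i = (z + (h n)%:C *: delta_mx 0 i, conjv w).
  by apply/pair_equal_spec; rewrite /= !scaler0 !addr0.
have -> : (z, conjv w) + (h n)%:C *: dw j = (z, conjv (w + (h n)%:C *: delta_mx 0 j)).
  by apply/pair_equal_spec; rewrite conjvD conjvZ cj conjv_delta /= !scaler0 !addr0.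
set zi : V := z + _; set wj : V := w + _.
move: (F (zi, conjv wj)) (F (zi, conjv w)) (F (z, conjv wj)) (F (z, conjv w)) => a1 a2 a3 a4.
move: (dirD _ _ _) => d.
have h20 : 0 < h n ^+ 2 by rewrite exprn_gt0.
move=> hX; rewrite -(ler_pM2r h20); apply: (@le_trans _ _ (k * h n ^+ 3)).
  apply: le_trans hX; apply: eq_leW.
  rewrite -[X in _ * X](gtr0_norm h20) -cmod_real -cmodM; congr cmod.
  by rewrite rmorphXn /=; move: hc; move: (h n)%:C => c c0; field.
rewrite [_ ^+ 3]exprS mulrA; apply: ler_wpM2r; first exact: ltW.
have h1 : h n * (`|k| + 1) < eps.
  by rewrite -ltr_pdivlMr ?ltr_wpDl //; lra.
have := h0 n; have := ler_norm k; nra.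
Qed.

End KernelDerivative.
(** * Infinite divisibility implies positivity of the mixed derivatives *)

Section Divisible.
Context {R : realType} {m : nat}.
Notation C := R[i].
Notation V := 'rV[C]_m.
Notation B := (@unit_ball R m).
Notation BB := (@BB R m).
Notation nVV := (@nVV R m).

Lemma pos_def_function_intro n (G : V -> V -> 'M[C]_n) g :
  (forall i j, holo nVV BB (sharp (fun z w => G z w i j))) ->
  pdk [set x : V * 'I_n | B x.1] (fun x y => G x.1 y.1 x.2 y.2) ->
  (forall w, B w -> G w w = g w) -> pos_def_function B g.
Proof.
move=> hG pG Gg; have sG := holo_sesqui hG.
by exists G => //; apply/pos_formP; split=> //; apply/pos_form_pdk.
Qed.

Variable L : V -> V -> C.
Hypothesis L_holo : holo nVV BB (sharp L).
Hypothesis L_gt0 : forall w, B w -> 0 < L w w.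
Notation F := (sharp L).

Lemma diag_gt0 w : B w -> 0 < complex.Re (L w w).
Proof. by move=> /L_gt0; rewrite ltcE => /andP[]. Qed.

Lemma diagE w : B w -> L w w = (complex.Re (L w w))%:C.
Proof.
by move=> /L_gt0; case: (L w w) => a b; rewrite ltcE /= => /andP[/eqP -> _].
Qed.

Lemma diag_bounded w : B w -> exists r M : R, 0 < r /\
  forall q, l1 m (q - w) < r -> B q /\ complex.Re (L q q) <= M.
Proof.
move=> Bw; have [[r [M [r0 hr]]] _] := L_holo (iffRL (BB_diag w) Bw).
exists (r / 2), M; split=> [|q hq]; first by lra.
have [|/BB_diag Bq Fq] := hr (q, conjv q).
  have -> : (q, conjv q) - (w, conjv w) = (q - w, conjv (q - w)).
    by apply/pair_equal_spec; rewrite conjvB.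
  by rewrite nVVE l1_conjv; lra.
by split=> //; move: Fq; rewrite sharp_diag; have := cmod_Re (L q q); rewrite ler_norml; lra.
Qed.

(** The bound uses that x^(1/(n+1)) is at most 1 or at most its own power x. *)
Lemma powR_root (x : R) n : 0 < x ->
  (x `^ n.+1%:R^-1) ^+ n.+1 = x /\ x `^ n.+1%:R^-1 <= 1 + x.
Proof.
move=> x0; have y0 : 0 <= x `^ n.+1%:R^-1 by apply: powR_ge0.
have yn : (x `^ n.+1%:R^-1) ^+ n.+1 = x.
  by rewrite -powR_mulrn // -powRrM mulVf ?pnatr_eq0 // powRr1 ?ltW.
split=> //; have [y1|y1] := leP (x `^ n.+1%:R^-1) 1; first by lra.
apply: (@le_trans _ _ x); last by lra.
by rewrite -{2}yn ler_eXnr // ltW.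
Qed.

Hypothesis L_div : forall t : R, 0 < t -> pos_def_function B
  (scalar_fun (fun w => (complex.Re (L w w) `^ t)%:C)).

(** The polarized root of order n + 1.  Positivity bounds it by the diagonal,
    uniformly in n. *)
Lemma polarized_root n : exists p : V * V -> C,
  [/\ holo nVV BB p, pdk B (fun z w => p (z, conjv w)),
      forall q, BB q -> p q ^+ n.+1 = F q,
      forall w, B w -> p (w, conjv w) = (complex.Re (L w w) `^ n.+1%:R^-1)%:C &
      forall z w, B z -> B w ->
        cmod (p (z, w)) <= 2 + complex.Re (L z z) + complex.Re (L (conjv w) (conjv w))].
Proof.
have t0 : 0 < n.+1%:R^-1 :> R by rewrite invr_gt0 ltr0n.
have [G [_ Gd] pG] := L_div t0; have /pos_formP[_ fG] := pG.
pose k z w := G z w 0 0.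
have kd w : B w -> k w w = (complex.Re (L w w) `^ n.+1%:R^-1)%:C.
  by move=> /Gd; rewrite /k /scalar_fun => ->; rewrite mxE eqxx mulr1n.
have kb w : B w -> complex.Re (k w w) <= 1 + complex.Re (L w w).
  by move=> Bw; rewrite kd //=; apply: (powR_root n (diag_gt0 Bw)).2.
have hk : holo nVV BB (sharp k).
  apply: (pos_def_holo 0 0 pG) => i w Bw; rewrite (ord1 i).
  have [r [M [r0 hr]]] := diag_bounded Bw; exists r, (1 + M); split=> // q Bq hq.
  by apply: le_trans (kb q Bq) _; have [_] := hr q hq; lra.
exists (sharp k); split=> //.
- move=> I u c hu; have := iffLR (pos_form_pdk _) fG I (fun p => (u p, ord0)) c hu.
  congr (_ <= _); apply: eq_bigr => p _; apply: eq_bigr => q _ /=.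
  by rewrite /sharp /= conjvK.
- move=> q; apply: (polarization_unique (holoX n.+1 hk) L_holo) => w Bw.
  rewrite !sharp_diag kd // diagE //= -[in RHS](powR_root n (diag_gt0 Bw)).1.
  by rewrite rmorphXn.
- by move=> w Bw; rewrite sharp_diag kd.
move=> z w Bz Bw; have Bw' : B (conjv w) by apply/unit_ball_conjv.
have [_] := pos_form_entry 0 0 fG Bz Bw'.
by have := kb z Bz; have := kb _ Bw'; rewrite /sharp /k /=; lra.
Qed.

(** At a zero of F all roots would vanish; being uniformly bounded they would be
    uniformly small nearby, and F, an arbitrarily high power of them, would
    vanish there. *)
Lemma divisible_neq0 q : BB q -> F q != 0.
Proof.
move=> hq; apply/eqP => Fq; case: q hq Fq => z w [/= Bz Bw] Fq.
have Bw' : B (conjv w) by apply/unit_ball_conjv.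
have [r1 [M1 [r10 h1]]] := diag_bounded Bz.
have [r2 [M2 [r20 h2]]] := diag_bounded Bw'.
have [r r0 [rr1 rr2]] := pos_below r10 r20.
pose M := 2 + M1 + M2.
have hb (x : V * V) : nVV (x - (z, w)) < r -> BB x /\ 2 + complex.Re (L x.1 x.1) +
    complex.Re (L (conjv x.2) (conjv x.2)) <= M.
  case: x => a b; have -> : (a, b) - (z, w) = (a - z, b - w) by [].
  rewrite nVVE => hx; have := csn_ge0 (l1 m) (a - z); have := csn_ge0 (l1 m) (b - w).
  move=> i1 i2; have [|Ba La] := h1 a; first by lra.
  have [|Bb Lb] := h2 (conjv b); first by rewrite -conjvB l1_conjv; lra.
  by split; [split=> //; apply/unit_ball_conjv|rewrite /M /=; lra].
have M0 : 0 < M.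
  have [|_] := hb (z, w); first by rewrite subrr csn0.
  by apply: lt_le_trans; have := diag_gt0 Bz; have := diag_gt0 Bw' => /=; lra.
have k0 : 0 < r / (8 * M) by rewrite divr_gt0 // mulr_gt0.
have r4 : 0 < r / 4 by lra.
have [t t0 [t1 t2]] := pos_below r4 k0.
have Mt : 4 * M / r * t <= 1 / 2.
  move: t2; rewrite ltr_pdivlMr ?mulr_gt0 // => t2.
  by rewrite mulrAC ler_pdivrMr //; lra.
have small v : nVV v <= t -> forall n, cmod (F ((z, w) + v)) <= 2 ^- n.
  move=> hv n; have [p [hp _ pn _ pb]] := polarized_root n.
  have inB : BB ((z, w) + v).
    by apply: (hb _ _).1; rewrite addrAC subrr add0r; lra.
  have pM x : nVV (x - (z, w)) < r -> BB x /\ cmod (p x) <= M.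
    move=> /hb[Bx xM]; split=> //; apply: le_trans xM.
    by case: (x) Bx => a b [Ba Bb]; apply: pb.
  have := holo_lipschitz hp r0 pM hv t0; move=> /(_ ltac:(lra)) hl.
  have pz : p (z, w) = 0.
    by have := pn (z, w) (conj Bz Bw); rewrite Fq => /eqP; rewrite expf_eq0 /= => /eqP.
  rewrite -(pn _ inB) cmodX; apply: (@le_trans _ _ ((1 / 2) ^+ n.+1)).
    by rewrite ler_pXn2r ?nnegrE ?cmod_ge0 //; move: hl; rewrite pz subr0; lra.
  have : 0 <= 2 ^- n :> R by rewrite invr_ge0 exprn_ge0.
  by rewrite mul1r exprS exprVn; move: (2 ^- n) => a a0; lra.
have Fsmall v : nVV v <= t -> F ((z, w) + v) = 0.
  move=> hv; apply: cmod_small => e /half_pow_small[n hn].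
  by apply: le_trans (small v hv n) _; apply: ltW.
have : F ((z, w) + - (z, w)) = 0.
  apply: (holo_identity L_holo) => [s hs|].
    have -> : - (z, w) = (0, 0) - (z, w) :> V * V by rewrite sub0r.
    by apply: BB_convex => //; split; apply: unit_ball0.
  have N0 := csn_ge0 nVV (- (z, w)).
  exists (t / (nVV (- (z, w)) + 1)) => [|x]; first by rewrite divr_gt0 //; lra.
  rewrite ltr_pdivlMr; last by lra.
  by move=> hx; apply: Fsmall; rewrite csnZ; have := cmod_ge0 x; lra.
rewrite subrr => F0; have := L_gt0 unit_ball0.
have := sharp_diag L 0; have -> : (0, conjv 0) = 0 :> V * V.
  by apply/pair_equal_spec; split=> //; apply/rowP => i; rewrite !mxE rmorph0.
by rewrite F0 => <-; rewrite ltxx.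
Qed.

Lemma dirD_power (p : V * V -> C) n v q : holo nVV BB p -> BB q ->
  dirD v (fun x => p x ^+ n) q * p q = n%:R * p q ^+ n * dirD v p q.
Proof.
move=> hp hq; elim: n => [|n IH].
  by rewrite (eq_dirD v (@BB_open R m) (g := fun=> 1)) // dirD_cst !mul0r.
rewrite (eq_dirD v (@BB_open R m) (g := fun x => p x * p x ^+ n)) //; last first.
  by move=> x _; rewrite exprS.
rewrite (dirDM v hp (holoX n hp) hq) mulrDl -(mulrA (p q)) IH -natr1 exprS; ring.
Qed.

(** (n + 1) times the mixed derivative of the root of order n + 1 tends to the
    mixed derivative of log F, because the roots tend to 1. *)
Lemma divisible_ddbar : pos_def_function B (ddbar_log L).
Proof.
have F0 := divisible_neq0.
have cn n (x : C) : cmod (x * n.+1%:R^-1) = cmod x * n.+1%:R^-1.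
  by rewrite cmodM cmodV cmod_nat.
have /choice[p hp] := polarized_root.
have p_holo n : holo nVV BB (p n) by case: (hp n).
have D1 n v q : BB q -> dirD v (p n) q = p n q * (dirD v F q * (F q)^-1 * n.+1%:R^-1).
  move=> hq; have [_ _ pn _ _] := hp n; have := F0 q hq; rewrite -(pn q hq) => p0.
  have p0' : p n q != 0 by apply: contraNneq p0 => ->; rewrite expr0n.
  have := dirD_power n.+1 v (p_holo n) hq.
  rewrite (eq_dirD v (@BB_open R m) (g := F)) // => e.
  have n0 : n.+1%:R != 0 :> C by rewrite pnatr_eq0.
  apply: (mulfI (mulf_neq0 n0 p0)); rewrite -e.
  move: (dirD v F q) p0 p0' n0; move: (p n q) (n.+1%:R : C) => a b d a0 a0' b0; field.
  by rewrite b0 a0.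
have D2 n i j q : BB q -> n.+1%:R * dirD (dz i) (dirD (dw j) (p n)) q =
    p n q * (ddlog F i j q + dirD (dz i) F q * dirD (dw j) F q / F q ^+ 2 * n.+1%:R^-1).
  move=> hq; have hj := holo_dirD (dw j) L_holo; have hV := holoV L_holo F0.
  rewrite (eq_dirD _ (@BB_open R m) (fun q hq => D1 n (dw j) q hq)) //.
  have hc := holo_cst (n.+1%:R^-1 : C) (@BB_open R m).
  rewrite (dirDM _ (p_holo n) (holoM (holoM hj hV) hc) hq) D1 //.
  rewrite (dirDM _ (holoM hj hV) hc hq) dirD_cst (dirDM _ hj hV hq) (dirDV _ L_holo hq (F0 q hq)).
  rewrite /ddlog; have n0 : n.+1%:R != 0 :> C by rewrite pnatr_eq0.
  have := F0 q hq; move: (dirD (dz i) (dirD (dw j) F) q) (dirD (dw j) F q) (dirD (dz i) F q).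
  move: n0; move: (F q) (p n q) (n.+1%:R : C) => a b c c0 d1 d2 d3 a0; field.
  by rewrite c0 a0.
have p0_lim : climit (fun n => p n (0, conjv 0)) 1.
  move=> e e0; have [r r0 hr] := cdiff_cont (cdiff_cexp (0 : C)) e0.
  have r2 : 0 < r / 2 by lra.
  have [N hN] := harmonic_small `|ln (complex.Re (L 0 0))| r2.
  exists N => n /hN hn; have [_ _ _ pd _] := hp n.
  rewrite (pd _ unit_ball0) /powR (gt_eqF (diag_gt0 unit_ball0)) -cexp_real -cexp0.
  have := hr ((n.+1%:R^-1 * ln (complex.Re (L 0 0)))%:C).
  have ni : `|n.+1%:R^-1| = n.+1%:R^-1 :> R by rewrite ger0_norm // invr_ge0 ler0n.
  by rewrite add0r; apply; rewrite cmod_real normrM ni mulrC; apply: le_lt_trans hn _; lra.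
have BB0 : BB (0, conjv 0) by apply/BB_diag/unit_ball0.
have e0 : (0, conjv 0) = 0 :> V * V.
  by apply/pair_equal_spec; split=> //; apply/rowP => i; rewrite !mxE rmorph0.
have seg q (t : R) : BB q -> 0 <= t <= 1 -> BB (0 + t%:C *: q).
  by move=> hq ht; have := BB_convex BB0 hq ht; rewrite e0 subr0.
have p_bound q : BB q -> exists2 M : R, 0 <= M & forall n t, 0 <= t <= 1 ->
    cmod (p n (0 + t%:C *: q)) <= M.
  move=> [Bz Bw]; have Bw' : B (conjv q.2) by apply/unit_ball_conjv.
  have tube (a : V) : B a -> exists2 M : R, 0 <= M & forall t, 0 <= t <= 1 ->
      complex.Re (L (t%:C *: a) (t%:C *: a)) <= M.
    move=> Ba; have hd : BB (a, conjv a) by apply/BB_diag.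
    have [r [M [r0 M0 hr]]] := holo_tube L_holo (fun t ht => seg _ t hd ht).
    exists M => // t ht; have [|_] := hr t (0 + t%:C *: (a, conjv a)) ht.
      by rewrite subrr csn0.
    have -> : 0 + t%:C *: (a, conjv a) = (t%:C *: a, conjv (t%:C *: a)).
      have cj : conjC t%:C = t%:C :> C := conjc_real _.
      by apply/pair_equal_spec; rewrite /= !add0r conjvZ cj.
    rewrite sharp_diag => hM; have := le_trans (cmod_Re _) hM; rewrite ler_norml; lra.
  have [M1 M10 h1] := tube _ Bz; have [M2 M20 h2] := tube _ Bw'.
  exists (2 + M1 + M2) => [|n t ht]; first by lra.
  have [_ _ _ _ pb] := hp n; have cj : conjC t%:C = t%:C :> C := conjc_real _.
  rewrite add0r; have := pb (t%:C *: q.1) (t%:C *: q.2) (unit_ballZ Bz ht) (unit_ballZ Bw ht).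
  by rewrite conjvZ cj; have := h1 t ht; have := h2 t ht; lra.
have p_lim q : BB q -> climit (fun n => p n q) 1.
  move=> hq e e_gt0; have [M M0 hM] := p_bound q hq.
  have hg := holoM (holo_dirD q L_holo) (holoV L_holo F0).
  have [r [M' [r0 M'0 hr]]] := holo_tube hg (fun t ht => seg _ t hq ht).
  have e2 : 0 < e / 2 by lra.
  have [N hN] := harmonic_small (M * M') e2; have [N' hN'] := p0_lim _ e2.
  exists (maxn N N') => n; rewrite geq_max => /andP[/hN h1 /hN'].
  have k0 : 0 <= M * M' * n.+1%:R^-1 by rewrite !mulr_ge0 // invr_ge0 ler0n.
  have := holo_mean_value (p_holo n) k0 (fun t ht => seg _ t hq ht).
  rewrite e0 add0r; move=> h2 h3.
  apply: le_trans (cmod_tri (p n 0) _ _) _; rewrite (splitr e); apply: lerD h3.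
  apply: le_trans h1.
  apply: h2 => t ht; rewrite (D1 _ _ _ (seg _ t hq ht)) mulrA cn cmodM.
  apply: ler_wpM2r; first by rewrite invr_ge0 ler0n.
  apply: ler_pM; rewrite ?cmod_ge0 ?hM //.
  by apply: (hr t _ ht _).2; rewrite subrr csn0.
apply: (@pos_def_function_intro _ (fun z w => \matrix_(i, j) ddlog F i j (z, conjv w))).
- move=> i j; apply: eq_holo (ddlog_holo i j L_holo F0) => q _.
  by rewrite /sharp mxE conjvK -surjective_pairing.
- apply: (@pdk_limit _ _ _ (fun n (x y : V * 'I_m) =>
      n.+1%:R * dirD (dz x.2) (dirD (dw y.2) (p n)) (x.1, conjv y.1))).
    move=> n; apply: pdkZ; first exact: ler0n.
    by have [? ? _ _ _] := hp n; apply: pdk_derivative.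
  move=> [z i] [w j] /= Bz Bw; have hq : BB (z, conjv w) by split=> //; apply/unit_ball_conjv.
  rewrite mxE; have := p_lim _ hq; have [M M0 hM] := p_bound _ hq.
  set a := ddlog F i j _; pose b := dirD (dz i) F (z, conjv w) * dirD (dw j) F (z, conjv w) /
    F (z, conjv w) ^+ 2 => hlim.
  suff : climit (fun n => a * p n (z, conjv w) + p n (z, conjv w) * (b * n.+1%:R^-1)) a.
    congr climit; apply/funext => n; rewrite (D2 n i j _ hq) -/a -/b.
    by rewrite mulrDr [a * _]mulrC.
  have := climitMl a hlim; rewrite mulr1 => h1.
  have : climit (fun n => p n (z, conjv w) * (b * n.+1%:R^-1)) 0.
    move=> e e_gt0; have [N hN] := harmonic_small (M * cmod b) e_gt0.
    exists N => n /hN; apply: le_trans; rewrite subr0 mulrA cn cmodM.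
    apply: ler_wpM2r; first by rewrite invr_ge0 ler0n.
    apply: ler_wpM2r; first exact: cmod_ge0.
    by have := hM n 1; rewrite add0r scale1r; apply; rewrite ler01 lexx.
  by move=> /(climitD h1); rewrite addr0.
move=> w Bw; apply/matrixP => i j; rewrite mxE (ddbar_logE _ _ L_holo L_gt0 Bw) //.
Qed.

End Divisible.
(** * The row contraction kernel *)

Section RowKernel.
Context {R : realType} {m : nat}.
Notation C := R[i].
Notation V := 'rV[C]_m.
Notation B := (@unit_ball R m).
Notation BB := (@BB R m).
Notation nVV := (@nVV R m).

Lemma eq_pos_def_function n (G G' : V -> 'M[C]_n) : (forall w, B w -> G w = G' w) ->
  pos_def_function B G -> pos_def_function B G'.
Proof.
by move=> GG' [Gt [hG Gd] pG]; exists Gt => //; split=> // w Bw; rewrite Gd ?GG'.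
Qed.

Lemma eq_ddlog (F G : V * V -> C) i j p : (forall q, BB q -> F q = G q) -> BB p ->
  ddlog F i j p = ddlog G i j p.
Proof.
move=> FG hp; have e v q : BB q -> dirD v F q = dirD v G q by apply: (eq_dirD v (@BB_open R m)).
by rewrite /ddlog (eq_dirD _ (@BB_open R m) (e (dw j))) // !e // FG.
Qed.

Variable K : V -> V -> C.
Hypothesis K_holo : holo nVV BB (sharp K).
Hypothesis K_gt0 : forall w, B w -> 0 < K w w.

Definition row_kernel (z w : V) : C := (1 - vdot z w) * K z w.

Lemma row_kernel_holo : holo nVV BB (sharp row_kernel).
Proof. exact: holoM (@holo_vdot R m) K_holo. Qed.

Lemma row_kernel_gt0 w : B w -> 0 < row_kernel w w.
Proof. by move=> Bw; rewrite /row_kernel mulr_gt0 ?one_sub_vdot_gt0 ?K_gt0. Qed.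

(** The logarithm of (1 - <w,w>) K(w,w) differs from that of K(w,w) by the
    logarithm of the inverse of the Drury-Arveson kernel. *)
Lemma ddbar_row_kernel w : B w ->
  ddbar_log row_kernel w = curvature drury_arveson w - curvature K w.
Proof.
move=> Bw; have hp : BB (w, conjv w) by apply/BB_diag.
have hv := @holo_vdot R m.
have v0 q : BB q -> 1 - vdot q.1 (conjv q.2) != 0 :> C.
  by move=> [B1 B2]; apply: one_sub_vdot_neq0 => //; apply/unit_ball_conjv.
have hDA : holo nVV BB (sharp (@drury_arveson R m)) by apply: holoV hv v0.
have DA0 q : B q -> 0 < drury_arveson q q :> C.
  by move=> Bq; rewrite /drury_arveson invr_gt0 one_sub_vdot_gt0.
have curvE (L : V -> V -> C) : curvature L w = - ddbar_log L w.
  by apply/matrixP => i j; rewrite !mxE.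
have subE (A A' : 'M[C]_m) i j : (- A + A') i j = A' i j - A i j by rewrite !mxE addrC.
rewrite !curvE opprK; apply/matrixP => i j; rewrite subE.
apply: etrans (ddbar_logE i j row_kernel_holo row_kernel_gt0 Bw) _.
apply: etrans (esym (congr2 (fun a b => a - b) (ddbar_logE i j K_holo K_gt0 Bw)
  (ddbar_logE i j hDA DA0 Bw))).
have K0 : sharp K (w, conjv w) != 0 by rewrite sharp_diag gt_eqF ?K_gt0.
have dDA : sharp (@drury_arveson R m) (w, conjv w) != 0.
  by rewrite sharp_diag gt_eqF ?DA0.
have := ddlogM i j hv hDA hp (v0 _ hp) dDA.
rewrite (eq_ddlog i j (G := fun=> 1)) // ?ddlog_cst; last first.
  by move=> q /v0 q0; rewrite mulfV.
have -> : ddlog (sharp row_kernel) i j (w, conjv w) = _ := ddlogM i j hv K_holo hp (v0 _ hp) K0.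
move: (ddlog _ i j _) (ddlog _ i j _) (ddlog (sharp K) i j _) => a b c /eqP.
by rewrite eq_sym addr_eq0 => /eqP ->; rewrite addrC.
Qed.

Lemma pd_le_curvature :
  pos_def_function B (ddbar_log row_kernel) <-> pd_le B (curvature K) (curvature drury_arveson).
Proof.
by split; apply: eq_pos_def_function => w Bw; rewrite ddbar_row_kernel.
Qed.

End RowKernel.

Lemma scalar_kernel_holo (R : realType) (m : nat) (K : 'rV[R[i]]_m -> 'rV[R[i]]_m -> R[i]) :
  pos_def_kernel (@unit_ball R m) (scalar_kernel K) ->
  (forall w, unit_ball w -> exists r M : R, 0 < r /\ forall q, unit_ball q ->
     l1 m (q - w) < r -> complex.Re (K q q) <= M) ->
  holo (@nVV R m) (@BB R m) (sharp K).
Proof.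
move=> pK bd; have kE z w : scalar_kernel K z w 0 0 = K z w by rewrite mxE eqxx mulr1n.
apply: eq_holo (pos_def_holo 0 0 pK _) => [p _|i w Bw]; first by rewrite /sharp kE.
have [r [M [r0 hr]]] := bd w Bw; exists r, M; split=> // q Bq hq.
by rewrite (ord1 i) kE hr.
Qed.
(** * Dyadic means *)

Section DyadicMeans.
Context {R : realType}.
Notation C := R[i].

(** The Riemann sum over the left end points of 2^n equal subintervals of
    [a, a + h], divided by h. *)
Fixpoint mean n (f : R -> C) (a h : R) : C :=
  if n is n'.+1 then (mean n' f a (h / 2) + mean n' f (a + h / 2) (h / 2)) / 2 else f a.

Lemma meanS n f a h :
  mean n.+1 f a h = (mean n f a (h / 2) + mean n f (a + h / 2) (h / 2)) / 2.
Proof. by []. Qed.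

Lemma eq_mean n f g a h : 0 <= h -> (forall x, a <= x <= a + h -> f x = g x) ->
  mean n f a h = mean n g a h.
Proof.
elim: n a h => [|n IH] a h h0 fg /=; first by apply: fg; lra.
rewrite (IH a) ?(IH (a + h / 2)) //; try lra; move=> x hx; apply: fg; lra.
Qed.

Lemma meanB n f g a h : mean n f a h - mean n g a h = mean n (fun x => f x - g x) a h.
Proof. by elim: n a h => [|n IH] a h //=; rewrite -!IH; field. Qed.

Lemma meanZ n c f a h : mean n (fun x => c * f x) a h = c * mean n f a h.
Proof. by elim: n a h => [|n IH] a h //=; rewrite !IH; field. Qed.

Lemma mean_sum n (I : Type) (r : seq I) (f : I -> R -> C) a h :
  mean n (fun x => \sum_(i <- r) f i x) a h = \sum_(i <- r) mean n (f i) a h.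
Proof.
elim: n a h => [|n IH] a h //=; rewrite !IH -big_split mulr_suml /=.
by apply: eq_bigr.
Qed.

Lemma mean_bound n f a h (M : R) : 0 <= h -> (forall x, a <= x <= a + h -> cmod (f x) <= M) ->
  cmod (mean n f a h) <= M.
Proof.
elim: n a h => [|n IH] a h h0 fM /=; first by apply: fM; lra.
rewrite cmodM cmodV cmod_nat.
have := cmodD (mean n f a (h / 2)) (mean n f (a + h / 2) (h / 2)).
have : cmod (mean n f a (h / 2)) <= M by apply: IH => [|x hx]; [lra|apply: fM; lra].
have : cmod (mean n f (a + h / 2) (h / 2)) <= M by apply: IH => [|x hx]; [lra|apply: fM; lra].
lra.
Qed.

Lemma mean_step n f a h (K : R) : 0 <= h ->
  (forall x y, a <= x -> x <= y -> y <= a + h -> cmod (f y - f x) <= K * (y - x)) ->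
  cmod (mean n.+1 f a h - mean n f a h) <= K * h * 2 ^- n.
Proof.
elim: n a h => [|n IH] a h h0 fK.
  have -> : mean 1 f a h - mean 0 f a h = (f (a + h / 2) - f a) / 2 by rewrite /=; field.
  rewrite cmodM cmodV cmod_nat expr0 invr1 mulr1.
  have := fK a (a + h / 2); rewrite [a + h / 2 - a]addrC addrA addNr add0r.
  by move=> /(_ ltac:(lra) ltac:(lra) ltac:(lra)); have := cmod_ge0 (f (a + h / 2) - f a); lra.
rewrite (meanS n.+1) (meanS n) -mulrBl opprD addrACA.
rewrite cmodM cmodV cmod_nat exprS invfM.
have := cmodD (mean n.+1 f a (h / 2) - mean n f a (h / 2))
  (mean n.+1 f (a + h / 2) (h / 2) - mean n f (a + h / 2) (h / 2)).
have : cmod (mean n.+1 f a (h / 2) - mean n f a (h / 2)) <= K * (h / 2) * 2 ^- n.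
  by apply: IH => [|x y hx xy hy]; [lra|apply: fK; lra].
have : cmod (mean n.+1 f (a + h / 2) (h / 2) - mean n f (a + h / 2) (h / 2))
   <= K * (h / 2) * 2 ^- n.
  by apply: IH => [|x y hx xy hy]; [lra|apply: fK; lra].
move: (cmod _) (cmod _) (cmod _) (2 ^- n) => x y z t; lra.
Qed.

(** This replaces the fundamental theorem of calculus: X is an additive function of
    the interval [x, x + y], such as an increment, and the errors on the small
    intervals add up. *)
Lemma mean_additive (X : R -> R -> C) f n a h (e : R) : 0 <= h ->
  (forall x y, X x y = X x (y / 2) + X (x + y / 2) (y / 2)) ->
  (forall x, a <= x -> x + h / 2 ^+ n <= a + h ->
     cmod (X x (h / 2 ^+ n) - (h / 2 ^+ n)%:C * f x) <= e * (h / 2 ^+ n)) ->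
  cmod (X a h - h%:C * mean n f a h) <= e * h.
Proof.
move=> + addX; elim: n a h => [|n IH] a h h0 cell /=.
  by have := cell a; rewrite expr0 divr1; apply; lra.
have h2 : h / 2 / 2 ^+ n = h / 2 ^+ n.+1 by rewrite exprS invfM mulrA.
have h20 : 0 <= h / 2 by lra.
have i1 : cmod (X a (h / 2) - (h / 2)%:C * mean n f a (h / 2)) <= e * (h / 2).
  by apply: IH => // x hx; rewrite h2 => xh; apply: cell => //; lra.
have i2 : cmod (X (a + h / 2) (h / 2) - (h / 2)%:C * mean n f (a + h / 2) (h / 2)) <= e * (h / 2).
  by apply: IH => // x hx; rewrite h2 => xh; apply: cell => //; lra.
have := le_trans (cmodD _ _) (lerD i1 i2).
have -> : e * (h / 2) + e * (h / 2) = e * h by lra.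
congr (cmod _ <= _); rewrite (addX a h) rmorphM /= fmorphV /= rmorph_nat.
by move: (X _ _) (X _ _) (mean _ _ _ _) (mean _ _ _ _) => x y z t; field.
Qed.

(** The same weights and sample points for all functions, as needed to recognize
    means of kernels as finite combinations. *)
Lemma mean_weights n a h : 0 <= h -> exists (J : finType) (x c : J -> R),
  (forall s, a <= x s <= a + h) /\
  forall f, mean n f a h = \sum_s f (x s) * (c s)%:C.
Proof.
elim: n a h => [|n IH] a h h0.
  exists unit, (fun=> a), (fun=> 1); split=> [s|f]; first by lra.
  by rewrite (bigD1 tt) //= big1 ?mulr1 ?addr0 // => -[].
have h20 : 0 <= h / 2 by lra.
have [J [x [c [hx hc]]]] := IH a (h / 2) h20.
have [J' [x' [c' [hx' hc']]]] := IH (a + h / 2) (h / 2) h20.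
exists (J + J')%type, (fun s => match s with inl s => x s | inr s => x' s end),
  (fun s => match s with inl s => c s / 2 | inr s => c' s / 2 end).
split=> [[s|s]|f]; first by have := hx s; lra.
  by have := hx' s; lra.
rewrite big_sumType /= hc hc' mulrDl !mulr_suml.
by congr (_ + _); apply: eq_bigr => s _; rewrite rmorphM /= fmorphV /= rmorph_nat mulrA.
Qed.

Lemma holo_mean (E : lmodType C) (N : cseminorm E) Om (f : R -> E -> C) n a h : is_open N Om ->
  0 <= h -> (forall x, a <= x <= a + h -> holo N Om (f x)) ->
  holo N Om (fun q => mean n (fun x => f x q) a h).
Proof.
move=> oO; elim: n a h => [|n IH] a h h0 hf /=; first by apply: hf; lra.
apply: (holoM _ (holo_cst _ oO)); apply: holoD; apply: IH => [|x hx]; try lra; apply: hf; lra.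
Qed.

(** ** Limits *)

Lemma geometric_limit (u : nat -> C) (K : R) :
  (forall n, cmod (u n.+1 - u n) <= K * 2 ^- n) ->
  exists l, forall n, cmod (u n - l) <= 2 * K * 2 ^- n.
Proof.
move=> hu.
have K0 : 0 <= K by have := hu 0%N; rewrite expr0 invr1 mulr1; apply: le_trans; apply: cmod_ge0.
have tail n d : cmod (u (n + d)%N - u n) <= 2 * K * 2 ^- n - 2 * K * 2 ^- (n + d).
  elim: d => [|d IH]; first by rewrite addn0 !subrr cmod0.
  have := cmod_tri (u (n + d)%N) (u (n + d.+1)%N) (u n); have := hu (n + d)%N.
  rewrite addnS exprS invfM; move: IH; move: (cmod _) (cmod _) (cmod _) => x y z.
  by move: (2 ^- n) (2 ^- (n + d)) => s t; lra.
have cl n n' : (n <= n')%N -> cmod (u n' - u n) <= 2 * K * 2 ^- n.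
  move=> nn'; have := tail n (n' - n)%N; rewrite subnKC //.
  have : 0 <= 2 * K * 2 ^- n' by rewrite !mulr_ge0 // invr_ge0 exprn_ge0.
  lra.
have p2 n : 0 < 2 ^- n :> R by rewrite invr_gt0 exprn_gt0.
have [|e e' c c' e0 e'0 [n [hn ->]] [n' [hn' ->]]|l hl] :=
    @cauchy_choice R (fun e c => exists n, 2 ^- n <= e /\ c = u n) (2 * K).
- by move=> e /half_pow_small[n hn]; exists (u n), n; split=> //; apply: ltW.
- have := cl n n'; have := cl n' n; have := mulr_ge0 (mulr_ge0 (ler0n R 2) K0) (ltW e0).
  have := mulr_ge0 (mulr_ge0 (ler0n R 2) K0) (ltW e'0).
  have k0 : 0 <= 2 * K by lra.
  have := ler_wpM2l k0 hn; have := ler_wpM2l k0 hn'; rewrite mulrDr.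
  move=> i1 i2 i3 i4 i5 i6; have [nn'|nn'] := leqP n n'.
    by rewrite cmodBC; have := i6 nn'; lra.
  by have := i5 (ltnW nn'); lra.
by exists l => n; apply: hl => //; exists n.
Qed.

Lemma geometric_climit (u : nat -> C) l (K : R) :
  (forall n, cmod (u n - l) <= K * 2 ^- n) -> climit u l.
Proof.
move=> hu; have K0 : 0 <= K.
  by have := hu 0%N; rewrite expr0 invr1 mulr1; apply: le_trans; apply: cmod_ge0.
move=> e e0; have k0 : 0 < e / (K + 1) by rewrite divr_gt0 //; lra.
have [N hN] := half_pow_small k0; exists N => n Nn; apply: le_trans (hu n) _.
have k1 : 0 < K + 1 by lra.
have : 2 ^- n <= 2 ^- N :> R.
  by rewrite lef_pV2 ?posrE ?exprn_gt0 // ler_weXn2l // ler1n.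
move: hN; rewrite ltr_pdivlMr //.
have : 0 < 2 ^- n :> R by rewrite invr_gt0 exprn_gt0.
by move: (2 ^- n) (2 ^- N) => x y; nra.
Qed.

Lemma holo_geometric_limit (E : lmodType C) (N : cseminorm E) Om (g : nat -> E -> C) :
  (forall n, holo N Om (g n)) ->
  (forall p, Om p -> exists r K : R, 0 < r /\ forall q n, N (q - p) < r ->
     cmod (g n.+1 q - g n q) <= K * 2 ^- n) ->
  exists2 l, holo N Om l & forall p, Om p -> climit (fun n => g n p) (l p).
Proof.
move=> hg step.
have /choice[l hl] : forall q, exists l, forall l',
    climit (fun n => g n q) l' -> climit (fun n => g n q) l.
  move=> q; have [[l hl]|no] := pselect (exists l, climit (fun n => g n q) l).
    by exists l.
  by exists 0 => l' h; case: no; exists l'.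
have app p : Om p -> exists r K : R, 0 < r /\ forall q n, N (q - p) < r ->
    cmod (g n q - l q) <= 2 * K * 2 ^- n.
  move=> /step[r [K [r0 hr]]]; exists r, K; split=> // q n hq.
  have [l' hl'] := geometric_limit (fun n => hr q n hq).
  suff -> : l q = l' by [].
  by apply: climit_unique (hl q l' _) _; apply: geometric_climit hl'.
exists l; last first.
  move=> p /app[r [K [r0 hr]]]; apply: (@geometric_climit _ _ (2 * K)) => n.
  by apply: hr; rewrite subrr csn0.
apply: holo_limit => p hp; have [r [K [r0 hr]]] := app p hp.
have [[r' [M [r'0 hr']]] _] := hg 0%N p hp.
have [s s0 [sr sr']] := pos_below r0 r'0.
exists s, (M + 2 * K); split=> // [q hq|e e0].
  have [Oq gq] := hr' q (lt_trans hq sr'); split=> //.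
  have := hr q 0%N (lt_trans hq sr); rewrite expr0 invr1 mulr1.
  by have := cmod_dist (l q) (g 0%N q); rewrite cmodBC; lra.
have K0 : 0 <= 2 * K.
  have := hr p 0%N; rewrite subrr csn0 expr0 invr1 mulr1 => /(_ r0).
  by apply: le_trans; apply: cmod_ge0.
have k0 : 0 < e / (2 * K + 1) by rewrite divr_gt0 //; lra.
have [n hn] := half_pow_small k0; exists (g n) => // q hq.
rewrite cmodBC; apply: le_trans (hr q n (lt_trans hq sr)) _.
move: hn; rewrite ltr_pdivlMr; last by lra.
have : 0 < 2 ^- n :> R by rewrite invr_gt0 exprn_gt0.
by move: (2 ^- n) => x; nra.
Qed.

(** ** The exponential as a limit of powers *)

Lemma cmod_powB (x y : C) (M : R) n : 1 <= M -> cmod x <= M -> cmod y <= M ->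
  cmod (x ^+ n - y ^+ n) <= n%:R * M ^+ n * cmod (x - y).
Proof.
move=> M1 xM yM; elim: n => [|n IH]; first by rewrite !expr0 subrr cmod0 !mul0r.
have -> : x ^+ n.+1 - y ^+ n.+1 = x * (x ^+ n - y ^+ n) + (x - y) * y ^+ n.
  by rewrite !exprS; ring.
apply: le_trans (cmodD _ _) _; rewrite !cmodM cmodX.
have M0 : 0 <= M by lra.
have d0 := cmod_ge0 (x - y).
have i1 : cmod x * cmod (x ^+ n - y ^+ n) <= M * (n%:R * M ^+ n * cmod (x - y)).
  by apply: ler_pM => //; apply: cmod_ge0.
have i2 : cmod (x - y) * cmod y ^+ n <= cmod (x - y) * M ^+ n.+1.
  apply: ler_wpM2l => //; apply: (@le_trans _ _ (M ^+ n)).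
    by rewrite lerXn2r ?nnegrE ?cmod_ge0.
  by rewrite exprS ler_peMl // exprn_ge0.
apply: le_trans (lerD i1 i2) _; rewrite -natr1 exprS; move: (M ^+ n) => a.
by apply: eq_leW; ring.
Qed.

Lemma cexp_limit (x : C) : climit (fun n => (1 + x * n.+1%:R^-1) ^+ n.+1) (cexp x).
Proof.
move=> e e0; pose k := cmod x; have k0 : 0 <= k := cmod_ge0 x.
pose c := expR k * (k + 1); have c0 : 0 < c by rewrite mulr_gt0 ?expR_gt0 //; lra.
have [r r0 hr] := cdiff_cexp (0 : C) (divr_gt0 e0 c0).
have r2 : 0 < r / 2 by lra.
have [N hN] := harmonic_small k r2; exists N => n /hN hn.
set h := x * n.+1%:R^-1.
have n0 : 0 < n.+1%:R :> R by rewrite ltr0n.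
have nc : n.+1%:R != 0 :> C by rewrite pnatr_eq0.
have hk : cmod h = k * n.+1%:R^-1 by rewrite /h cmodM cmodV cmod_nat.
have -> : cexp x = cexp h ^+ n.+1 by rewrite -cexp_nat /h mulrC mulfVK.
pose M := expR (cmod h).
have Mn : M ^+ n.+1 = expR k.
  by rewrite /M -expRM_natl hk mulrC mulfVK // gt_eqF.
have M1 : 1 <= M by rewrite -expR0 ler_expR cmod_ge0.
have h1 : cmod (1 + h) <= M.
  by apply: le_trans (cmodD _ _) _; rewrite cmod1 expR_ge1Dx.
have h2 : cmod (cexp h) <= M.
  by rewrite cmod_cexp ler_expR; apply: le_trans (ler_norm _) (cmod_Re _).
apply: le_trans (cmod_powB n.+1 M1 h1 h2) _; rewrite Mn.
have hlt : cmod h < r by rewrite hk; apply: le_lt_trans hn _; lra.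
have := hr h hlt; rewrite add0r cexp0 mul1r.
have -> : cexp h - 1 - h = - (1 + h - cexp h) by ring.
rewrite cmodN hk => i1.
have e1 : 0 < expR k by apply: expR_gt0.
apply: (@le_trans _ _ (n.+1%:R * expR k * (e / c * (k * n.+1%:R^-1)))).
  by rewrite ler_pM2l ?mulr_gt0.
have -> : n.+1%:R * expR k * (e / c * (k * n.+1%:R^-1)) = e * (k / (k + 1)).
  by rewrite /c; field; rewrite !gt_eqF //; lra.
by rewrite ler_piMr ?(ltW e0) // ler_pdivrMr; lra.
Qed.

Lemma pdk_cexp X (D : set X) (k : X -> X -> C) : pdk D k -> pdk D (fun x y => cexp (k x y)).
Proof.
move=> hk; apply: (@pdk_limit _ _ _ (fun n x y => (1 + k x y * n.+1%:R^-1) ^+ n.+1)).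
  move=> n; apply: pdkX; apply: pdkD; first exact: pdk1.
  apply: (@eq_pdk _ _ _ _ (fun x y => n.+1%:R^-1 * k x y)) => [x y _ _|]; first exact: mulrC.
  by apply: pdkZ => //; rewrite invr_ge0 ler0n.
by move=> x y _ _; apply: cexp_limit.
Qed.

End DyadicMeans.
(** * Integrals along segments and holomorphic logarithms *)

Section Integrals.
Context {R : realType} {E : lmodType R[i]} (N : cseminorm E).
Notation C := R[i].
Implicit Types (Om : set E) (f : E -> C) (p q u v : E).

Lemma holo_scale Om f (a : R) : (forall q, Om q -> Om (a%:C *: q)) -> is_open N Om ->
  holo N Om f -> holo N Om (fun q => f (a%:C *: q)).
Proof.
move=> sub oO hf; apply: (holo_subset oO) sub _.
apply: (@holo_affine R E E N N (fun q => a%:C *: q) (fun q => a%:C *: q) `|a|) => //.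
  by move=> p z v; rewrite scalerDr !scalerA mulrC.
by move=> v; rewrite csnZr.
Qed.

(** Near points are compared by the Cauchy estimates, distant ones by the bound
    of f itself. *)
Lemma tube_lipschitz Om f (S : set E) (r M : R) : holo N Om f -> 0 < r ->
  (forall s q, S s -> N (q - s) < r -> Om q /\ cmod (f q) <= M) ->
  forall s s' (t : R), S s -> S s' -> 0 < t -> N (s' - s) <= t ->
    cmod (f s' - f s) <= 8 * M / r * t.
Proof.
move=> hf r0 hr s s' t Ss Ss' t0 st.
have fM x : S x -> cmod (f x) <= M by move=> Sx; apply: (hr x x Sx _).2; rewrite subrr csn0.
have M0 : 0 <= M by apply: le_trans (fM s Ss); apply: cmod_ge0.
have k0 : 0 <= M / r by rewrite divr_ge0 // ltW.
have [tr|rt] := leP (4 * t) r.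
  have := holo_lipschitz hf r0 (fun q => hr s q Ss) st t0 tr; rewrite [s + _]addrC subrK.
  move=> h; apply: le_trans h _; have : 0 <= M / r * t by rewrite mulr_ge0 // ltW.
  have -> : 8 * M / r * t = 8 * (M / r * t) by field; lra.
  have -> : 4 * M / r * t = 4 * (M / r * t) by field; lra.
  lra.
have : M * r <= M * (4 * t) by apply: ler_wpM2l => //; apply: ltW.
rewrite -ler_pdivlMr // => i; apply: le_trans (cmodB _ _) _.
have -> : 8 * M / r * t = 2 * (M * (4 * t) / r) by field; lra.
by have := fM s Ss; have := fM s' Ss'; lra.
Qed.

Lemma holo_integral Om (f : R -> E -> C) : is_open N Om ->
  (forall a : R, 0 <= a <= 1 -> holo N Om (f a)) ->
  (forall p, Om p -> exists r K : R, 0 < r /\ forall q x y, N (q - p) < r ->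
     0 <= x -> x <= y -> y <= 1 -> cmod (f y q - f x q) <= K * (y - x)) ->
  exists2 l, holo N Om l &
    forall p, Om p -> climit (fun n => mean n (fun a => f a p) 0 1) (l p).
Proof.
move=> oO hf lip; apply: holo_geometric_limit => [n|p hp].
  by apply: holo_mean => // x; rewrite add0r; apply: hf.
have [r [K [r0 hr]]] := lip p hp; exists r, K; split=> // q n hq.
have := @mean_step R n (fun a => f a q) 0 1 K ler01.
by rewrite mulr1; apply=> x y x0 xy y1; apply: hr => //; lra.
Qed.

Lemma holo_integral2 Om (f : R -> R -> E -> C) : is_open N Om ->
  (forall a b : R, 0 <= a <= 1 -> 0 <= b <= 1 -> holo N Om (f a b)) ->
  (forall p, Om p -> exists r K : R, 0 < r /\ forall q x y b, N (q - p) < r ->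
     0 <= x -> x <= y -> y <= 1 -> 0 <= b <= 1 ->
     cmod (f y b q - f x b q) <= K * (y - x) /\ cmod (f b y q - f b x q) <= K * (y - x)) ->
  exists2 l, holo N Om l & forall p, Om p ->
    climit (fun n => mean n (fun a => mean n (fun b => f a b p) 0 1) 0 1) (l p).
Proof.
move=> oO hf lip; apply: holo_geometric_limit => [n|p hp].
  apply: holo_mean => // x; rewrite add0r => hx; apply: holo_mean => // y.
  by rewrite add0r; apply: hf.
have [r [K [r0 hr]]] := lip p hp; exists r, (2 * K); split=> // q n hq.
have i1 : cmod (mean n.+1 (fun a => mean n (fun b => f a b q) 0 1) 0 1 -
    mean n (fun a => mean n (fun b => f a b q) 0 1) 0 1) <= K * 1 * 2 ^- n.
  apply: mean_step => // x y x0 xy y1; rewrite meanB; apply: mean_bound => // b hb.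
  by apply: (hr q x y b hq x0 xy _ _).1; lra.
have i2 : cmod (mean n.+1 (fun a => mean n.+1 (fun b => f a b q) 0 1) 0 1 -
    mean n.+1 (fun a => mean n (fun b => f a b q) 0 1) 0 1) <= K * 1 * 2 ^- n.
  rewrite meanB; apply: mean_bound => // b hb; apply: mean_step => // x y x0 xy y1.
  by apply: (hr q x y b hq x0 xy _ _).2; lra.
have := le_trans (cmodD _ _) (lerD i2 i1); rewrite addrA subrK mulr1 => h.
by apply: le_trans h _; apply: eq_leW; ring.
Qed.

Lemma dirD0 f p : dirD 0 f p = 0.
Proof.
rewrite /dirD -[RHS](dirD_cst (f p) p (0 : E)); congr cderiv.
by apply/funext => z; rewrite scaler0 addr0.
Qed.

Lemma dirD_sum Om f p (I : Type) (r : seq I) (c : I -> C) (v : I -> E) :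
  holo N Om f -> Om p ->
  dirD (\sum_(i <- r) c i *: v i) f p = \sum_(i <- r) c i * dirD (v i) f p.
Proof.
move=> hf hp; elim: r => [|i r IH]; first by rewrite !big_nil dirD0.
by rewrite !big_cons (dirD_add _ _ hf hp) (dirDZ _ _ hf hp) IH.
Qed.

End Integrals.

Section Logarithm.
Context {R : realType} {m : nat}.
Notation C := R[i].
Notation V := 'rV[C]_m.
Notation B := (@unit_ball R m).

Lemma dirD_row (Om : set V) (f : V -> C) p v : holo (l1 m) Om f -> Om p ->
  dirD v f p = \sum_i v 0 i * dirD (delta_mx 0 i) f p.
Proof. by move=> hf hp; rewrite {1}(row_sum_delta v) (dirD_sum _ _ _ hf hp). Qed.

(** A zero free holomorphic function on the ball has a logarithm, the integral of
    its logarithmic derivative along rays; near the origin this is verified by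
    telescoping, elsewhere by the identity theorem. *)
Lemma log_branch (f : V -> C) : holo (l1 m) B f -> (forall z, B z -> f z != 0) ->
  0 < complex.Re (f 0) -> exists2 h, holo (l1 m) B h & forall z, B z -> f z = cexp (h z).
Proof.
move=> hf f0 Ref; have oB := @unit_ball_open R m.
pose g i z := dirD (delta_mx 0 i) f z * (f z)^-1.
have hg i : holo (l1 m) B (g i) := holoM (holo_dirD _ hf) (holoV hf f0).
have seg z : B z -> forall a : R, 0 <= a <= 1 -> B (0 + a%:C *: z).
  by move=> Bz a ha; rewrite add0r; apply: unit_ballZ.
have /choice[I hI] : forall i, exists I, holo (l1 m) B I /\
    forall z, B z -> climit (fun n => mean n (fun a => g i (a%:C *: z)) 0 1) (I z).
  move=> i; suff [l h1 h2] : exists2 l, holo (l1 m) B l &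
    forall p, B p -> climit (fun n => mean n (fun a => g i (a%:C *: p)) 0 1) (l p) by exists l.
  apply: (holo_integral (f := fun a q => g i (a%:C *: q)) oB) => [a ha|p Bp].
    by apply: holo_scale => // q Bq; apply: unit_ballZ.
  have [r [M [r0 M0 hr]]] := holo_tube (hg i) (seg p Bp).
  have [r' r'0 hr'] := oB p Bp.
  have r20 : 0 < r / 2 by lra.
  have [s s0 [sr sr']] := pos_below r20 r'0.
  exists s, (8 * M / (r / 2) * (l1 m p + s)); split=> // q x y hq x0 xy y1.
  have [-> |xny] := eqVneq x y; first by rewrite !subrr cmod0 mulr0.
  have yx : 0 < y - x by rewrite subr_gt0 lt_neqAle xny.
  have Nq : l1 m q <= l1 m p + s.
    by have := csnD (l1 m) (q - p) p; rewrite subrK; lra.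
  rewrite -mulrA.
  apply: (@tube_lipschitz R V (l1 m) B (g i) [set w | exists2 a : R, 0 <= a <= 1 & w = a%:C *: q]
     (r / 2) M (hg i) r20).
  - move=> w w' [a ha ->] hw; apply: (hr a) => //.
    rewrite add0r; have -> : w' - a%:C *: p = (w' - a%:C *: q) + a%:C *: (q - p).
      by rewrite scalerBr addrA subrK.
    have := csnD (l1 m) (w' - a%:C *: q) (a%:C *: (q - p)); rewrite csnZr.
    have a0 : 0 <= a by lra.
    rewrite ger0_norm //; have : a * l1 m (q - p) <= l1 m (q - p).
      by rewrite ler_piMl ?csn_ge0 //; lra.
    lra.
  - by exists x => //; lra.
  - by exists y => //; lra.
  - by rewrite mulr_gt0 //; have := csn_ge0 (l1 m) p; lra.
  rewrite -scalerBl -rmorphB csnZr gtr0_norm // mulrC.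
  by apply: ler_wpM2r => //; apply: ltW.
pose h (z : V) := clog (f 0) + \sum_i z 0 i * I i z.
have hh : holo (l1 m) B h.
  apply: holoD; first exact: holo_cst.
  by apply: holo_sum => // i; apply: holoM (holo_coord i) (hI i).1.
have [s s0 hs] : exists2 s : R, 0 < s & forall z, l1 m z < s -> f z = cexp (h z).
  pose P := [set z | B z /\ 0 < complex.Re (f z)].
  have P_open : is_open (l1 m) P.
    move=> p [hp Fp]; have e0 : 0 < complex.Re (f p) / 2 by lra.
    have [r r0 hr] := holo_cont hf hp e0; exists r => // q /hr[hq Fq]; split=> //.
    have := le_trans (cmod_Re _) Fq; rewrite raddfB /= ler_norml; lra.
  have hfP : holo (l1 m) P f by apply: holo_subset hf => // p [].
  have hlog : holo (l1 m) P (fun p => clog (f p)).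
    by apply: (holo_comp hfP) => p [_ Fp]; exists (f p)^-1; apply: cdiff_clog.
  have P0 : P 0 by split=> //; apply: unit_ball0.
  have [r [M [r0 M0 hr]]] := holo_est hlog P0.
  have [s s0 [s1 sr]] := pos_below ltr01 r0.
  exists s => // z hz; set psi := fun p => clog (f p) in hlog hr.
  have inP (a : R) : 0 <= a <= 1 -> l1 m (a%:C *: z - 0) < r.
    move=> /andP[a0 a1]; rewrite subr0 csnZr ger0_norm //.
    by apply: le_lt_trans sr; apply: le_trans (ltW hz); rewrite ler_piMl ?csn_ge0.
  have [Pz Bz] : P z /\ B z.
    have := inP 1; rewrite ler01 lexx scale1r => /(_ isT) /hr[Pz _ _].
    by split=> //; case: Pz.
  have e1 : climit (fun n => mean n (fun a => \sum_i z 0 i * g i (a%:C *: z)) 0 1)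
      (\sum_i z 0 i * I i z).
    have -> : (fun n => mean n (fun a => \sum_i z 0 i * g i (a%:C *: z)) 0 1) =
        (fun n => \sum_i z 0 i * mean n (fun a => g i (a%:C *: z)) 0 1).
      by apply/funext => n; rewrite mean_sum; apply: eq_bigr => i _; rewrite meanZ.
    by apply: climit_sum => i; apply/climitMl/(hI i).2.
  have e2 : climit (fun n => mean n (fun a => \sum_i z 0 i * g i (a%:C *: z)) 0 1)
      (psi z - psi 0).
    move=> e e0; have k0 : 0 < e / (M + 1) by rewrite divr_gt0 //; lra.
    have [t t0 [tr tk]] := pos_below r0 k0; have [n0 hn0] := half_pow_small t0.
    exists n0 => n n0n; have p2 : 0 < 2 ^- n :> R by rewrite invr_gt0 exprn_gt0.
    have nt : 2 ^- n < t :> R.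
      by apply: le_lt_trans hn0; rewrite lef_pV2 ?posrE ?exprn_gt0 // ler_weXn2l // ler1n.
    have := @mean_additive R (fun a k => psi ((a + k)%:C *: z) - psi (a%:C *: z))
      (fun a => \sum_i z 0 i * g i (a%:C *: z)) n 0 1 (M * 2 ^- n) ler01.
    rewrite mulr1 [in X in _ -> X -> _]mul1r add0r scale1r scale0r mul1r => H.
    rewrite cmodBC; apply: le_trans (H _ _) _ => {H}.
    - move=> x y; have -> : x + y / 2 + y / 2 = x + y by field.
      by rewrite [RHS]addrC addrA subrK.
    - move=> x x0 xn; have hx : 0 <= x <= 1 by lra.
      have [Px _ /(_ ((2 ^- n)%:C *: z) (2 ^- n))] := hr _ (inP x hx).
      rewrite csnZr gtr0_norm // => /(_ _ p2)[|_].
        by rewrite ler_piMr ?(ltW p2) //; apply: ltW; apply: lt_trans s1.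
      move=> /(_ ltac:(lra)); rewrite (dirDZ _ _ hlog Px) rmorphD scalerDl expr2 mulrA.
      congr (cmod (_ - _ * _) <= _); rewrite (dirD_row _ hlog Px); apply: eq_bigr => i _.
      rewrite /psi (dirD_comp _ hfP Px (cdiff_clog Px.2)) /g [_^-1 * _]mulrC //.
    have : M * 2 ^- n <= M * (e / (M + 1)) by apply: ler_wpM2l => //; lra.
    have : M * (e / (M + 1)) <= e.
      by rewrite mulrCA ler_piMr ?(ltW e0) // ler_pdivrMr; lra.
    lra.
  rewrite /h (climit_unique e1 e2) addrCA subrr addr0 /psi clogK //; exact: Pz.2.
exists h => // z Bz; apply/eqP; rewrite -subr_eq0; apply/eqP.
have hc : holo (l1 m) B (fun z => f z - cexp (h z)).
  by apply: holoB hf _; apply: (holo_comp hh) => p _; eexists; apply: cdiff_cexp.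
rewrite -[z in LHS]add0r -[LHS]/((fun z => f z - cexp (h z)) (0 + z)).
apply: (holo_identity hc (seg z Bz)).
have z0 := csn_ge0 (l1 m) z.
exists (s / (l1 m z + 1)) => [|x]; first by rewrite divr_gt0 //; lra.
rewrite ltr_pdivlMr; last by lra.
move=> hx; rewrite add0r hs ?subrr // csnZ; have := cmod_ge0 x; lra.
Qed.

End Logarithm.
(** * The potential of a positive definite matrix of mixed derivatives *)

Section Potential.
Context {R : realType} {m : nat}.
Notation C := R[i].
Notation V := 'rV[C]_m.
Notation B := (@unit_ball R m).
Notation BB := (@BB R m).
Notation nVV := (@nVV R m).

Variable G : 'I_m -> 'I_m -> V * V -> C.
Hypothesis G_holo : forall i j, holo nVV BB (G i j).
Hypothesis G_pdk : pdk [set x : V * 'I_m | B x.1]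
  (fun x y => G x.2 y.2 (x.1, conjv y.1)).
(* a consequence of positivity, recorded in the form in which it is used *)
Hypothesis G_bound : forall i j z w, B z -> B w -> cmod (G i j (z, w)) <=
  complex.Re (G i i (z, conjv z)) + complex.Re (G j j (conjv w, w)).

(** For a and b in [0, 1] these points form the square spanned by z and w. *)
Definition rect (a b : R) (p : V * V) : V * V := (a%:C *: p.1, b%:C *: p.2).

Lemma rect_BB a b p : 0 <= a <= 1 -> 0 <= b <= 1 -> BB p -> BB (rect a b p).
Proof. by move=> ha hb [p1 p2]; split; apply: unit_ballZ. Qed.

Lemma rect_norm a b p : 0 <= a <= 1 -> 0 <= b <= 1 -> nVV (rect a b p) <= nVV p.
Proof.
move=> /andP[a0 a1] /andP[b0 b1]; rewrite /rect nVVE !csnZr !ger0_norm //.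
have -> : nVV p = l1 m p.1 + l1 m p.2 by [].
by apply: lerD; rewrite ler_piMl ?csn_ge0.
Qed.

Lemma rectB a b p q : rect a b p - rect a b q = rect a b (p - q).
Proof. by apply/pair_equal_spec; rewrite /= !scalerBr. Qed.

(** Positivity reduces a bound on the square spanned by z and w to bounds on the
    segments from 0 to (z, conj z) and to (conj w, w). *)
Lemma rect_tube i j p : BB p -> exists r M : R, 0 < r /\
  forall a b q, 0 <= a <= 1 -> 0 <= b <= 1 -> nVV (q - rect a b p) < r ->
    BB q /\ cmod (G i j q) <= M.
Proof.
case: p => z w [/= Bz Bw].
have cj (t : R) : conjC t%:C = t%:C :> C := conjc_real t.
have BB0 : BB 0 by split; apply: unit_ball0.
have seg (x : V) : B x -> forall t : R, 0 <= t <= 1 -> BB (0 + t%:C *: (x, conjv x)).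
  move=> Bx t ht; have := BB_convex BB0 (iffRL (BB_diag x) Bx) ht; by rewrite subr0.
have Bw' : B (conjv w) by apply/unit_ball_conjv.
have [r1 [M1 [r10 _ h1]]] := holo_tube (G_holo i i) (seg z Bz).
have [r2 [M2 [r20 _ h2]]] := holo_tube (G_holo j j) (seg _ Bw').
have [r r0 [rr1 rr2]] := pos_below r10 r20.
exists (r / 2), (M1 + M2); split=> [|a b [x y] ha hb]; first by lra.
move=> hq; have {}hq : l1 m (x - a%:C *: z) + l1 m (y - b%:C *: w) < r / 2 := hq.
have := csn_ge0 (l1 m) (x - a%:C *: z); have := csn_ge0 (l1 m) (y - b%:C *: w) => n1 n2.
have [|/BB_diag Bx Gx] := h1 a (x, conjv x) ha.
  rewrite add0r; have -> : (x, conjv x) - a%:C *: (z, conjv z) =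
      (x - a%:C *: z, conjv (x - a%:C *: z)).
    by apply/pair_equal_spec; rewrite conjvB conjvZ cj.
  by rewrite nVVE l1_conjv; lra.
have [|[_ /= By] Gy] := h2 b (conjv y, y) hb.
  rewrite add0r conjvK; have -> : (conjv y, y) - b%:C *: (conjv w, w) =
      (conjv (y - b%:C *: w), y - b%:C *: w).
    by apply/pair_equal_spec; rewrite conjvB conjvZ cj.
  by rewrite nVVE l1_conjv; lra.
split=> //; apply: le_trans (G_bound i j Bx By) _.
have := le_trans (ler_norm _) (le_trans (cmod_Re _) Gx).
by have := le_trans (ler_norm _) (le_trans (cmod_Re _) Gy); lra.
Qed.

Lemma rect_integral i j : exists2 I, holo nVV BB I & forall p, BB p ->
  climit (fun n => mean n (fun a => mean n (fun b => G i j (rect a b p)) 0 1) 0 1) (I p).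
Proof.
have oBB := @BB_open R m.
apply: (holo_integral2 (f := fun a b q => G i j (rect a b q)) oBB) => [a b ha hb|p hp].
  have := @holo_affine R _ _ nVV nVV (rect a b) (rect a b) 1 BB (G i j) ler01.
  move=> /(_ _ _ (G_holo i j)) h; apply: (holo_subset oBB _ (h _ _)) => [q|q z v|v].
  - exact: rect_BB.
  - by apply/pair_equal_spec; rewrite /= !scalerDr !scalerA ![z * _]mulrC.
  - by rewrite mul1r rect_norm.
have [r [M [r0 hr]]] := rect_tube i j hp.
have [r' r'0 hr'] := oBB p hp.
have r20 : 0 < r / 2 by lra.
have [s s0 [sr sr']] := pos_below r20 r'0.
exists s, (8 * M / (r / 2) * (nVV p + s)); split=> // q x y b hq x0 xy y1 hb.
have [<- |xny] := eqVneq x y; first by rewrite !subrr cmod0 mulr0.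
have yx : 0 < y - x by rewrite subr_gt0 lt_neqAle xny.
have hx : 0 <= x <= 1 by lra.
have hy : 0 <= y <= 1 by lra.
have Nq : nVV q <= nVV p + s by have := csnD nVV (q - p) p; rewrite subrK; lra.
have lip a a' b0 b1 : 0 <= a <= 1 -> 0 <= a' <= 1 -> 0 <= b0 <= 1 -> 0 <= b1 <= 1 ->
    nVV (rect a' b1 q - rect a b0 q) <= (y - x) * nVV q ->
    cmod (G i j (rect a' b1 q) - G i j (rect a b0 q)) <= 8 * M / (r / 2) * (nVV p + s) * (y - x).
  move=> ha ha' hb0 hb1 h; rewrite -mulrA.
  apply: (@tube_lipschitz R _ nVV BB (G i j) [set w | exists a b : R, [/\ 0 <= a <= 1,
     0 <= b <= 1 & w = rect a b q]] (r / 2) M (G_holo i j) r20).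
  - move=> w w' [c [d [hc hd ->]]] hw; apply: (hr c d) => //.
    have -> : w' - rect c d p = (w' - rect c d q) + rect c d (q - p).
      by rewrite -rectB addrA subrK.
    apply: le_lt_trans (csnD nVV _ _) _; rewrite (splitr r); apply: (ltrD hw).
    by apply: le_lt_trans (rect_norm _ hc hd) _; apply: lt_trans hq sr.
  - by exists a, b0.
  - by exists a', b1.
  - by rewrite mulr_gt0 //; have := csn_ge0 nVV p; lra.
  apply: le_trans h _; rewrite mulrC; apply: ler_wpM2r => //; exact: ltW.
have e1 a a' c : rect a' c q - rect a c q = (a' - a)%:C *: (q.1, 0).
  by apply/pair_equal_spec; rewrite /= -!scalerBl -!rmorphB subrr scale0r scaler0.
have e2 a a' c : rect c a' q - rect c a q = (a' - a)%:C *: (0, q.2).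
  by apply/pair_equal_spec; rewrite /= -!scalerBl -!rmorphB subrr scale0r scaler0.
have qE : nVV q = l1 m q.1 + l1 m q.2 by [].
have q1 := csn_ge0 (l1 m) q.1; have q2 := csn_ge0 (l1 m) q.2.
split; apply: lip => //; rewrite ?e1 ?e2 csnZr gtr0_norm // ler_pM2l // nVVE csn0 qE.
  by rewrite addr0 lerDl.
by rewrite add0r lerDr.
Qed.

Definition mixed_form (p : V * V) (a b : R) : C :=
  \sum_i \sum_j p.1 0 i * p.2 0 j * G i j (rect a b p).

(** The potential N is the double integral over this square of the bilinear form of
    G at z and w.  It is a second primitive of G, and being an integral of values
    of G it inherits positivity. *)
Lemma potential_exists : exists2 N, holo nVV BB N & forall p, BB p ->
  climit (fun n => mean n (fun a => mean n (mixed_form p a) 0 1) 0 1) (N p).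
Proof.
have /choice[I0 h0] : forall ij : 'I_m * 'I_m, exists I, holo nVV BB I /\ forall p, BB p ->
    climit (fun n => mean n (fun a => mean n (fun b => G ij.1 ij.2 (rect a b p)) 0 1) 0 1) (I p).
  by move=> [i j]; have [I h1 h2] := rect_integral i j; exists I.
pose I i j := I0 (i, j); have hI i j := h0 (i, j).
exists (fun p : V * V => \sum_i \sum_j p.1 0 i * p.2 0 j * I i j p).
  have oBB := @BB_open R m.
  apply: holo_sum => // i; apply: holo_sum => // j.
  apply: holoM (hI i j).1; exact: holoM (holo_coord1 i) (holo_coord2 j).
move=> p hp; have -> : (fun n => mean n (fun a => mean n (mixed_form p a) 0 1) 0 1) =
    (fun n => \sum_i \sum_j p.1 0 i * p.2 0 j *
       mean n (fun a => mean n (fun b => G i j (rect a b p)) 0 1) 0 1).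
  apply/funext => n; rewrite /mixed_form.
  have e a : mean n (fun b => \sum_i \sum_j p.1 0 i * p.2 0 j * G i j (rect a b p)) 0 1 =
      \sum_i \sum_j p.1 0 i * p.2 0 j * mean n (fun b => G i j (rect a b p)) 0 1.
    rewrite mean_sum; apply: eq_bigr => i _; rewrite mean_sum; apply: eq_bigr => j _.
    by rewrite meanZ.
  rewrite (eq_mean n (g := fun a => \sum_i \sum_j p.1 0 i * p.2 0 j *
    mean n (fun b => G i j (rect a b p)) 0 1)) //.
  rewrite mean_sum; apply: eq_bigr => i _; rewrite mean_sum; apply: eq_bigr => j _.
  by rewrite meanZ.
by apply: climit_sum => i; apply: climit_sum => j; apply/climitMl/(hI i j).2.
Qed.

(** Approximating both integrals by the same mean, N becomes a combination of the
    kernel G over the points (x z, i) with coefficients z_i c. *)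
Lemma potential_pdk N : (forall p, BB p ->
    climit (fun n => mean n (fun a => mean n (mixed_form p a) 0 1) 0 1) (N p)) ->
  pdk B (fun z w => N (z, conjv w)).
Proof.
move=> hN; apply: (@pdk_limit _ _ _ (fun n z w => mean n (fun a =>
    mean n (mixed_form (z, conjv w) a) 0 1) 0 1)); last first.
  by move=> z w Bz Bw; apply: hN; split=> //; apply/unit_ball_conjv.
move=> n; have [J [x [c [hx hc]]]] := @mean_weights R n 0 1 ler01.
have x01 s : 0 <= x s <= 1 by have := hx s; rewrite add0r.
have cj (t : R) : conjC t%:C = t%:C :> C := conjc_real t.
pose g (z : V) (s : J * 'I_m) : V * 'I_m := ((x s.1)%:C *: z, s.2).
pose f (z : V) (s : J * 'I_m) : C := z 0 s.2 * (c s.1)%:C.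
have := pdk_combination (D := B) (g := g) f G_pdk.
move=> /(_ (fun z s Bz => unit_ballZ Bz (x01 s.1))); apply: eq_pdk => z w _ _.
rewrite hc -(pair_bigA _ (fun s i => \sum_b G (g z (s, i)).2 (g w b).2
   ((g z (s, i)).1, conjv (g w b).1) * f z (s, i) * conjC (f w b))) /=.
apply: eq_bigr => s _; rewrite hc mulr_suml.
under [RHS]eq_bigr => i _ do rewrite -(pair_bigA _ (fun s' j => G i j
   ((x s)%:C *: z, conjv ((x s')%:C *: w)) * f z (s, i) * conjC (f w (s', j)))) /=.
rewrite [RHS]exchange_big; apply: eq_bigr => s' _ /=.
rewrite /mixed_form !mulr_suml; apply: eq_bigr => i _; rewrite !mulr_suml.
apply: eq_bigr => j _; rewrite /rect /f /= mxE conjvZ cj rmorphM /= cj.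
by ring.
Qed.

End Potential.
(** * Positivity of the mixed derivatives implies infinite divisibility *)

Section MixedPositive.
Context {R : realType} {m : nat}.
Notation C := R[i].
Notation V := 'rV[C]_m.
Notation B := (@unit_ball R m).
Notation BB := (@BB R m).
Notation nVV := (@nVV R m).

Variable L : V -> V -> C.
Hypothesis L_holo : holo nVV BB (sharp L).
Hypothesis L_gt0 : forall w, B w -> 0 < L w w.
Hypothesis L_mixed : pos_def_function B (ddbar_log L).
Notation F := (sharp L).

(** The region where log F is given by the principal branch: a neighbourhood of the
    points (w, conj w). *)
Definition log_region : set (V * V) := [set p | BB p /\ 0 < complex.Re (F p)].

Lemma log_region_open : is_open nVV log_region.
Proof.
move=> p [hp Fp]; have e0 : 0 < complex.Re (F p) / 2 by lra.
have [r r0 hr] := holo_cont L_holo hp e0; exists r => // q /hr[hq Fq]; split=> //.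
have := le_trans (cmod_Re _) Fq; rewrite raddfB /= ler_norml; lra.
Qed.

Lemma log_region_diag w : B w -> log_region (w, conjv w).
Proof.
move=> Bw; split; first exact/BB_diag.
by rewrite sharp_diag; have := L_gt0 Bw; rewrite ltcE => /andP[].
Qed.

Lemma log_region_neq0 p : log_region p -> F p != 0.
Proof. by case=> _; apply: contraTneq => ->; rewrite /= ltxx. Qed.

Lemma log_region_holo : holo nVV log_region F.
Proof. by apply: holo_subset log_region_open _ L_holo => p []. Qed.

Definition log_F p := clog (F p).

Lemma log_F_holo : holo nVV log_region log_F.
Proof.
apply: (holo_comp log_region_holo) => p [_ Fp].
by exists (F p)^-1; apply: cdiff_clog.
Qed.

Lemma log_F_mixed i j p : log_region p ->
  dirD (dz i) (dirD (dw j) log_F) p = ddlog F i j p.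
Proof.
move=> hp; have hF := log_region_holo; have hj := holo_dirD (dw j) hF.
rewrite (eq_dirD (dz i) log_region_open (g := fun q => dirD (dw j) F q * (F q)^-1)) //.
  have F0 := log_region_neq0 hp.
  rewrite (dirDM _ hj (holoV hF log_region_neq0) hp) (dirDV _ hF hp F0) /ddlog.
  move: (dirD (dz i) (dirD (dw j) F) _) (dirD (dw j) F _) (dirD (dz i) F _) => a b c.
  by move: (F p) F0 => d d0; field.
move=> q hq; rewrite /log_F (dirD_comp _ hF hq (cdiff_clog _)) ?[_^-1 * _]mulrC //.
by case: hq.
Qed.

(** The polarization of the matrix of mixed derivatives.  It agrees with ddlog F
    first on the diagonal; after multiplication by F^2 both sides are holomorphic on
    B x B, hence agree there, zeros of F included. *)
Lemma mixed_kernel : exists G : 'I_m -> 'I_m -> V * V -> C,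
  [/\ forall i j, holo nVV BB (G i j),
      pdk [set x : V * 'I_m | B x.1] (fun x y => G x.2 y.2 (x.1, conjv y.1)),
      forall i j z w, B z -> B w -> cmod (G i j (z, w)) <=
        complex.Re (G i i (z, conjv z)) + complex.Re (G j j (conjv w, w)) &
      forall i j p, log_region p -> G i j p = ddlog F i j p].
Proof.
have [Gt [_ Gd] pG] := L_mixed; have /pos_formP[_ fG] := pG.
have GdE w i j : B w -> Gt w w i j = ddlog F i j (w, conjv w).
  by move=> Bw; rewrite Gd // (ddbar_logE i j L_holo L_gt0 Bw).
pose G i j := sharp (fun z w => Gt z w i j).
have hG i j : holo nVV BB (G i j).
  apply: (pos_def_holo i j pG) => k w Bw.
  have hd := ddlog_holo k k log_region_holo log_region_neq0.
  have [[r [M [r0 hr]]] _] := hd _ (log_region_diag Bw).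
  exists (r / 2), M; split=> [|q Bq hq]; first by lra.
  have [|_ dM] := hr (q, conjv q); last first.
    by rewrite GdE //; apply: le_trans (ler_norm _) (le_trans (cmod_Re _) dM).
  have -> : (q, conjv q) - (w, conjv w) = (q - w, conjv (q - w)).
    by apply/pair_equal_spec; rewrite conjvB.
  by rewrite nVVE l1_conjv; lra.
have GE i j p : BB p -> F p ^+ 2 * G i j p =
    dirD (dz i) (dirD (dw j) F) p * F p - dirD (dw j) F p * dirD (dz i) F p.
  have hi := holo_dirD (dz i) L_holo; have hj := holo_dirD (dw j) L_holo.
  have h1 := holoM (holoX 2 L_holo) (hG i j).
  have h2 := holoB (holoM (holo_dirD (dz i) hj) L_holo) (holoM hj hi).
  apply: (polarization_unique h1 h2) => w Bw.
  have -> : G i j (w, conjv w) = ddlog F i j (w, conjv w).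
    by rewrite -GdE // /G sharp_diag.
  rewrite /ddlog mulrC mulfVK // expf_neq0 //.
  exact: log_region_neq0 (log_region_diag Bw).
exists G; split=> // [||i j p hp].
- have := iffLR (pos_form_pdk _) fG; apply: eq_pdk => x y _ _.
  by rewrite /G /sharp /= conjvK.
- move=> i j z w Bz Bw; have Bw' : B (conjv w) by apply/unit_ball_conjv.
  by have [_] := pos_form_entry i j fG Bz Bw'; rewrite /G /sharp /= conjvK.
rewrite /ddlog -(GE i j p hp.1) mulrC mulKf // expf_neq0 //.
exact: log_region_neq0 hp.
Qed.

Lemma pair_zero : (0, conjv 0) = 0 :> V * V.
Proof. by apply/pair_equal_spec; split=> //; apply/rowP => i; rewrite !mxE rmorph0. Qed.

Lemma log_region0 : log_region 0.
Proof. by have := log_region_diag (@unit_ball0 R m); rewrite pair_zero. Qed.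

Lemma sum_dz (v : V) : \sum_i v 0 i *: dz i = (v, 0) :> V * V.
Proof.
rewrite [LHS]surjective_pairing; congr (_, _).
  rewrite (raddf_sum fst) [RHS]row_sum_delta; exact: eq_bigr.
by rewrite (raddf_sum snd) big1 // => i _; rewrite /= scaler0.
Qed.

Lemma sum_dw (v : V) : \sum_i v 0 i *: dw i = (0, v) :> V * V.
Proof.
rewrite [LHS]surjective_pairing; congr (_, _); last first.
  rewrite (raddf_sum snd) [RHS]row_sum_delta; exact: eq_bigr.
by rewrite (raddf_sum fst) big1 // => i _; rewrite /= scaler0.
Qed.

Section Potential.
Variable G : 'I_m -> 'I_m -> V * V -> C.
Hypothesis G_mixed : forall i j p, log_region p -> G i j p = ddlog F i j p.
Variable N : V * V -> C.
Hypothesis N_holo : holo nVV BB N.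
Hypothesis N_limit : forall p, BB p ->
  climit (fun n => mean n (fun a => mean n (mixed_form G p a) 0 1) 0 1) (N p).

Lemma mixed_form_log p a b : log_region (rect a b p) ->
  dirD (p.1, 0) (dirD (0, p.2) log_F) (rect a b p) = mixed_form G p a b.
Proof.
move=> hq; have hl := log_F_holo; have hD v := holo_dirD v hl.
rewrite -[X in dirD X]sum_dz (dirD_sum _ _ _ (hD _) hq) /mixed_form.
apply: eq_bigr => i _.
have e x : log_region x -> dirD (0, p.2) log_F x = \sum_j p.2 0 j * dirD (dw j) log_F x.
  by move=> hx; rewrite -[X in dirD X]sum_dw (dirD_sum _ _ _ hl hx).
rewrite (eq_dirD (dz i) log_region_open e hq).
have -> : dirD (dz i) (fun x => \sum_j p.2 0 j * dirD (dw j) log_F x) (rect a b p) =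
    \sum_j p.2 0 j * dirD (dz i) (dirD (dw j) log_F) (rect a b p).
  elim: (index_enum _) => [|j r IH].
    rewrite big_nil (eq_dirD _ log_region_open (g := fun=> 0)) ?dirD_cst //.
    by move=> x _; rewrite big_nil.
  rewrite (eq_dirD _ log_region_open (g := fun x => p.2 0 j * dirD (dw j) log_F x +
    \sum_(j <- r) p.2 0 j * dirD (dw j) log_F x)) //; last by move=> x _; rewrite big_cons.
  have hs : holo nVV log_region (fun x => \sum_(j <- r) p.2 0 j * dirD (dw j) log_F x).
    by apply: holo_sum log_region_open _ => k; apply: holoZ.
  have hc := holo_cst (p.2 0 j) log_region_open.
  rewrite (dirDD _ (holoM hc (hD _)) hs hq) (dirDM _ hc (hD _) hq) dirD_cst mul0r add0r.
  by rewrite IH big_cons.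
rewrite mulr_sumr; apply: eq_bigr => j _.
by rewrite log_F_mixed // -G_mixed // mulrA.
Qed.

(** Near the origin the double integral telescopes, each cell being a second
    difference of log F up to third order. *)
Lemma potential_log : exists2 s : R, 0 < s & forall p, nVV p < s ->
  [/\ log_region p, log_region (p.1, 0), log_region (0, p.2) &
  N p = log_F p - log_F (p.1, 0) - log_F (0, p.2) + log_F 0].
Proof.
have [r [k [r0 hr]]] := second_difference log_F_holo log_region0.
have [s s0 [s1 sr]] := pos_below ltr01 r0.
have [r' r'0 hr'] := log_region_open log_region0.
have [s' s'0 [ss sr']] := pos_below s0 r'0; exists s' => // p hp.
pose Phi a b := log_F (rect a b p).
have near a b : 0 <= a <= 1 -> 0 <= b <= 1 -> nVV (rect a b p) < s'.
  by move=> ha hb; apply: le_lt_trans (rect_norm p ha hb) hp.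
have inP a b : 0 <= a <= 1 -> 0 <= b <= 1 -> log_region (rect a b p).
  by move=> ha hb; apply: hr'; rewrite subr0; apply: lt_trans (near a b ha hb) sr'.
have pE : nVV p = l1 m p.1 + l1 m p.2 by [].
have p1 := csn_ge0 (l1 m) p.1; have p2 := csn_ge0 (l1 m) p.2.
have u1 : nVV (p.1, 0) <= 1 by rewrite nVVE csn0; lra.
have v1 : nVV (0, p.2) <= 1 by rewrite nVVE csn0; lra.
have i0 : 0 <= (0 : R) <= 1 by rewrite lexx ler01.
have i1 : 0 <= (1 : R) <= 1 by rewrite lexx ler01.
have r11 : rect 1 1 p = p by rewrite /rect !scale1r; case: (p).
have r10 : rect 1 0 p = (p.1, 0) by rewrite /rect scale1r scale0r.
have r01 : rect 0 1 p = (0, p.2) by rewrite /rect scale1r scale0r.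
have r00 : rect 0 0 p = 0 by rewrite /rect !scale0r.
have L11 := inP 1 1 i1 i1; have L10 := inP 1 0 i1 i0; have L01 := inP 0 1 i0 i1.
rewrite r11 in L11; rewrite r10 in L10; rewrite r01 in L01; split=> //.
have cell a b (h : R) : 0 <= a <= 1 -> 0 <= b <= 1 -> 0 < h -> h < r ->
    cmod (Phi (a + h) (b + h) - Phi (a + h) b - Phi a (b + h) + Phi a b
          - (h ^+ 2)%:C * mixed_form G p a b) <= k * h ^+ 3.
  move=> ha hb h0 hlt; have [|_] := hr (rect a b p) (p.1, 0) (0, p.2) h _ u1 v1 h0 hlt.
    by rewrite subr0; apply: lt_trans (near a b ha hb) _; lra.
  rewrite mixed_form_log; last exact: inP.
  have -> : rect a b p + h%:C *: (p.1, 0) + h%:C *: (0, p.2) = rect (a + h) (b + h) p.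
    by apply/pair_equal_spec; rewrite /= !scaler0 !addr0 !rmorphD !scalerDl.
  have -> : rect a b p + h%:C *: (p.1, 0) = rect (a + h) b p.
    by apply/pair_equal_spec; rewrite /= !scaler0 !addr0 !rmorphD !scalerDl.
  have -> : rect a b p + h%:C *: (0, p.2) = rect a (b + h) p.
    by apply/pair_equal_spec; rewrite /= !scaler0 !addr0 !rmorphD !scalerDl.
  by [].
apply: climit_unique (N_limit L11.1) _ => e e0.
have k0 : 0 < e / (`|k| + 1) by rewrite divr_gt0 // ltr_wpDl.
have [t t0 [tr tk]] := pos_below r0 k0; have [n0 hn0] := half_pow_small t0.
exists n0 => n n0n; have e20 : 0 < 2 ^- n :> R by rewrite invr_gt0 exprn_gt0.
have nt : 2 ^- n < t :> R.
  by apply: le_lt_trans hn0; rewrite lef_pV2 ?posrE ?exprn_gt0 // ler_weXn2l // ler1n.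
have e2 : 1 / 2 ^+ n = 2 ^- n :> R by rewrite mul1r.
(* summing the cells of one row, then the rows *)
have row a : 0 <= a -> a + 2 ^- n <= 1 -> cmod (Phi (a + 2 ^- n) 1 - Phi (a + 2 ^- n) 0
    - Phi a 1 + Phi a 0 - (2 ^- n)%:C * mean n (mixed_form G p a) 0 1) <= k * 2 ^- n * 2 ^- n.
  move=> a0 an; have := @mean_additive R (fun b y => Phi (a + 2 ^- n) (b + y) - Phi a (b + y)
      - Phi (a + 2 ^- n) b + Phi a b)
    (fun b => (2 ^- n)%:C * mixed_form G p a b) n 0 1 (k * 2 ^- n * 2 ^- n) ler01.
  rewrite meanZ mulr1 e2 add0r mul1r => H.
  have -> : Phi (a + 2 ^- n) 1 - Phi (a + 2 ^- n) 0 - Phi a 1 + Phi a 0 =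
      Phi (a + 2 ^- n) 1 - Phi a 1 - Phi (a + 2 ^- n) 0 + Phi a 0.
    by move: (Phi _ _) (Phi _ _) (Phi _ _) (Phi _ _) => x1 x2 x3 x4; ring.
  apply: H => [x y|x x0 xn].
    have -> : x + y / 2 + y / 2 = x + y by field.
    move: (Phi _ _) (Phi _ _) (Phi _ _) (Phi _ _) (Phi _ _) (Phi _ _) => x1 x2 x3 x4 x5 x6.
    by ring.
  have le1 (y : R) : 0 <= y -> y + 2 ^- n <= 1 -> 0 <= y <= 1.
    by move=> -> yn; apply: le_trans yn; rewrite lerDl ltW.
  have := cell a x (2 ^- n) (le1 a a0 an) (le1 x x0 xn) e20 (lt_trans nt tr).
  congr (_ <= _); last by rewrite [_ ^+ 3]exprSr expr2 !mulrA.
  congr cmod; rewrite expr2 rmorphM /=.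
  move: (mixed_form _ _ _ _) (Phi _ _) (Phi _ _) (Phi _ _) (Phi _ _) => x0' x1 x2 x3 x4.
  by ring.
have := @mean_additive R (fun a y => Phi (a + y) 1 - Phi (a + y) 0 - Phi a 1 + Phi a 0)
  (fun a => mean n (mixed_form G p a) 0 1) n 0 1 (k * 2 ^- n) ler01.
rewrite mulr1 e2 add0r mul1r => H.
rewrite cmodBC; apply: le_trans (_ : k * 2 ^- n <= e); last first.
  have : 2 ^- n * (`|k| + 1) < e by rewrite -ltr_pdivlMr ?ltr_wpDl // (lt_trans nt).
  have := ler_norm k; move: (2 ^- n) e20 => x x0 kx xe; apply: ltW; apply: le_lt_trans xe.
  by rewrite mulrC ler_pM2l //; lra.
have -> : log_F p - log_F (p.1, 0) - log_F (0, p.2) + log_F 0 = 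
    Phi 1 1 - Phi 1 0 - Phi 0 1 + Phi 0 0 by rewrite /Phi r11 r10 r01 r00.
apply: H => [x y|x x0 xn]; last exact: row.
have -> : x + y / 2 + y / 2 = x + y by field.
move: (Phi _ _) (Phi _ _) (Phi _ _) (Phi _ _) (Phi _ _) (Phi _ _) => x1 x2 x3 x4 x5 x6.
by ring.
Qed.

(** The identity propagates from a neighbourhood of the origin, in exponential
    form, to the whole of B x B. *)
Lemma potential_exp p : BB p -> F p * F 0 = F (p.1, 0) * F (0, p.2) * cexp (N p).
Proof.
move=> hp; have oBB := @BB_open R m.
have BB0 : BB 0 by split; apply: unit_ball0.
have pre (A : V * V -> V * V) : (forall q (z : C) v, A (q + z *: v) = A q + z *: A v) ->
    (forall v, nVV (A v) <= 1 * nVV v) -> (forall q, BB q -> BB (A q)) ->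
    holo nVV BB (fun q => F (A q)).
  move=> AA A1 AB; apply: holo_subset oBB AB _.
  exact: (holo_affine ler01 AA A1 L_holo).
have n1 (q : V * V) := csn_ge0 (l1 m) q.1; have n2 (q : V * V) := csn_ge0 (l1 m) q.2.
have h1 : holo nVV BB (fun q => F (q.1, 0)).
  apply: (pre (fun q => (q.1, 0))) => [q z v|v|q [q1 q2]].
  - by apply/pair_equal_spec; rewrite /= scaler0 addr0.
  - by rewrite nVVE csn0 mul1r addr0 -[nVV v]/(l1 m v.1 + l1 m v.2) lerDl.
  - by split=> //; apply: unit_ball0.
have h2 : holo nVV BB (fun q => F (0, q.2)).
  apply: (pre (fun q => (0, q.2))) => [q z v|v|q [q1 q2]].
  - by apply/pair_equal_spec; rewrite /= scaler0 addr0.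
  - by rewrite nVVE csn0 mul1r add0r -[nVV v]/(l1 m v.1 + l1 m v.2) lerDr.
  - by split=> //; apply: unit_ball0.
have hN : holo nVV BB (fun q => cexp (N q)).
  by apply: (holo_comp N_holo) => q _; eexists; apply: cdiff_cexp.
have hH := holoB (holoM L_holo (holo_cst (F 0) oBB)) (holoM (holoM h1 h2) hN).
apply/eqP; rewrite -subr_eq0; apply/eqP.
rewrite -[p in LHS]add0r -[LHS]/((fun q => F q * F 0 - F (q.1, 0) * F (0, q.2) * cexp (N q)) (0 + p)).
apply: (holo_identity hH) => [t ht|].
  by have := BB_convex BB0 hp ht; rewrite subr0.
have [s s0 hs] := potential_log; have p0 := csn_ge0 nVV p.
exists (s / (nVV p + 1)) => [|z]; first by rewrite divr_gt0 //; lra.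
rewrite ltr_pdivlMr; last by lra.
move=> hz; have [|P11 P10 P01 ->] := hs (0 + z *: p).
  by rewrite add0r csnZ; have := cmod_ge0 z; lra.
have P00 := log_region0.
rewrite -(clogK P11.2) -(clogK P10.2) -(clogK P01.2) -(clogK P00.2) -!cexpD.
apply/eqP; rewrite subr_eq0; apply/eqP; congr cexp; rewrite /log_F.
by move: (clog _) (clog _) (clog _) (clog _) => a b c d; ring.
Qed.

End Potential.

End MixedPositive.
(** * Powers of the kernel *)

Section Powers.
Context {R : realType} {m : nat}.
Notation C := R[i].
Notation V := 'rV[C]_m.
Notation B := (@unit_ball R m).
Notation BB := (@BB R m).
Notation nVV := (@nVV R m).

Variable L : V -> V -> C.
Hypothesis L_holo : holo nVV BB (sharp L).
Hypothesis L_gt0 : forall w, B w -> 0 < L w w.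
Hypothesis L_herm : forall z w, B z -> B w -> L w z = conjC (L z w).
Hypothesis L_mixed : pos_def_function B (ddbar_log L).
Notation F := (sharp L).

(** On the diagonal potential_exp reads L(z,z) L(0,0) = |F(z,0)|^2 e^N(z,z), so that
    F(z,0) does not vanish and has a logarithm h.  Together with N this gives a
    logarithm of L. *)
Lemma global_log : exists (N : V * V -> C) (h : V -> C) (c : R),
  [/\ holo nVV BB N, holo (l1 m) B h, pdk B (fun z w => N (z, conjv w)) &
      forall w, B w -> L w w = cexp (N (w, conjv w) + h w + conjC (h w) - c%:C)].
Proof.
have [G [hG pG bG GE]] := mixed_kernel L_holo L_gt0 L_mixed.
have [N hN limN] := potential_exists hG bG.
have FE := potential_exp L_holo L_gt0 GE hN limN.
have c0 : conjv 0 = 0 :> V by apply/rowP => i; rewrite !mxE rmorph0.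
have B0 := @unit_ball0 R m; have F00 : F 0 = L 0 0 by rewrite -sharp_diag c0.
pose f z := F (z, 0); have fL z : f z = L z 0 by rewrite /f /sharp /= c0.
have diag z : B z -> L z z * L 0 0 = f z * conjC (f z) * cexp (N (z, conjv z)).
  move=> Bz; have := FE (z, conjv z) (iffRL (BB_diag z) Bz).
  rewrite sharp_diag F00 -/(f z) => ->; congr (_ * _ * _).
  by rewrite fL /sharp /= conjvK; apply: L_herm.
have f0 z : B z -> f z != 0.
  move=> Bz; apply: contraTneq (mulr_gt0 (L_gt0 Bz) (L_gt0 B0)) => fz.
  by rewrite diag // fz !mul0r ltxx.
have hf : holo (l1 m) B f.
  apply: (@holo_subset _ _ _ ((fun z => (z, 0)) @^-1` BB)); [exact: unit_ball_open|by []|].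
  apply: (@holo_affine R _ _ (l1 m) nVV (fun z => (z, 0)) (fun z => (z, 0)) 1 BB F) => //.
    by move=> p z v; apply/pair_equal_spec; rewrite /= scaler0 addr0.
  by move=> v; rewrite nVVE csn0 addr0 mul1r.
have Ref : 0 < complex.Re (f 0).
  by rewrite fL; have := L_gt0 B0; rewrite ltcE => /andP[].
have [h hh fh] := log_branch hf f0 Ref.
exists N, h, (ln (complex.Re (L 0 0))); split=> //; first exact: (@potential_pdk R m G pG N limN).
move=> w Bw; have L00 : L 0 0 = cexp (ln (complex.Re (L 0 0)))%:C.
  rewrite cexp_real lnK ?posrE -?fL //; rewrite fL; have := L_gt0 B0.
  by case: (L 0 0) => a b; rewrite ltcE /= => /andP[/eqP -> _].
have L0n : L 0 0 != 0 by rewrite gt_eqF ?L_gt0.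
apply: (mulIf L0n); rewrite diag // fh // -cexpJ {2}L00 -!cexpD.
by congr cexp; move: (N _) (h _) (ln _)%:C => a b d; ring.
Qed.

(** The power L^t is the exponential of t times the global logarithm: Schur's
    theorem handles the exponential of the positive definite part, and the rest
    contributes a kernel of rank one. *)
Lemma divisible_of_mixed t : 0 < t -> pos_def_function B
  (scalar_fun (fun w => (complex.Re (L w w) `^ t)%:C)).
Proof.
move=> t0; have [N [h [c [hN hh pN LE]]]] := global_log.
pose k z w := cexp (t%:C * (N (z, conjv w) + h z + conjC (h w) - c%:C)).
have oBB := @BB_open R m.
have hcj : holo (l1 m) B (fun w => conjC (h (conjv w))).
  by have := holo_conj hh; rewrite unit_ball_conjv_preim.
have k_holo : holo nVV BB (sharp k).
  have hE : holo nVV BB (fun p => t%:C * (N p + h p.1 + conjC (h (conjv p.2)) - c%:C)).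
    apply/holoZ/holoB; last exact: holo_cst.
    exact: holoD (holoD hN (holo_fst hh)) (holo_snd hcj).
  have := holo_comp hE (fun p _ => ex_intro _ _ (cdiff_cexp _)).
  by apply: eq_holo => p _; rewrite /sharp /k conjvK -surjective_pairing.
apply: (@pos_def_function_intro _ _ _ (scalar_kernel k)) => [i j||w Bw].
- by apply: eq_holo k_holo => p _; rewrite /sharp /scalar_kernel mxE (ord1 i) (ord1 j) eqxx mulr1n.
- pose g z := cexp (t%:C * (h z - (c / 2)%:C)).
  have pk : pdk B k.
    have tN : pdk B (fun z w => t%:C * N (z, conjv w)).
      by apply: pdkZ pN; rewrite lecR ltW.
    have := pdkM (pdk_cexp tN) (@pdk_rank1 R _ B g); apply: eq_pdk => z w _ _.
    have cj (x : R) : conjC x%:C = x%:C :> C := conjc_real x.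
    have cM a b : conjC (a * b) = conjC a * conjC b :> C by apply: rmorphM.
    have cB a b : conjC (a - b) = conjC a - conjC b :> C by apply: rmorphB.
    rewrite /k /g -cexpJ -!cexpD cM cB !cj; congr cexp.
    have -> : (c / 2)%:C = c%:C / 2 :> C by rewrite rmorphM /= fmorphV /= rmorph_nat.
    by move: (N _) (h _) (conjC _) t%:C c%:C => x1 x2 x3 x4 x5; field.
  move=> I u b hu; have := pk I (fun p => (u p).1) b hu; congr (_ <= _).
  apply: eq_bigr => p _; apply: eq_bigr => q _.
  by rewrite mxE (ord1 (u p).2) (ord1 (u q).2) eqxx mulr1n.
rewrite /scalar_kernel /scalar_fun; congr (_%:M).
set S := N (w, conjv w) + h w + conjC (h w) - c%:C.
have NR : 0 <= N (w, conjv w).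
  have := pN _ (fun _ : unit => w) (fun=> 1) (fun=> Bw).
  by rewrite (bigD1 tt) //= (bigD1 tt) //= !big1 ?addr0 ?rmorph1 ?mulr1 // => -[].
have SE : S = (complex.Re S)%:C.
  rewrite /S; move: NR; case: (N _) => a b; case: (h w) => a' b'.
  rewrite lecE /= => /andP[/eqP -> _]; apply/eqP; rewrite eq_complex /= eqxx /=.
  by rewrite add0r subrr oppr0 addr0.
rewrite /k -/S LE // -/S SE -rmorphM !cexp_real /= /powR gt_eqF ?expR_gt0 //.
by rewrite expRK.
Qed.

End Powers.
Lemma row_kernel_herm (R : realType) (m : nat) (K : 'rV[R[i]]_m -> 'rV[R[i]]_m -> R[i]) z w :
  pos_def_kernel (@unit_ball R m) (scalar_kernel K) -> unit_ball z -> unit_ball w ->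
  row_kernel K w z = conjC (row_kernel K z w).
Proof.
move=> /pos_formP[_ fK] Bz Bw; have [Kh _] := pos_form_entry 0 0 fK Bz Bw.
rewrite !mxE !mulr1n in Kh; rewrite /row_kernel Kh rmorphM rmorphB rmorph1; congr (_ * _).
congr (_ - _); rewrite /vdot rmorph_sum; apply: eq_bigr => k _.
by rewrite rmorphM /= conjCK mulrC.
Qed.

Theorem corollary4p3 (R : realType) (m : nat) (m_gt0 : (0 < m)%N)
    (K : 'rV[R[i]]_m -> 'rV[R[i]]_m -> R[i])
    (K_pd : pos_def_kernel (@unit_ball R m) (scalar_kernel K))
    (K_gt0 : forall w : 'rV[R[i]]_m, unit_ball w -> 0 < K w w)
    (H : hilbert R) (ev : H -> 'rV[R[i]]_m -> R[i])
    (H_rkhs : is_rkhs (@unit_ball R m) K ev)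
    (M Mstar : 'I_m -> {linear H -> H})
    (M_mult : coordinate_multiplication (@unit_ball R m) ev M)
    (Mstar_adj : adjoint_tuple M Mstar)
    (Mstar_B1 : in_B1 (@unit_ball R m) Mstar) :
  (pos_def_function (@unit_ball R m)
     (ddbar_log (fun z w => (1 - vdot z w) * K z w))
   <-> pd_le (@unit_ball R m) (curvature K) (curvature drury_arveson))
  /\
  (pos_def_function (@unit_ball R m)
     (ddbar_log (fun z w => (1 - vdot z w) * K z w))
   <-> inf_div_row_contraction K).
Proof.
have K_holo : holo (@nVV R m) (@BB R m) (sharp K).
  apply: (scalar_kernel_holo K_pd).
  exact: kernel_diag_bounded K_pd.1 K_gt0 H_rkhs M_mult Mstar_adj Mstar_B1.
have L_holo := row_kernel_holo K_holo; have L_gt0 := row_kernel_gt0 K_gt0.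
split; first exact: pd_le_curvature.
split=> [mixed|[_ _ div]]; last exact: (divisible_ddbar L_holo L_gt0 div).
split=> //.
  by apply: holo_sesqui => i j; apply: eq_holo L_holo => p _;
     rewrite /sharp mxE (ord1 i) (ord1 j) eqxx mulr1n.
move=> t; apply: (divisible_of_mixed L_holo L_gt0 _ mixed) => z w.
exact: row_kernel_herm.
Qed.
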